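(* Let $k$ be a commutative ring of characteristic $0$ and let $(A,\mu,\alpha)$ be a (multiplicative) hom-associative algebra over $k$. Then the pair $(H^\bullet_\alpha(A),H_\bullet^\alpha(A))$ of Hochschild cohomology and Hochschild homology of $A$, with the operations $\cup$, $[\ ,\ ]$, $i$ and $\mathcal L$ induced from the (co)chain-level operations described in the context, forms a precalculus.
   Context: All modules, linear maps and tensor products are over $k$. **Hom-associative algebras.** A (multiplicative) hom-associative algebra is a $k$-module $A$ with a bilinear map $\mu:A\otimes A\to A$, $(a,b)\mapsto a\cdot b$, and a linear map $\alpha:A\to A$ with $(a\cdot b)\cdot\alpha(c)=\alpha(a)\cdot(b\cdot c)$ and $\alpha(a\cdot b)=\alpha(a)\cdot\alpha(b)$. **Cochains.** For $p\ge1$, $\mathcal O(p)=C^p_\alpha(A)=\{f:A^{\otimes p}\to A\mid\alpha\circ f=f\circ\alpha^{\otimes p}\}$. For $f\in\mathcal O(p)$, $g\in\mathcal O(q)$, $1\le i\le p$, $$(f\circ_ig)(a_1,\dots,a_{p+q-1})=f(\alpha^{q-1}(a_1),\dots,\alpha^{q-1}(a_{i-1}),g(a_i,\dots,a_{i+q-1}),\alpha^{q-1}(a_{i+q}),\dots,\alpha^{q-1}(a_{p+q-1})).$$ Set $$[f,g]=\sum_{i=1}^p(-1)^{(q-1)(i-1)}f\circ_ig-(-1)^{(p-1)(q-1)}\sum_{i=1}^q(-1)^{(p-1)(i-1)}g\circ_if,\qquad f\cup g=(\mu\circ_2f)\circ_1g.$$ $H^\bullet_\alpha(A)$ (degrees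 $\ge1$, the complex starting in degree $1$) is the cohomology of the differential $f\mapsto[\mu,f]$, which up to sign is the Hochschild coboundary $(\delta_\alpha f)(a_1,\dots,a_{n+1})=\alpha^{n-1}(a_1)\cdot f(a_2,\dots,a_{n+1})+\sum_{i=1}^n(-1)^if(\alpha(a_1),\dots,a_i\cdot a_{i+1},\dots,\alpha(a_{n+1}))+(-1)^{n+1}f(a_1,\dots,a_n)\cdot\alpha^{n-1}(a_{n+1})$. The operations $\cup$ and $[\ ,\ ]$ make $H^\bullet_\alpha(A)$ a Gerstenhaber algebra. **Chains.** $\mathcal M(n)=A\otimes A^{\otimes n}$, $n\ge0$, with elements written $a_0\otimes a_1\cdots a_n$. For $f\in\mathcal O(p)$, $p\le n$, $1\le i\le n-p+1$, $$f\bullet_i(a_0\otimes a_1\cdots a_n)=\alpha^{p-1}(a_0)\otimes\alpha^{p-1}(a_1)\cdots\alpha^{p-1}(a_{i-1})\,f(a_i,\dots,a_{i+p-1})\,\alpha^{p-1}(a_{i+p})\cdots\alpha^{p-1}(a_n),$$ and for $p\le n+1$, $f\bullet_0(a_0\otimes a_1\cdots a_n)=f(a_0,\dots,a_{p-1})\otimes\alpha^{p-1}(a_p)\cdots\alpha^{p-1}(a_n)$. Let $t(a_0\otimes a_1\cdots a_n)=a_n\otimes a_0a_1\cdots a_{n-1}$. $H_\bullet^\alpha(A)$ is the homology of $(\mathcal M,d^\alpha)$ with $d^\alpha(a_0\otimes a_1\cdots a_n)=a_0\cdot a_1\otimes\alpha(a_2)\cdots\alpha(a_n)+\sum_{i=1}^{n-1}(-1)^i\alpha(a_0)\otimes\alpha(a_1)\cdots(a_i\cdot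 a_{i+1})\cdots\alpha(a_n)+(-1)^na_n\cdot a_0\otimes\alpha(a_1)\cdots\alpha(a_{n-1})$. **Operations.** For $f\in\mathcal O(p)$, $x\in\mathcal M(n)$: $i_fx=(\mu\circ_2f)\bullet_0x$, i.e. $i_f(a_0\otimes a_1\cdots a_n)=\alpha^{p-1}(a_0)\cdot f(a_1,\dots,a_p)\otimes\alpha^p(a_{p+1})\cdots\alpha^p(a_n)$ (zero if $p>n$); $\mathcal L_fx=\sum_{i=1}^{n-p+1}(-1)^{(p-1)(i-1)}f\bullet_ix+\sum_{i=1}^p(-1)^{n(i-1)+p-1}f\bullet_0t^{i-1}(x)$ if $p<n+1$; $\mathcal L_fx=(-1)^{p-1}\sum_{i=0}^n(-1)^{in}f\bullet_0t^i(x)$ if $p=n+1$; zero if $p>n+1$. **Precalculus.** A Gerstenhaber algebra is a graded $k$-module $\mathcal A=\oplus\mathcal A^i$ with a graded commutative associative product $\cup$ of degree $0$ and a degree $-1$ bracket making $\mathcal A^{\bullet+1}$ a graded Lie algebra, with $[f,g\cup h]=[f,g]\cup h+(-1)^{(p-1)q}g\cup[f,h]$ for $f\in\mathcal A^p,g\in\mathcal A^q$. A pair $(\mathcal A,\Omega)$, with $\Omega$ a graded $k$-module, is a precalculus if $\Omega$ has a graded $(\mathcal A,\cup)$-module structure $i:\mathcal A^p\otimes\Omega_n\to\Omega_{n-p}$ (so $i_{f\cup g}=i_f\circ i_g$) and a graded Lie module structure $\mathcal L:\mathcal A^{p+1}\otimes\Omega_n\to\Omega_{n-p}$ over $\mathcal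 A^{\bullet+1}$ (so $\mathcal L_{[f,g]}=\mathcal L_f\mathcal L_g-(-1)^{(p-1)(q-1)}\mathcal L_g\mathcal L_f$ for $f\in\mathcal A^p$, $g\in\mathcal A^q$), with $i_{[f,g]}=i_f\circ\mathcal L_g-(-1)^{p(q+1)}\mathcal L_g\circ i_f$ for $f\in\mathcal A^p$, $g\in\mathcal A^q$. *)

(* Defs.v *)
From HB Require Import structures.
From mathcomp Require Import all_boot all_order all_algebra.
From mathcomp Require Import zify.
From mathcomp Require Import boolp functions.
From mathcomp Require Import freeg.

Set Implicit Arguments.
Unset Strict Implicit.
Unset Printing Implicit Defensive.

Import Order.TTheory GRing.Theory Num.Theory.
Local Open Scope quotient_scope.
Local Open Scope ring_scope.

(* (-1)^z; only the parity of z matters, so taking `|z| is harmless. *)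
Definition sgn {k : comNzRingType} (z : int) : k := (-1) ^+ `|z|%N.

(* Transport of homogeneous elements along an equality of degrees. *)
Definition gcast (k : comNzRingType) (V : int -> lmodType k) (p q : int)
  (e : p = q) (x : V p) : V q := ecast r (V r) e x.

Lemma gcast_is_linear (k : comNzRingType) (V : int -> lmodType k) (p q : int)
  (e : p = q) : linear (@gcast k V p q e).
Proof. by case: _ / e. Qed.

HB.instance Definition _ (k : comNzRingType) (V : int -> lmodType k)
    (p q : int) (e : p = q) :=
  GRing.isLinear.Build k (V p) (V q) _ (@gcast k V p q e)
    (gcast_is_linear e).

Section Submodules.
Variables (k : comNzRingType) (V : lmodType k).

Inductive generated (G : V -> Prop) : V -> Prop :=
| generated0 : generated G 0
| generatedD c x y : G x -> generated G y -> generated G (c *: x + y).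

Definition submod_gen (G : V -> Prop) : {pred V} :=
  fun x => `[< generated G x >].

Lemma submod_gen_closed G : submod_closed (submod_gen G).
Proof.
split=> [|c x y /asboolP Gx /asboolP Gy]; apply/asboolP; first exact: generated0.
elim: Gx => [|d z t Gz _ IH]; first by rewrite scaler0 add0r.
by rewrite scalerDr scalerA -addrA; apply: generatedD.
Qed.

HB.instance Definition _ G :=
  GRing.isSubmodClosed.Build k V (submod_gen G) (submod_gen_closed G).

Lemma submod_gen_mem (G : V -> Prop) x : G x -> x \in submod_gen G.
Proof.
by move=> Gx; apply/asboolP; rewrite -[x]addr0 -[x]scale1r;
  apply: generatedD => //; apply: generated0.
Qed.

Variable S : submodClosed V.

Definition submod_pred : {pred V} := fun x => x \in S.

Lemma submod_pred_closed : zmod_closed submod_pred.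
Proof.
split=> [|x y Sx Sy]; first exact: (rpred0 S).
have Sy' : - y \in S by rewrite -scaleN1r; apply: rpredZ.
exact: (rpredD (Sx : x \in S) Sy').
Qed.

HB.instance Definition _ :=
  GRing.isZmodClosed.Build V submod_pred submod_pred_closed.

Definition quotmod := ring_quotient.Quotient.quot submod_pred.

HB.instance Definition _ := GRing.Zmodule.on quotmod.

Definition qclass (x : V) : quotmod := \pi_quotmod x.

Lemma qclassP x y : qclass x = qclass y <-> x - y \in S.
Proof.
have -> : (x - y \in S) = (x - y \in submod_pred) by [].
by rewrite ring_quotient.Quotient.idealrBE; split=> [/eqP|/eqP].
Qed.

Lemma qclassD x y : qclass (x + y) = qclass x + qclass y.
Proof. by rewrite /qclass piE. Qed.

Definition qscale (c : k) (x : quotmod) : quotmod := qclass (c *: repr x).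

Lemma qscaleE c x : qscale c (qclass x) = qclass (c *: x).
Proof.
apply/qclassP; rewrite -scalerBr rpredZ //; apply/qclassP.
by rewrite /qclass reprK.
Qed.

Lemma qclass_ind (P : quotmod -> Prop) : (forall x, P (qclass x)) -> forall x, P x.
Proof. by move=> H x; rewrite -[x]reprK. Qed.

Lemma qscaleA c d x : qscale c (qscale d x) = qscale (c * d) x.
Proof. by elim/qclass_ind: x => x; rewrite !qscaleE scalerA. Qed.

Lemma qscale1 : left_id 1 qscale.
Proof. by elim/qclass_ind => x; rewrite qscaleE scale1r. Qed.

Lemma qscaleDr : right_distributive qscale +%R.
Proof.
move=> c; elim/qclass_ind => x; elim/qclass_ind => y.
by rewrite -qclassD !qscaleE scalerDr qclassD.
Qed.

Lemma qscaleDl x : {morph qscale^~ x : c d / c + d}.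
Proof.
by move=> c d; elim/qclass_ind: x => x; rewrite !qscaleE scalerDl qclassD.
Qed.

HB.instance Definition _ := GRing.Zmodule_isLmodule.Build k quotmod
  qscaleA qscale1 qscaleDr qscaleDl.

Lemma qclass_is_linear : linear qclass.
Proof. by move=> c x y; rewrite qclassD -qscaleE. Qed.

HB.instance Definition _ :=
  GRing.isLinear.Build k V quotmod _ qclass qclass_is_linear.

End Submodules.

Section Homology.
Variables (k : comNzRingType) (U V W : lmodType k).
Variables (d1 : {linear U -> V}) (d2 : {linear V -> W}).

Definition ker_pred : {pred V} := fun x => d2 x == 0.

Lemma ker_closed : submod_closed ker_pred.
Proof.
split=> [|c x y /eqP x0 /eqP y0]; apply/eqP; first exact: linear0.
by rewrite linearP x0 y0 scaler0 addr0.
Qed.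

HB.instance Definition _ := GRing.isSubmodClosed.Build k V ker_pred ker_closed.

Record cycle := Cycle { cycle_val :> V; _ : cycle_val \in ker_pred }.

HB.instance Definition _ := [isSub for cycle_val].
HB.instance Definition _ := [Choice of cycle by <:].
HB.instance Definition _ := [SubChoice_isSubLmodule of cycle by <:].

Definition boundary : {pred cycle} :=
  fun z => `[< exists y : U, cycle_val z = d1 y >].

Lemma boundary_closed : submod_closed boundary.
Proof.
split=> [|c x y /asboolP[u xu] /asboolP[v yv]]; apply/asboolP.
  by exists 0; rewrite linear0.
by exists (c *: u + v); rewrite linearP /= -xu -yv.
Qed.

HB.instance Definition _ :=
  GRing.isSubmodClosed.Build k cycle boundary boundary_closed.

Definition homology : lmodType k := quotmod boundary.

(* x is a cycle and h is its class. *)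
Definition represents (h : homology) (x : V) : Prop :=
  exists2 z : cycle, cycle_val z = x & h = qclass boundary z.

End Homology.

Section Precalculus.
Variable k : comNzRingType.

Section Degrees.
Variables p q r n : int.

Lemma deg_cupA : p + q + r = p + (q + r). Proof. lia. Qed.
Lemma deg_brC : q + p - 1 = p + q - 1. Proof. lia. Qed.
Lemma deg_jacobi1 : p + q - 1 + r - 1 = p + (q + r - 1) - 1. Proof. lia. Qed.
Lemma deg_jacobi2 : q + (p + r - 1) - 1 = p + (q + r - 1) - 1. Proof. lia. Qed.
Lemma deg_leibniz1 : p + q - 1 + r = p + (q + r) - 1. Proof. lia. Qed.
Lemma deg_leibniz2 : q + (p + r - 1) = p + (q + r) - 1. Proof. lia. Qed.
Lemma deg_iD : n - q - p = n - (p + q). Proof. lia. Qed.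
Lemma deg_lie1 : n - q + 1 - p + 1 = n - (p + q - 1) + 1. Proof. lia. Qed.
Lemma deg_lie2 : n - p + 1 - q + 1 = n - (p + q - 1) + 1. Proof. lia. Qed.
Lemma deg_mix1 : n - q + 1 - p = n - (p + q - 1). Proof. lia. Qed.
Lemma deg_mix2 : n - p - q + 1 = n - (p + q - 1). Proof. lia. Qed.

End Degrees.

Definition bilinear_op (U V W : lmodType k) (op : U -> V -> W) : Prop :=
  (forall v, linear (op^~ v)) /\ (forall u, linear (op u)).

(* A graded module is a family indexed by int, its components being zero outside
   the degrees where the object lives; cup has degree 0 and br degree -1. *)
Record gerstenhaber (A : int -> lmodType k)
  (cup : forall p q, A p -> A q -> A (p + q))
  (br : forall p q, A p -> A q -> A (p + q - 1)) : Prop := Gerstenhaber {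
  cup_bilinear : forall p q, bilinear_op (@cup p q);
  br_bilinear : forall p q, bilinear_op (@br p q);
  cupA : forall p q r (f : A p) (g : A q) (h : A r),
    cup _ _ f (cup _ _ g h) = gcast (deg_cupA p q r) (cup _ _ (cup _ _ f g) h);
  cupC : forall p q (f : A p) (g : A q),
    cup _ _ f g = sgn (p * q) *: gcast (addrC q p) (cup _ _ g f);
  brC : forall p q (f : A p) (g : A q),
    br _ _ f g =
      - (sgn ((p - 1) * (q - 1)) *: gcast (deg_brC p q) (br _ _ g f));
  br_jacobi : forall p q r (f : A p) (g : A q) (h : A r),
    br _ _ f (br _ _ g h) =
      gcast (deg_jacobi1 p q r) (br _ _ (br _ _ f g) h) +
      sgn ((p - 1) * (q - 1)) *:
        gcast (deg_jacobi2 p q r) (br _ _ g (br _ _ f h));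
  br_cup : forall p q r (f : A p) (g : A q) (h : A r),
    br _ _ f (cup _ _ g h) =
      gcast (deg_leibniz1 p q r) (cup _ _ (br _ _ f g) h) +
      sgn ((p - 1) * q) *:
        gcast (deg_leibniz2 p q r) (cup _ _ g (br _ _ f h)) }.

Record precalculus (A Om : int -> lmodType k)
  (cup : forall p q, A p -> A q -> A (p + q))
  (br : forall p q, A p -> A q -> A (p + q - 1))
  (io : forall p n, A p -> Om n -> Om (n - p))
  (lie : forall p n, A p -> Om n -> Om (n - p + 1)) : Prop := Precalculus {
  precalculus_gerstenhaber : gerstenhaber cup br;
  io_bilinear : forall p n, bilinear_op (@io p n);
  lie_bilinear : forall p n, bilinear_op (@lie p n);
  io_cup : forall p q n (f : A p) (g : A q) (x : Om n),
    io _ _ (cup _ _ f g) x = gcast (deg_iD p q n) (io _ _ f (io _ _ g x));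
  lie_br : forall p q n (f : A p) (g : A q) (x : Om n),
    lie _ _ (br _ _ f g) x =
      gcast (deg_lie1 p q n) (lie _ _ f (lie _ _ g x)) -
      sgn ((p - 1) * (q - 1)) *:
        gcast (deg_lie2 p q n) (lie _ _ g (lie _ _ f x));
  io_br : forall p q n (f : A p) (g : A q) (x : Om n),
    io _ _ (br _ _ f g) x =
      gcast (deg_mix1 p q n) (io _ _ f (lie _ _ g x)) -
      sgn (p * (q + 1)) *:
        gcast (deg_mix2 p q n) (lie _ _ g (io _ _ f x)) }.

End Precalculus.

Record homAssocAlgebra (k : comNzRingType) := HomAssocAlgebra {
  hom_module :> lmodType k;
  hom_mul : {bilinear hom_module -> hom_module -> hom_module};
  hom_twist : {linear hom_module -> hom_module};
  hom_mulA : forall a b c, hom_mul (hom_mul a b) (hom_twist c) =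
                           hom_mul (hom_twist a) (hom_mul b c);
  hom_twistM : forall a b,
    hom_twist (hom_mul a b) = hom_mul (hom_twist a) (hom_twist b) }.

Section Hochschild.
Variables (k : comNzRingType) (A : homAssocAlgebra k).
Notation mul := (@hom_mul k A).
Notation alpha := (@hom_twist k A).

(* A map on A^m is represented by a function on all sequences that vanishes on
   those of length other than m.  The empty sequence never counts, so that for
   m <= 0 only the zero map is left. *)
Definition has_length (m : int) (s : seq A) : bool :=
  (0 < size s)%N && ((size s)%:Z == m).

Definition supported (V : lmodType k) (m : int) (F : seq A -> V) : Prop :=
  forall s, ~~ has_length m s -> F s = 0.

Definition multilinear (V : lmodType k) (F : seq A -> V) : Prop :=
  forall s1 s2 c x y,
    F (s1 ++ (c *: x + y) :: s2) = c *: F (s1 ++ x :: s2) + F (s1 ++ y :: s2).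

Lemma multilinear0 (V : lmodType k) (F : seq A -> V) s1 s2 :
  multilinear F -> F (s1 ++ 0 :: s2) = 0.
Proof.
move=> mF; have := mF s1 s2 (-1) 0 0.
by rewrite scaler0 addr0 scaleN1r addNr.
Qed.

(* With a_1 ... a_n the entries of s, the sequence
   alpha^{q-1}(a_1) ... alpha^{q-1}(a_i) g(a_{i+1}, ..., a_{i+q})
   alpha^{q-1}(a_{i+q+1}) ... alpha^{q-1}(a_n). *)
Definition splice (q : int) (g : seq A -> A) (i : nat) (s : seq A) : seq A :=
  map (iter (absz (q - 1)) alpha) (take i s)
    ++ g (take `|q|%N (drop i s))
    :: map (iter (absz (q - 1)) alpha) (drop (i + `|q|)%N s).

Section Cochains.
Variable p : int.

Definition is_cochain (f : seq A -> A) : Prop :=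
  [/\ supported p f, multilinear f & forall s, alpha (f s) = f (map alpha s)].

Definition cochain_pred : {pred (seq A -> A)} := fun f => `[< is_cochain f >].

Lemma cochain_closed : submod_closed cochain_pred.
Proof.
split=> [|c f g /asboolP[sf mf af] /asboolP[sg mg ag]]; apply/asboolP; split.
- by [].
- by move=> s1 s2 c x y; rewrite /= scaler0 addr0.
- by move=> s; rewrite /= linear0.
- move=> s ns; have -> : (c *: f + g) s = c *: f s + g s by [].
  by rewrite sf // sg // scaler0 addr0.
- move=> s1 s2 d x y.
  have E s : (c *: f + g) s = c *: f s + g s by [].
  rewrite !E mf mg !scalerDr !scalerA (mulrC c d) -!addrA.
  by congr (_ + _); rewrite addrCA.
- move=> s; have E t : (c *: f + g) t = c *: f t + g t by [].
  by rewrite !E linearP af ag.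
Qed.

HB.instance Definition _ :=
  GRing.isSubmodClosed.Build k (seq A -> A) cochain_pred cochain_closed.

Record cochain := Cochain
  { cochain_fun :> seq A -> A; _ : cochain_fun \in cochain_pred }.

HB.instance Definition _ := [isSub for cochain_fun].
HB.instance Definition _ := [Choice of cochain by <:].
HB.instance Definition _ := [SubChoice_isSubLmodule of cochain by <:].

Lemma cochainP (f : cochain) : is_cochain f.
Proof. by case: f => f Hf; apply/asboolP. Qed.

End Cochains.

Lemma iter_twist_linear n : linear (iter n alpha).
Proof. by elim: n => [|n IH] c x y //=; rewrite IH linearP. Qed.

Lemma splice_multilinear (V : lmodType k) (F : seq A -> V) q (g : cochain q) i :
  multilinear F -> multilinear (F \o splice q g i).
Proof.
move=> mF s1 s2 c x y; have [_ mg _] := cochainP g.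
set e := iter (absz (q - 1)) alpha; have le : linear e by exact: iter_twist_linear.
have [lt1|ge1] := ltnP (size s1) i.
  have [j -> {lt1}] : exists j, i = (size s1 + j.+1)%N.
    by exists (i - size s1).-1; lia.
  have E z : splice q g (size s1 + j.+1) (s1 ++ z :: s2) =
      map e s1 ++ e z :: (map e (take j s2) ++ g (take `|q|%N (drop j s2)) ::
        map e (drop (j + `|q|)%N s2)).
    rewrite /splice take_cat ltnNge leq_addr /= addKn /= map_cat /= -/e.
    rewrite !drop_cat !ltnNge leq_addr -addnA leq_addr /= !addKn /=.
    by rewrite -catA.
  by rewrite /= !E le mF.
have [lt2|ge2] := ltnP (size s1) (i + `|q|)%N.
  have E z : splice q g i (s1 ++ z :: s2) =
      map e (take i s1) ++ g (drop i s1 ++ z :: take (i + `|q| - size s1).-1 s2)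
        :: map e (drop (i + `|q| - size s1).-1 s2).
    have d : (i + `|q| - size s1)%N = (i + `|q| - size s1).-1.+1 by lia.
    have d' : (`|q| - size (drop i s1))%N = (i + `|q| - size s1).-1.+1.
      by rewrite size_drop; lia.
    have t1 : take i (s1 ++ z :: s2) = take i s1 by rewrite takel_cat.
    have t2 : drop i (s1 ++ z :: s2) = drop i s1 ++ z :: s2.
      rewrite drop_cat; case: ltnP => // ge; have -> : i = size s1 by lia.
      by rewrite subnn drop_size.
    rewrite /splice t1 t2 take_cat size_drop ltnNge.
    have -> /= : (size s1 - i <= `|q|)%N by lia.
    rewrite size_drop in d'; rewrite d' /= -/e; congr (_ ++ _ :: map e _).
    by rewrite drop_cat ltnNge (ltnW lt2) /= d.
  by rewrite /= !E mg mF.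
have E z : splice q g i (s1 ++ z :: s2) =
    (map e (take i s1) ++ g (take `|q|%N (drop i s1)) ::
      map e (drop (i + `|q|)%N s1)) ++ e z :: map e s2.
  have t1 : take i (s1 ++ z :: s2) = take i s1 by rewrite takel_cat.
  have t2 j : (j <= size s1)%N -> drop j (s1 ++ z :: s2) = drop j s1 ++ z :: s2.
    move=> lj; rewrite drop_cat; case: ltnP => // ge.
    have -> : j = size s1 by lia.
    by rewrite subnn drop_size.
  have le_i : (i <= size s1)%N by lia.
  rewrite /splice t1 !t2 // takel_cat; last by rewrite size_drop leq_subRL.
  by rewrite map_cat /= -catA.
by rewrite /= !E le mF.
Qed.

Lemma splice_supported (V : lmodType k) (F : seq A -> V) (m : int) q
    (g : cochain q) i (m' : int) :
  m' = m + q - 1 -> multilinear F -> supported m F ->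
  supported m' (F \o splice q g i).
Proof.
move=> -> mF sF s ns /=; have [sg _ _] := cochainP g.
have [lg|nlg] := boolP (has_length q (take `|q|%N (drop i s))); last first.
  by rewrite /splice sg // multilinear0.
apply: sF; apply: contra ns; move: lg; rewrite /has_length.
rewrite size_cat /= !size_map !size_take_min !size_drop.
move=> /andP[h0 /eqP h1] /andP[_ /eqP h2].
by apply/andP; split; [lia | apply/eqP; lia].
Qed.

Lemma map_splice q (g : cochain q) i s :
  map alpha (splice q g i s) = splice q g i (map alpha s).
Proof.
have [_ _ ag] := cochainP g.
rewrite /splice map_cat /= ag -!map_take -!map_drop -!map_comp -map_take.
by congr (_ ++ _ :: _); apply: eq_map => x /=; rewrite -iterS iterSr.
Qed.

Lemma circ_subproof p q (f : cochain p) (g : cochain q) i :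
  f \o splice q g i.-1 \in cochain_pred (p + q - 1).
Proof.
have [sf mf af] := cochainP f; apply/asboolP; split.
- exact: (@splice_supported A f p q g i.-1 _ (erefl _) mf sf).
- exact: splice_multilinear.
- by move=> s /=; rewrite af map_splice.
Qed.

(* i counts from 1, whereas splice takes the number of entries before g. *)
Definition circ p q (f : cochain p) (i : nat) (g : cochain q) :
  cochain (p + q - 1) := Cochain (circ_subproof f g i).

Definition bracket p q (f : cochain p) (g : cochain q) : cochain (p + q - 1) :=
  \sum_(1 <= i < `|p|.+1) sgn ((q - 1) * (i%:Z - 1)) *: circ f i g
  - sgn ((p - 1) * (q - 1)) *:
      \sum_(1 <= i < `|q|.+1)
         sgn ((p - 1) * (i%:Z - 1)) *: gcast (deg_brC p q) (circ g i f).

Definition mu_fun (s : seq A) : A := if s is [:: a; b] then mul a b else 0.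

Lemma mu_subproof : mu_fun \in cochain_pred 2%:Z.
Proof.
apply/asboolP; split.
- by case=> [|a [|b [|c s]]].
- case=> [|a [|b s1]] s2 c x y /=.
  + by case: s2 => [|b [|d s2]] /=; rewrite ?scaler0 ?addr0 ?linearPl.
  + by case: s2 => [|d s2] /=; rewrite ?scaler0 ?addr0 ?linearPr.
  + by case: s1 => [|d s1] /=; rewrite scaler0 addr0.
- by case=> [|a [|b [|c s]]] /=; rewrite ?linear0 ?hom_twistM.
Qed.

Definition mu : cochain 2%:Z := Cochain mu_subproof.

Lemma deg_cup p q : 2%:Z + p - 1 + q - 1 = p + q. Proof. lia. Qed.

Definition cup_product p q (f : cochain p) (g : cochain q) : cochain (p + q) :=
  gcast (deg_cup p q) (circ (circ mu 2 f) 1 g).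

Lemma deg_delta p q : p + 1 = q -> 2%:Z + p - 1 = q. Proof. lia. Qed.

Definition delta p q (e : p + 1 = q) (f : cochain p) : cochain q :=
  gcast (deg_delta e) (bracket mu f).

Lemma circ_linearl p q (g : cochain q) i :
  linear (fun f : cochain p => circ f i g).
Proof. by move=> c x y; apply: val_inj; apply/funext => s. Qed.

Lemma circ_linearr p q (f : cochain p) i :
  linear (fun g : cochain q => circ f i g).
Proof.
move=> c x y; have [_ mf _] := cochainP f.
by apply: val_inj; apply/funext => s; apply: mf.
Qed.

Lemma sum_linear (U V : lmodType k) (r : seq nat) (F : nat -> U -> V) :
  (forall i, linear (F i)) -> linear (fun x => \sum_(i <- r) F i x).
Proof.
move=> lF c x y; rewrite scaler_sumr -big_split.
by apply: eq_bigr => i _; rewrite lF.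
Qed.

Lemma scale_linear (U V : lmodType k) (F : U -> V) a :
  linear F -> linear (fun x => a *: F x).
Proof. by move=> lF c x y; rewrite lF scalerDr !scalerA mulrC. Qed.

Lemma sub_linear (U V : lmodType k) (F G : U -> V) :
  linear F -> linear G -> linear (fun x => F x - G x).
Proof.
by move=> lF lG c x y; rewrite lF lG opprD scalerBr !addrA; congr (_ + _);
  rewrite -!addrA; congr (_ + _); rewrite addrC.
Qed.

Lemma bracket_linearr p q (f : cochain p) :
  linear (fun g : cochain q => bracket f g).
Proof.
apply: sub_linear; [|apply: scale_linear]; apply: sum_linear => i;
  apply: scale_linear; first exact: circ_linearr.
by move=> c x y; rewrite circ_linearl linearP.
Qed.

Lemma delta_is_linear p q (e : p + 1 = q) : linear (delta e).
Proof. by move=> c x y; rewrite /delta bracket_linearr linearP. Qed.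

HB.instance Definition _ p q (e : p + 1 = q) :=
  GRing.isLinear.Build k (cochain p) (cochain q) _ (delta e) (delta_is_linear e).

Definition cohomology (p : int) : lmodType k :=
  homology (delta (subrK 1 p)) (delta (erefl (p + 1))).

Definition generator (s : seq A) : {freeg (seq A) / k} := Freeg [:: (1, s)].

(* For n >= 0 these relations present A (x) A^{(x) n}, a_0 (x) a_1 ... a_n being
   the class of the generator a_0 :: a_1 :: ... :: a_n; generators of any other
   length are killed.  For n < 0 the module is zero. *)
Inductive tensor_relation (n : int) : {freeg (seq A) / k} -> Prop :=
| relation_linear s1 s2 c x y :
    tensor_relation n (generator (s1 ++ (c *: x + y) :: s2)
      - (c *: generator (s1 ++ x :: s2) + generator (s1 ++ y :: s2)))
| relation_length s : ~~ has_length (n + 1) s -> tensor_relation n (generator s).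

Definition chain (n : int) : lmodType k :=
  quotmod (submod_gen (tensor_relation n)).

Definition tensor (n : int) (s : seq A) : chain n := qclass _ (generator s).

Lemma tensor_multilinear n : multilinear (tensor n).
Proof.
move=> s1 s2 c x y; rewrite /tensor -linearP; apply/qclassP.
exact/submod_gen_mem/relation_linear.
Qed.

Lemma tensor_supported n : supported (n + 1) (tensor n).
Proof.
move=> s ns; rewrite /tensor -(linear0 (qclass _)); apply/qclassP.
by rewrite subr0; apply/submod_gen_mem/relation_length.
Qed.

Section Lift.
Variables (n : int) (V : lmodType k) (F : seq A -> V).

(* The linear map with tensor s |-> F s, for a multilinear F. *)
Definition tensor_lift (x : chain n) : V := fglift F (repr x).

Lemma fglift_linear : linear (fglift F).
Proof.
have lB := lift_is_additive F.
have l0 : fglift F 0 = 0 by have := lB 0 0; rewrite !subrr.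
have lN x : fglift F (- x) = - fglift F x.
  by have := lB 0 x; rewrite l0 !sub0r.
have lD x y : fglift F (x + y) = fglift F x + fglift F y.
  by have := lB x (- y); rewrite lN !opprK.
have lS (r : seq (seq A)) (G : seq A -> {freeg (seq A) / k}) :
    fglift F (\sum_(z <- r) G z) = \sum_(z <- r) fglift F (G z).
  by elim: r => [|z r IH]; rewrite ?big_nil // !big_cons lD IH.
move=> c x y; rewrite lD; congr (_ + _).
rewrite -[in RHS](freeg_sumE x) !lS scaler_sumr.
by apply: eq_bigr => z _; rewrite !liftU scalerA.
Qed.

Hypotheses (mF : multilinear F) (sF : supported (n + 1) F).

Lemma fglift_relation x :
  x \in submod_gen (tensor_relation n) -> fglift F x = 0.
Proof.
pose L := GRing.isLinear.Build k _ _ _ (fglift F) fglift_linear.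
pose lF : {linear {freeg (seq A) / k} -> V} := HB.pack (fglift F) L.
have lg s : lF (generator s) = F s by rewrite /= liftU scale1r.
move=> /asboolP; rewrite -[fglift F]/(lF : _ -> _).
elim=> [|c {}x y Rx _ IH]; first exact: linear0.
rewrite linearP IH addr0; case: Rx => [s1 s2 d a b|s ns].
  by rewrite linearB linearP !lg mF subrr scaler0.
by rewrite lg sF // scaler0.
Qed.

Lemma fglift_qclass x : tensor_lift (qclass _ x) = fglift F x.
Proof.
have h : repr (qclass (submod_gen (tensor_relation n)) x) - x
    \in submod_gen (tensor_relation n).
  by apply/qclassP; rewrite /qclass reprK.
have := fglift_relation h; rewrite -scaleN1r addrC fglift_linear scaleN1r.
by rewrite addrC => /eqP; rewrite subr_eq0 => /eqP.
Qed.

Lemma tensor_liftE s : tensor_lift (tensor n s) = F s.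
Proof. by rewrite fglift_qclass liftU scale1r. Qed.

Lemma tensor_lift_linear : linear tensor_lift.
Proof.
move=> c; elim/qclass_ind => x; elim/qclass_ind => y.
by rewrite -linearP !fglift_qclass fglift_linear.
Qed.

End Lift.

Definition bullet p n (f : cochain p) (i : nat) : chain n -> chain (n - p + 1) :=
  tensor_lift (fun s => tensor (n - p + 1) (splice p f i s)).

Lemma bullet_multilinear p n (f : cochain p) i :
  multilinear (fun s => tensor (n - p + 1) (splice p f i s)).
Proof. exact: splice_multilinear (@tensor_multilinear _). Qed.

Lemma bullet_supported p n (f : cochain p) i :
  supported (n + 1) (fun s => tensor (n - p + 1) (splice p f i s)).
Proof.
apply: (splice_supported f i _ (@tensor_multilinear _) (@tensor_supported _)).
lia.
Qed.

Lemma bulletE p n (f : cochain p) i s :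
  bullet f i (tensor n s) = tensor (n - p + 1) (splice p f i s).
Proof.
exact: (tensor_liftE (@bullet_multilinear p n f i) (@bullet_supported p n f i)).
Qed.

Lemma bullet_is_linear p n (f : cochain p) i : linear (@bullet p n f i).
Proof.
apply: tensor_lift_linear; first exact: bullet_multilinear.
exact: bullet_supported.
Qed.

HB.instance Definition _ p n (f : cochain p) i :=
  GRing.isLinear.Build k (chain n) (chain (n - p + 1)) _ (@bullet p n f i)
    (@bullet_is_linear p n f i).

Definition rotate n : chain n -> chain n :=
  tensor_lift (fun s => tensor n (rotr 1 s)).

Lemma rotate_multilinear n : multilinear (fun s => tensor n (rotr 1 s)).
Proof.
move=> s1 s2 c x y; case/lastP: s2 => [|s2 b].
  by rewrite -!cat_rcons !cats0 !rotr1_rcons -[_ :: s1]cat0s tensor_multilinear.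
have E z : rotr 1 (s1 ++ z :: rcons s2 b) = (b :: s1) ++ z :: s2.
  by rewrite -rcons_cons -rcons_cat rotr1_rcons.
by rewrite !E tensor_multilinear.
Qed.

Lemma rotate_supported n :
  supported (n + 1) (fun s => tensor n (rotr 1 s)).
Proof.
by move=> s ns; apply: tensor_supported; rewrite /has_length size_rotr.
Qed.

Lemma rotateE n s : rotate (tensor n s) = tensor n (rotr 1 s).
Proof.
exact: (tensor_liftE (@rotate_multilinear n) (@rotate_supported n)).
Qed.

Lemma rotate_is_linear n : linear (@rotate n).
Proof.
apply: tensor_lift_linear; first exact: rotate_multilinear.
exact: rotate_supported.
Qed.

HB.instance Definition _ n :=
  GRing.isLinear.Build k (chain n) (chain n) _ (@rotate n) (@rotate_is_linear n).

Lemma deg_d m n : m + 1 = n -> n - 2%:Z + 1 = m. Proof. lia. Qed.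

(* The last summand is mu bullet_0 t(x), that is, a_n a_0 (x) alpha(a_1) ... . *)
Definition dalpha n m (e : m + 1 = n) (x : chain n) : chain m :=
  gcast (deg_d e)
    (bullet mu 0 x + \sum_(1 <= i < `|n|%N) sgn i *: bullet mu i x
     + sgn n *: bullet mu 0 (rotate x)).

Lemma dalpha_is_linear n m (e : m + 1 = n) : linear (dalpha e).
Proof.
have addl (U V : lmodType k) (F G : U -> V) :
    linear F -> linear G -> linear (fun x => F x + G x).
  move=> lF lG c x y; rewrite lF lG scalerDr -!addrA; congr (_ + _).
  by rewrite addrCA.
have l : linear (fun x : chain n => bullet mu 0 x
   + \sum_(1 <= i < `|n|%N) sgn i *: bullet mu i x
   + sgn n *: bullet mu 0 (rotate x)).
  apply: (addl); first apply: (addl).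
  - exact: bullet_is_linear.
  - by apply: sum_linear => i; apply: scale_linear; apply: bullet_is_linear.
  - apply: scale_linear => c x y; rewrite (rotate_is_linear c x y).
    exact: (bullet_is_linear mu 0 c (rotate x) (rotate y)).
by move=> c x y; rewrite /dalpha l linearP.
Qed.

HB.instance Definition _ n m (e : m + 1 = n) :=
  GRing.isLinear.Build k (chain n) (chain m) _ (dalpha e) (dalpha_is_linear e).

Definition hochschild_homology (n : int) : lmodType k :=
  homology (dalpha (erefl (n + 1))) (dalpha (subrK 1 n)).

Lemma deg_i p n : n - (2%:Z + p - 1) + 1 = n - p. Proof. lia. Qed.

Definition contraction p n (f : cochain p) (x : chain n) : chain (n - p) :=
  if p <= n then gcast (deg_i p n) (bullet (circ mu 2 f) 0 x) else 0.

(* If p = n + 1, the first sum is empty and the second one is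
   (-1)^(p-1) \sum_(0 <= i <= n) (-1)^(i n) f bullet_0 t^i(x). *)
Definition lie_derivative p n (f : cochain p) (x : chain n) : chain (n - p + 1) :=
  if p <= n + 1 then
    \sum_(1 <= i < (absz (n - p + 1)).+1) sgn ((p - 1) * (i%:Z - 1)) *: bullet f i x
    + \sum_(1 <= i < `|p|%N.+1)
        sgn (n * (i%:Z - 1) + p - 1) *: bullet f 0 (iter i.-1 (@rotate n) x)
  else 0.

End Hochschild.

(* Main.v *)
(* With degrees shifted by one, the partial compositions make the cochains of A
   a nonsymmetric operad: the twists by alpha balance because cochains commute
   with alpha, and mu is an associative multiplication, mu o mu = 0.  The bracket
   is the commutator of the graded pre-Lie product f o g, the differential is
   bracketing with mu, cup is up to sign the brace mu{g, f}, and the pre-Lie and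
   brace relations yield the Gerstenhaber identities up to the homotopies f o g
   (commutativity of cup) and f{h, g} (Leibniz rule).

   A chain a_0 (x) a_1 ... a_n is a cyclic word with base point a_0, and up to
   sign lie_derivative f inserts f into all arcs of it; hence d is minus
   lie_derivative mu, and L_[f,g] = [L_f, L_g] holds on chains.  Let T(g, f) be
   the part of the action of g o f in which the argument of g filled by f lies to
   the right of the base point, which is inside g.  Then i_f = - T(mu, f), and the
   failure of T to commute with L_h is expressed by T itself up to a term
   symmetric in g and h.  Antisymmetrizing and taking h = mu gives
   i_[f,g] = [i_f, L_g] up to the homotopy T(g, f). *)

Require Import Defs.
From HB Require Import structures.
From mathcomp Require Import all_boot all_order all_algebra.
From mathcomp Require Import zify.
From mathcomp Require Import boolp functions.
From mathcomp Require Import freeg.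

Set Implicit Arguments.
Unset Strict Implicit.
Unset Printing Implicit Defensive.

Import Order.TTheory GRing.Theory Num.Theory.
Local Open Scope ring_scope.

(** The identities are proved for functions of words with values in an arbitrary module, so that one
    calculus serves cochains and chains. A chain enters only through a multilinear function
    [Psi a w], specialised at the end to the class of a (x) w. Such functions pull operators back:
    in a nested expression the outermost operator is the first to act on the word.

    The obstacle is the comparison of double sums in which ranges, signs and twists all depend on
    positions. The ranges disappear when sums run over all factorisations of a word. The price is
    paid in the signs, which often agree only for factorisations that give every cochain its exact
    number of letters; hence the recurring case distinctions on lengths, the other terms being zero
    on both sides.

    After that, everything depends on where a second cochain sits relative to the first: to its
    left, to its right, inside it or around it. Marked functions record exactly this, and each
    identity is an enumeration of such relative positions. The twists need no separate argument: a
    letter outside both cochains is twisted by the sum of the shifts, whichever is inserted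
    first. *)

(** * Deciding integral linear identities, with signs *)

Inductive zexpr := ZVar of nat | ZZero | ZOpp of zexpr | ZAdd of zexpr & zexpr.

Fixpoint zeval (V : zmodType) (env : seq V) (e : zexpr) : V :=
  match e with
  | ZVar i => nth 0 env i
  | ZZero => 0
  | ZOpp e1 => - zeval env e1
  | ZAdd e1 e2 => zeval env e1 + zeval env e2
  end.

Fixpoint zcoef (e : zexpr) (i : nat) : int :=
  match e with
  | ZVar j => (i == j)%:Z
  | ZZero => 0
  | ZOpp e1 => - zcoef e1 i
  | ZAdd e1 e2 => zcoef e1 i + zcoef e2 i
  end.

Lemma zevalE (V : zmodType) (env : seq V) e :
  zeval env e = \sum_(i < size env) nth 0 env i *~ zcoef e i.
Proof.
elim: e => [j||e IH|e1 IH1 e2 IH2] /=.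
- have [lt_j|ge_j] := ltnP j (size env); last first.
    rewrite nth_default // big1 // => i _.
    by rewrite ltn_eqF ?mulr0z // (leq_trans (ltn_ord i)).
  rewrite (bigD1 (Ordinal lt_j)) //= eqxx mulr1z big1 ?addr0 // => i ne_ij.
  by rewrite -val_eqE /= in ne_ij; rewrite (negbTE ne_ij) mulr0z.
- by rewrite big1 // => i _; rewrite mulr0z.
- by rewrite IH -sumrN; apply: eq_bigr => i _; rewrite mulrNz.
- by rewrite IH1 IH2 -big_split; apply: eq_bigr => i _; rewrite mulrzDr.
Qed.

(** The coefficients are closed integers once the terms are reified, so the hypothesis holds by
    computation and [isT] proves it. *)
Lemma zevalP (V : zmodType) (env : seq V) e1 e2 :
  all (fun i => zcoef e1 i == zcoef e2 i) (iota 0 (size env)) ->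
  zeval env e1 = zeval env e2.
Proof.
move=> /allP h; rewrite !zevalE; apply: eq_bigr => i _.
by rewrite (eqP (h i _)) // mem_iota add0n ltn_ord.
Qed.

Ltac zmem x env :=
  lazymatch env with
  | x :: _ => constr:(0%N)
  | _ :: ?env' => let n := zmem x env' in constr:(n.+1)
  end.

Ltac zadd x env :=
  match env with
  | _ => let _ := zmem x env in env
  | _ => constr:(x :: env)
  end.

Ltac zatoms env t :=
  match t with
  | 0 => env
  | - ?x => zatoms env x
  | ?x + ?y => let env1 := zatoms env x in zatoms env1 y
  | ?x => zadd x env
  end.

Ltac zreify env t :=
  match t with
  | 0 => constr:(ZZero)
  | - ?x => let e := zreify env x in constr:(ZOpp e)
  | ?x + ?y => let e1 := zreify env x in let e2 := zreify env y in
      constr:(ZAdd e1 e2)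
  | ?x => let i := zmem x env in constr:(ZVar i)
  end.

(* Decides equations between integral combinations of atoms, coefficient by
   coefficient. *)
Ltac zmodule :=
  match goal with |- ?x = ?y :> ?V =>
    let env0 := constr:(@nil V) in
    let env1 := zatoms env0 x in
    let env := zatoms env1 y in
    let e1 := zreify env x in
    let e2 := zreify env y in
    exact: (@zevalP _ env e1 e2 isT)
  end.

Lemma signr_oddZ (k : comNzRingType) (V : lmodType k) n (x : V) :
  (-1) ^+ n *: x = if odd n then - x else x.
Proof. by rewrite -signr_odd; case: odd; rewrite /= ?scaleN1r ?scale1r. Qed.

(** Signs depend only on the parities of the exponents. Fixing the parity of each variable leaves an
    integral linear identity. *)
Ltac zsigns :=
  rewrite ?(signr_oddZ, oddD, oddM, oddS) /=;
  repeat match goal with |- context [odd ?x] => case: (odd x) => /= end;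
  zmodule.

(** * Sums over the factorisations of a word *)

Section LinearFunctions.
Variables (k : comNzRingType) (U V : lmodType k) (F : U -> V).
Hypothesis lF : linear F.

Lemma linear0_of : F 0 = 0.
Proof. by have := lF (-1) 0 0; rewrite scaler0 addr0 scaleN1r addNr. Qed.

Lemma linearZ_of c x : F (c *: x) = c *: F x.
Proof. by have := lF c x 0; rewrite linear0_of !addr0. Qed.

End LinearFunctions.

Section LinearCombination.
Variables (k : comNzRingType) (U V W : lmodType k).

Lemma comp_linear (F : V -> W) (G : U -> V) :
  linear F -> linear G -> linear (fun x => F (G x)).
Proof. by move=> lF lG c x y; rewrite lG lF. Qed.

Lemma add_linear (F G : U -> V) : linear F -> linear G -> linear (fun x => F x + G x).
Proof. by move=> lF lG c x y; rewrite lF lG scalerDr addrACA. Qed.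

End LinearCombination.

Section Apply.
Variables (k : comNzRingType) (T : Type) (V : lmodType k).

Lemma addf_app (F G : T -> V) x : (F + G) x = F x + G x. Proof. by []. Qed.
Lemma oppf_app (F : T -> V) x : (- F) x = - F x. Proof. by []. Qed.
Lemma scalef_app c (F : T -> V) x : (c *: F) x = c *: F x. Proof. by []. Qed.

End Apply.

Definition appE := (addf_app, oppf_app, scalef_app).

Section Split.
Variables (k : comNzRingType) (T : Type) (V : lmodType k).
Implicit Types (w u v : seq T).

(* The sum of F over all w = u ++ v, i.e. Sweedler notation for deconcatenation.
   No bounds on the lengths are needed: a cochain vanishes on the words of the
   wrong length, so the irrelevant terms are zero. *)
Fixpoint split2 w (F : seq T -> seq T -> V) : V :=
  if w is a :: w' then F [::] w + split2 w' (fun u v => F (a :: u) v)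
  else F [::] [::].

Definition split3 w (F : seq T -> seq T -> seq T -> V) : V :=
  split2 w (fun u z => split2 z (F u)).

Lemma eq_split2_in w F G :
  (forall u v, w = u ++ v -> F u v = G u v) -> split2 w F = split2 w G.
Proof.
elim: w F G => [|a w IH] F G eFG /=; first exact: eFG.
rewrite eFG //; congr (_ + _); apply: IH => u v ew.
by apply: eFG; rewrite ew.
Qed.

Lemma eq_split2 w F G : (forall u v, F u v = G u v) -> split2 w F = split2 w G.
Proof. by move=> eFG; apply: eq_split2_in. Qed.

Lemma eq_split3_in w F G :
  (forall u v y, w = u ++ v ++ y -> F u v y = G u v y) ->
  split3 w F = split3 w G.
Proof.
move=> eFG; apply: eq_split2_in => u z ew; apply: eq_split2_in => v y ez.
by apply: eFG; rewrite ew ez.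
Qed.

Lemma eq_split3 w F G :
  (forall u v y, F u v y = G u v y) -> split3 w F = split3 w G.
Proof. by move=> eFG; apply: eq_split3_in. Qed.

Lemma split2D w F G :
  split2 w (fun u v => F u v + G u v) = split2 w F + split2 w G.
Proof.
elim: w F G => [//|a w IH] F G /=.
by rewrite (IH (fun u v => F (a :: u) v)) addrACA.
Qed.

Lemma split2_0 w : split2 w (fun _ _ => 0) = 0.
Proof. by elim: w => [//|a w IH] /=; rewrite IH addr0. Qed.

Lemma split3D w F G :
  split3 w (fun u v y => F u v y + G u v y) = split3 w F + split3 w G.
Proof. by rewrite -split2D; apply: eq_split2 => u z; rewrite split2D. Qed.

Lemma split3_0 w : split3 w (fun _ _ _ => 0) = 0.
Proof. by rewrite -[RHS](split2_0 w); apply: eq_split2 => u z; rewrite split2_0. Qed.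

Lemma split2_cat u a v F :
  split2 (u ++ a :: v) F =
    split2 u (fun u1 u2 => F u1 (u2 ++ a :: v)) +
    split2 v (fun v1 v2 => F (u ++ a :: v1) v2).
Proof. by elim: u F => [//|b u IH] F /=; rewrite IH addrA. Qed.

(** The letter a lies in the third, second or first factor. With a as the mark, these are the
    origins of [insL], [insM] and [insR]. *)
Lemma split3_cat u a v F :
  split3 (u ++ a :: v) F =
    split3 u (fun u1 u2 u3 => F u1 u2 (u3 ++ a :: v)) +
    (split2 u (fun u1 u2 => split2 v (fun v1 v2 => F u1 (u2 ++ a :: v1) v2)) +
     split3 v (fun v1 v2 v3 => F (u ++ a :: v1) v2 v3)).
Proof.
rewrite /split3 split2_cat addrA; congr (_ + _).
by rewrite -split2D; apply: eq_split2 => u1 u2; rewrite split2_cat.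
Qed.

(** This is coassociativity of deconcatenation. *)
Lemma split2A w (F : seq T -> seq T -> seq T -> V) :
  split2 w (fun z y => split2 z (fun u v => F u v y)) = split3 w F.
Proof.
rewrite /split3; elim: w F => [//|a w IH] F /=.
rewrite -(IH (fun u v y => F (a :: u) v y)).
by rewrite split2D addrA.
Qed.

End Split.

Lemma split2_map (k : comNzRingType) (S T : Type) (V : lmodType k)
    (e : S -> T) (w : seq S) (F : seq T -> seq T -> V) :
  split2 (map e w) F = split2 w (fun u v => F (map e u) (map e v)).
Proof.
elim: w F => [//|a w IH] F /=.
by rewrite (IH (fun u v => F (e a :: u) v)).
Qed.

Lemma split3_map (k : comNzRingType) (S T : Type) (V : lmodType k)
    (e : S -> T) (w : seq S) (F : seq T -> seq T -> seq T -> V) :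
  split3 (map e w) F =
  split3 w (fun u v y => F (map e u) (map e v) (map e y)).
Proof.
by rewrite /split3 split2_map; apply: eq_split2 => u z; rewrite split2_map.
Qed.

Lemma split2_linear (k : comNzRingType) (T : Type) (U V : lmodType k) (w : seq T)
    (F : seq T -> seq T -> U) (f : U -> V) :
  linear f -> f (split2 w F) = split2 w (fun u v => f (F u v)).
Proof.
move=> lf; elim: w F => [//|a w IH] F /=.
by rewrite -[F [::] _]scale1r lf scale1r IH scale1r.
Qed.

Lemma split3_linear (k : comNzRingType) (T : Type) (U V : lmodType k) (w : seq T)
    (F : seq T -> seq T -> seq T -> U) (f : U -> V) :
  linear f -> f (split3 w F) = split3 w (fun u v y => f (F u v y)).
Proof.
move=> lf; rewrite /split3 (split2_linear _ _ lf).
by apply: eq_split2 => u z; apply: split2_linear.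
Qed.

Lemma split2Z (k : comNzRingType) (T : Type) (V : lmodType k) (c : k) (w : seq T)
    (F : seq T -> seq T -> V) :
  c *: split2 w F = split2 w (fun u v => c *: F u v).
Proof. by apply: split2_linear => d x y; rewrite scalerDr !scalerA mulrC. Qed.

Lemma split3Z (k : comNzRingType) (T : Type) (V : lmodType k) (c : k) (w : seq T)
    (F : seq T -> seq T -> seq T -> V) :
  c *: split3 w F = split3 w (fun u v y => c *: F u v y).
Proof. by apply: split3_linear => d x y; rewrite scalerDr !scalerA mulrC. Qed.

Lemma split2_exchange (k : comNzRingType) (T : Type) (V : lmodType k)
    (w z : seq T) (F : seq T -> seq T -> seq T -> seq T -> V) :
  split2 w (fun u v => split2 z (F u v)) =
  split2 z (fun x y => split2 w (fun u v => F u v x y)).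
Proof.
elim: w F => [//|a w IH] F /=.
by rewrite (IH (fun u v => F (a :: u) v)) -split2D.
Qed.

Section Split5.
Variables (k : comNzRingType) (T : Type) (V : lmodType k) (w : seq T).

(** A common form for double sums over cuts of w, so that two of them can be compared term by term.
    In the four lemmas that lead to it, the extra arguments of F are the words cut a second time,
    spelled out as concatenations. *)
Definition split5 (F : seq T -> seq T -> seq T -> seq T -> seq T -> V) : V :=
  split3 w (fun u1 u2 z => split3 z (F u1 u2)).

Lemma eq_split5_in F G :
  (forall a b c d e, w = a ++ b ++ c ++ d ++ e -> F a b c d e = G a b c d e) ->
  split5 F = split5 G.
Proof.
move=> eFG; apply: eq_split3_in => a b z ew; apply: eq_split3_in => c d e ez.
by apply: eFG; rewrite ew ez.
Qed.

Lemma eq_split5 F G : (forall a b c d e, F a b c d e = G a b c d e) ->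
  split5 F = split5 G.
Proof. by move=> eFG; apply: eq_split5_in. Qed.

Lemma split3_right (F : seq T -> seq T -> seq T -> seq T -> seq T -> seq T -> V) :
  split3 w (fun a b z => split3 z (F z a b)) =
  split5 (fun a b c d e => F (c ++ d ++ e) a b c d e).
Proof. by apply: eq_split3 => a b z; apply: eq_split3_in => c d e ->. Qed.

Lemma split3_left (F : seq T -> seq T -> seq T -> seq T -> seq T -> seq T -> V) :
  split3 w (fun z d e => split3 z (fun a b c => F z a b c d e)) =
  split5 (fun a b c d e => F (a ++ b ++ c) a b c d e).
Proof.
transitivity (split3 w (fun z d e => split3 z (fun a b c =>
    F (a ++ b ++ c) a b c d e))).
  by apply: eq_split3 => z d e; apply: eq_split3_in => a b c ->.
rewrite /split5 /split3.
under eq_split2 => z t do rewrite split2_exchange.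
rewrite split2A; apply: eq_split2 => a t.
under eq_split2 => z s do rewrite split2_exchange.
exact: (split2A t (fun b c s => split2 s (fun d e => F _ a b c d e))).
Qed.

Lemma split3_sides
    (F : seq T -> seq T -> seq T -> seq T -> seq T -> seq T -> seq T -> V) :
  split3 w (fun x c y =>
    split2 x (fun a b => split2 y (fun d e => F x y a b c d e))) =
  split5 (fun a b c d e => F (a ++ b) (d ++ e) a b c d e).
Proof.
transitivity (split3 w (fun x c y => split2 x (fun a b => split2 y (fun d e =>
    F (a ++ b) (d ++ e) a b c d e)))).
  apply: eq_split3 => x c y; apply: eq_split2_in => a b ->.
  by apply: eq_split2_in => d e ->.
rewrite /split5 /split3.
under eq_split2 => z t do rewrite split2_exchange.
exact: (split2A w (fun a b t => split2 t (fun c y => split2 y (fun d e =>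
  F _ _ a b c d e)))).
Qed.

Lemma split3_mid (F : seq T -> seq T -> seq T -> seq T -> seq T -> seq T -> V) :
  split3 w (fun a z e => split3 z (fun b c d => F z a b c d e)) =
  split5 (fun a b c d e => F (b ++ c ++ d) a b c d e).
Proof.
transitivity (split3 w (fun a z e => split3 z (fun b c d =>
    F (b ++ c ++ d) a b c d e))).
  by apply: eq_split3 => a z e; apply: eq_split3_in => b c d ->.
rewrite /split5 /split3; apply: eq_split2 => a t.
rewrite split2A; apply: eq_split2 => b s.
exact: (split2A s (fun c d e => F _ a b c d e)).
Qed.

End Split5.

Section Split4.
Variables (k : comNzRingType) (T : Type) (V : lmodType k).

Definition split4 w (F : seq T -> seq T -> seq T -> seq T -> V) : V :=
  split2 w (fun a z => split3 z (F a)).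

Lemma eq_split4 w F G : (forall a b c d, F a b c d = G a b c d) ->
  split4 w F = split4 w G.
Proof. by move=> eFG; apply: eq_split2 => a z; apply: eq_split3. Qed.

Lemma split4_head w (F : seq T -> seq T -> seq T -> seq T -> seq T -> V) :
  split3 w (fun z c d => split2 z (fun a b => F z a b c d)) =
  split4 w (fun a b c d => F (a ++ b) a b c d).
Proof.
transitivity (split3 w (fun z c d => split2 z (fun a b => F (a ++ b) a b c d))).
  by apply: eq_split3 => z c d; apply: eq_split2_in => a b ->.
rewrite /split3.
under eq_split2 => z t do rewrite split2_exchange.
exact: (split2A w (fun a b t => split2 t (fun c d => F _ a b c d))).
Qed.

Lemma split4_last w (F : seq T -> seq T -> seq T -> seq T -> V) :
  split3 w (fun a b z => split2 z (F a b)) = split4 w F.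
Proof. by []. Qed.

Lemma split4_cat3 w (F : seq T -> seq T -> seq T -> seq T -> seq T -> V) :
  split2 w (fun z d => split3 z (fun a b c => F z a b c d)) =
  split4 w (fun a b c d => F (a ++ b ++ c) a b c d).
Proof.
transitivity (split2 w (fun z d => split3 z (fun a b c => F (a ++ b ++ c) a b c d))).
  by apply: eq_split2 => z d; apply: eq_split3_in => a b c ->.
rewrite /split4 /split3 split2A; apply: eq_split2 => a z.
exact: (split2A z (fun b c d => F _ a b c d)).
Qed.

Lemma split32_exchange w z (F : seq T -> seq T -> seq T -> seq T -> seq T -> V) :
  split3 w (fun a b c => split2 z (F a b c)) =
  split2 z (fun d e => split3 w (fun a b c => F a b c d e)).
Proof.
rewrite /split3 -split2_exchange; apply: eq_split2 => a t.
exact: (split2_exchange t z (F a)).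
Qed.

Lemma split3_exchange w z
    (F : seq T -> seq T -> seq T -> seq T -> seq T -> seq T -> V) :
  split3 w (fun a b c => split3 z (F a b c)) =
  split3 z (fun d e f => split3 w (fun a b c => F a b c d e f)).
Proof.
rewrite [LHS](split32_exchange w z (fun a b c d t => split2 t (F a b c d))).
apply: eq_split2 => d t.
exact: (split32_exchange w t (fun a b c => F a b c d)).
Qed.

End Split4.

(** * Insertion of cochains *)

Section Operators.
Variables (k : comNzRingType) (A : homAssocAlgebra k).

(* Throughout, a cochain is graded by its shift, which is one less than its
   arity: a cochain f of shift m has m.+1 arguments, and twists by alpha^m the
   arguments standing next to it. *)
Definition tw (n : nat) : A -> A := iter n (hom_twist A).
Definition tws (n : nat) : seq A -> seq A := map (tw n).

Lemma tw_linear n : linear (tw n).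
Proof. exact: iter_twist_linear. Qed.

Lemma twZ n c x : tw n (c *: x) = c *: tw n x.
Proof. by elim: n => [//|n IH] /=; rewrite IH linearZ. Qed.

Lemma tw_tw m n x : tw m (tw n x) = tw (m + n) x.
Proof. by rewrite /tw iterD. Qed.

Lemma tw_mul n a b : tw n (hom_mul A a b) = hom_mul A (tw n a) (tw n b).
Proof. by elim: n => [//|n IH] /=; rewrite -/(tw n _) IH hom_twistM. Qed.

Lemma tws_tws m n s : tws m (tws n s) = tws (m + n) s.
Proof. by rewrite /tws -map_comp; apply: eq_map => x; apply: tw_tw. Qed.

Lemma tws_cat n s t : tws n (s ++ t) = tws n s ++ tws n t.
Proof. exact: map_cat. Qed.

Lemma tws_cons n x s : tws n (x :: s) = tw n x :: tws n s.
Proof. by []. Qed.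

Lemma size_tws n s : size (tws n s) = size s.
Proof. exact: size_map. Qed.

Section CochainTheory.
Variables (m : nat) (f : seq A -> A).
Hypothesis cf : is_cochain m.+1%:Z f.

Lemma cochain_mlin : multilinear f.
Proof. by have [] := cf. Qed.

Lemma cochain_tw n s : tw n (f s) = f (tws n s).
Proof.
have [_ _ af] := cf; elim: n s => [|n IH] s /=.
  by rewrite /tws map_id_in.
by rewrite -/(tw n) IH af /tws -map_comp.
Qed.

Lemma cochain_size s : size s != m.+1 -> f s = 0.
Proof.
have [sf _ _] := cf => ns; apply: sf; rewrite /has_length negb_and.
by apply/orP; right; rewrite eqz_nat.
Qed.

End CochainTheory.

Section Ops.
Variable V : lmodType k.
Implicit Types (F : seq A -> A -> seq A -> V) (phi : seq A -> V).

(* A marked function takes a word y ++ a :: u together with the position of the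
   letter a.  Inserting a cochain g into the word acts to the right of the mark
   (insR), to the left of it (insL), or on a factor that contains it (insM). *)
Definition mark W (f : seq A -> W) (y : seq A) (a : A) (u : seq A) : W := f (y ++ a
  :: u).

Definition plug n F (g : seq A -> A) w : V :=
  split3 w (fun u v y => (-1) ^+ (n * size u) *: F (tws n u) (g v) (tws n y)).

(** This is the pre-Lie product phi o g, with all places of g summed at once. *)
Definition ins n phi g := plug n (mark phi) g.

(* (size y).+1 letters are passed before u is reached. *)
Definition insR r F (g : seq A -> A) y a u : V :=
  (-1) ^+ (r * (size y).+1) *: ins r (F (tws r y) (tw r a)) g u.

Definition insL r F (g : seq A -> A) y a u : V :=
  ins r (fun y' => F y' (tw r a) (tws r u)) g y.

Definition insM r F (K : seq A -> A -> seq A -> A) y a u : V :=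
  split2 y (fun y1 y2 => split2 u (fun u1 u2 =>
    (-1) ^+ (r * size y1) *: F (tws r y1) (K y2 a u1) (tws r u2))).

Definition marked_multilinear F : Prop :=
  [/\ forall a u, multilinear (fun y => F y a u), forall y u, linear (F y ^~ u)
    & forall y a, multilinear (F y a)].

Lemma signZ e1 e2 (x y : V) :
  odd e1 = odd e2 -> x = y -> (-1) ^+ e1 *: x = (-1) ^+ e2 *: y.
Proof. by move=> h ->; rewrite -signr_odd h signr_odd. Qed.

Lemma signZZ e1 e2 (x : V) : (-1) ^+ e1 *: ((-1) ^+ e2 *: x) = (-1) ^+ (e1 + e2) *: x.
Proof. by rewrite scalerA exprD. Qed.

End Ops.
End Operators.

Definition size_cons T (x : T) s : size (x :: s) = (size s).+1 := erefl.

Ltac oddcases :=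
  repeat match goal with |- context [odd ?x] => case: (odd x) end.

Ltac parity :=
  rewrite ?(size_cat, size_tws, size_cons, oddD, oddM, oddS, addnS, addSn);
  repeat match goal with H : size _ = _ |- _ => rewrite H; clear H end;
  rewrite ?(size_cat, size_tws, size_cons, oddD, oddM, oddS) /=;
  oddcases; done.

Section SplitTwist.
Variables (k : comNzRingType) (A : homAssocAlgebra k) (V : lmodType k).
Variables (n : nat) (w : seq A).

Lemma split2_tws (F : seq A -> seq A -> V) :
  split2 (tws n w) F = split2 w (fun u v => F (tws n u) (tws n v)).
Proof. exact: split2_map. Qed.

Lemma split3_tws (F : seq A -> seq A -> seq A -> V) :
  split3 (tws n w) F = split3 w (fun u v y => F (tws n u) (tws n v) (tws n y)).
Proof. exact: split3_map. Qed.

End SplitTwist.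

(** Here d counts the letters other than the marked one, so that marking a cochain keeps its
    shift. *)
Record marked_cochain (k : comNzRingType) (A : homAssocAlgebra k) (d : nat)
    (K : seq A -> A -> seq A -> A) : Prop := MarkedCochain {
  marked_cochain_marked_multilinear : marked_multilinear K;
  marked_cochain_tw : forall i y a u, tw i (K y a u) = K (tws i y) (tw i a) (tws i u);
  marked_cochain_size : forall y a u, size y + size u != d -> K y a u = 0 }.

Section Identities.
Variables (k : comNzRingType) (A : homAssocAlgebra k) (V : lmodType k).
Variables (n r : nat) (g h : seq A -> A).
Hypotheses (cg : is_cochain n.+1%:Z g) (ch : is_cochain r.+1%:Z h).

(** The cochain h falls inside g, to its left or to its right. In the last two cases the order in
    which g and h are inserted is exchanged, which costs the sign. *)
Lemma ins_plug (F : seq A -> A -> seq A -> V) : marked_multilinear F ->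
  ins r (plug n F g) h =
  plug (n + r) F (ins r g h) +
  (-1) ^+ (n * r) *: (plug n (insL r F h) g + plug n (insR r F h) g).
Proof.
move=> [mF1 lF mF2]; apply/funext => w; rewrite !fctE.
(* The three sums have h to the right of g, inside g and to the left of g. *)
transitivity (split3 w (fun u v y =>
    split3 u (fun a b c => (-1) ^+ (r * size u + n * size a) *:
      F (tws (n + r) a) (g (tws r b)) (tws (n + r) c ++ tw n (h v) :: tws (n + r) y)))
  + split3 w (fun u v y =>
    split2 u (fun a b => split2 y (fun d e => (-1) ^+ (r * size u + n * size a) *:
      F (tws (n + r) a) (g (tws r b ++ h v :: tws r d)) (tws (n + r) e))))
  + split3 w (fun u v y =>
    split3 y (fun c d e => (-1) ^+ (r * size u + n * (size u + (size c).+1)) *: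
      F (tws (n + r) u ++ tw n (h v) :: tws (n + r) c) (g (tws r d)) (tws (n + r) e)))).
  rewrite -!split3D; apply: eq_split3 => u v y.
  rewrite /mark /plug split3_cat !split3_tws split2_tws !scalerDr addrA.
  congr (_ + _ + _); rewrite ?split3Z ?split2Z.
  - by apply: eq_split3 => a b c; rewrite signZZ tws_cat tws_cons size_tws !tws_tws.
  - apply: eq_split2 => a b; rewrite split2_tws split2Z; apply: eq_split2 => d e.
    by rewrite signZZ size_tws !tws_tws.
  - apply: eq_split3 => c d e.
    by rewrite signZZ tws_cat tws_cons size_cat !size_tws size_cons size_tws !tws_tws.
rewrite scalerDr [X in _ = X]addrC [in X in _ = X + _]addrC [X in _ = X]addrAC.
congr (_ + _ + _).
- rewrite /plug /insR /ins split3Z split3_left.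
  transitivity (split3 w (fun u v z => split3 z (fun c d e =>
    (-1) ^+ (n * r + n * size u + r * (size u).+1 + r * size c) *:
      F (tws (n + r) u) (tw r (g v)) (tws (n + r) c ++ h (tws n d) :: tws (n + r) e)))).
    rewrite split3_right; apply: eq_split5 => a b c d e.
    rewrite (cochain_tw ch) (cochain_tw cg).
    (* The exponents have equal parity only if g receives n.+1 letters; otherwise both terms are
       zero. *)
    have [eb|nb] := eqVneq (size b) n.+1; first by apply: signZ => //; parity.
    by rewrite !(cochain_size cg) ?size_tws // !(linear0_of (lF _ _)) !scaler0.
  apply: eq_split3 => u v z; rewrite /mark /plug split3_tws split3Z !split3Z.
  apply: eq_split3 => c d e; rewrite !signZZ !size_tws !tws_tws.
  by apply: signZ; [parity|rewrite (addnC r)].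
- rewrite split3_sides /plug /ins /plug /mark.
  transitivity (split3 w (fun a z e => split3 z (fun b c d =>
     (-1) ^+ ((n + r) * size a + r * size b) *:
      F (tws (n + r) a) (g (tws r b ++ h c :: tws r d)) (tws (n + r) e)))).
    rewrite split3_mid; apply: eq_split5 => a b c d e.
    by apply: signZ => //; parity.
  apply: eq_split3 => a z e; rewrite (split3_linear z _ (lF _ _)) split3Z.
  by apply: eq_split3 => b c d; rewrite (linearZ_of (lF _ _)) signZZ.
- rewrite /plug /insL /ins split3Z split3_right.
  transitivity (split3 w (fun z d e => split3 z (fun a b c =>
    (-1) ^+ (n * r + n * size z + r * size a) *:
      F (tws (n + r) a ++ h (tws n b) :: tws (n + r) c) (tw r (g d)) (tws (n + r) e)))).
    rewrite split3_left; apply: eq_split5 => a b c d e.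
    rewrite (cochain_tw ch) (cochain_tw cg).
    have [eb|nb] := eqVneq (size b) r.+1; first by apply: signZ => //; parity.
    rewrite (cochain_size ch) ?size_tws //.
    by rewrite (multilinear0 _ _ (mF1 _ _)) !scaler0.
  apply: eq_split3 => z d e; rewrite /mark /plug split3_tws !split3Z.
  apply: eq_split3 => a b c; rewrite !signZZ !size_tws !tws_tws.
  by apply: signZ; [parity|rewrite (addnC r)].
Qed.

(** Nested insertions are associative: g goes into K at the mark, and K into F. *)
Lemma plug_insM m (F : seq A -> A -> seq A -> V) (K : seq A -> A -> seq A -> A) :
  marked_multilinear F -> plug n (insM m F K) g = plug (m + n) F (plug n K g).
Proof.
move=> [mF1 lF mF2]; apply/funext => w; rewrite /plug /insM.
transitivity (split3 w (fun x c y => split2 x (fun a b => split2 y (fun d e =>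
  (-1) ^+ (n * size x + m * size a) *:
    F (tws (m + n) a) (K (tws n b) (g c) (tws n d)) (tws (m + n) e))))).
  apply: eq_split3 => x c y; rewrite split2_tws split2Z; apply: eq_split2 => a b.
  rewrite split2_tws split2Z; apply: eq_split2 => d e.
  by rewrite signZZ size_tws !tws_tws.
transitivity (split3 w (fun a z e => split3 z (fun b c d =>
  (-1) ^+ ((m + n) * size a + n * size b) *:
    F (tws (m + n) a) (K (tws n b) (g c) (tws n d)) (tws (m + n) e)))).
  rewrite split3_sides split3_mid; apply: eq_split5 => a b c d e.
  by apply: signZ => //; parity.
apply: eq_split3 => a z e; rewrite (split3_linear z _ (lF _ _)) split3Z.
by apply: eq_split3 => b c d; rewrite (linearZ_of (lF _ _)) signZZ.
Qed.

(** That h stands to the left of g means that g stands to the right of h. Thus [insR] alone suffices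
    to describe disjoint pairs. *)
Lemma plug_insL (phi : seq A -> V) : multilinear phi ->
  plug n (insL r (mark phi) h) g =
  (-1) ^+ (n * r) *: plug r (insR n (mark phi) g) h.
Proof.
move=> mphi; apply/funext => w; rewrite !fctE; rewrite /plug /insL /insR /ins /plug
  /mark.
transitivity (split3 w (fun z d e => split3 z (fun a b c =>
  (-1) ^+ (n * size z + r * size a) *:
    phi ((tws (n + r) a ++ h (tws n b) :: tws (n + r) c) ++ tw r (g d) :: tws (n + r)
      e)))).
  apply: eq_split3 => z d e; rewrite split3_tws split3Z.
  apply: eq_split3 => a b c.
  by rewrite signZZ !size_tws !tws_tws (addnC r).
transitivity (split3 w (fun a b z => split3 z (fun c d e =>
  (-1) ^+ (n * r + (r * size a + n * (size a).+1 + n * size c)) *: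
    phi (tws (n + r) a ++ tw n (h b) :: tws (n + r) c ++ g (tws r d) :: tws (n + r)
      e)))).
  rewrite split3_left split3_right; apply: eq_split5 => a b c d e.
  rewrite (cochain_tw ch) (cochain_tw cg) -catA /=.
  have [eb|nb] := eqVneq (size b) r.+1; first by apply: signZ => //; parity.
  by rewrite (cochain_size ch) ?size_tws // multilinear0 // !scaler0.
rewrite split3Z; apply: eq_split3 => a b z; rewrite split3_tws !split3Z.
apply: eq_split3 => c d e.
rewrite !signZZ !size_tws !tws_tws; apply: signZ; [parity|by rewrite ?(addnC r)].
Qed.

Lemma mark_ins (phi : seq A -> V) :
  mark (ins r phi h) = insL r (mark phi) h +
   (insM r (mark phi) (mark h) + insR r (mark phi) h).
Proof.
apply/funext => y; apply/funext => a; apply/funext => u; rewrite !fctE.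
rewrite /mark {1}/ins {1}/plug split3_cat /insL /insM /insR /ins /plug /mark.
congr (_ + (_ + _)).
- by apply: eq_split3 => b c d; rewrite tws_cat -catA.
- rewrite split3Z; apply: eq_split3 => b c d.
  rewrite signZZ tws_cat -catA; apply: signZ => //; parity.
Qed.

Lemma insL_insR (F : seq A -> A -> seq A -> V) : marked_multilinear F ->
  insL r (insR n F g) h = (-1) ^+ (n * r) *: insR n (insL r F h) g.
Proof.
move=> [mF1 lF mF2].
apply/funext => y; apply/funext => a; apply/funext => u; rewrite !fctE.
 rewrite /insL /insR /ins /plug /mark.
transitivity (split3 y (fun b c d => split3 u (fun p q s =>
  (-1) ^+ (r * size b + n * (size b + (size d).+1).+1 + n * size p) *:
   F (tws (n + r) b ++ h (tws n c) :: tws (n + r) d) (tw (n + r) a)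
     (tws (n + r) p ++ g (tws r q) :: tws (n + r) s)))).
  apply: eq_split3 => b c d; rewrite split3_tws !split3Z.
  apply: eq_split3 => p q s.
  rewrite !signZZ size_cat size_cons !size_tws tws_cat tws_cons !tws_tws tw_tw.
  rewrite (cochain_tw ch); apply: signZ => //; parity.
rewrite split3_exchange !split3Z; apply: eq_split3 => p q s.
rewrite split3_tws !split3Z; apply: eq_split3_in => b c d ->.
rewrite !signZZ tws_cat tws_cons !tws_tws tw_tw (cochain_tw cg) (addnC r).
have [eb|nb] := eqVneq (size c) r.+1; first by apply: signZ => //; parity.
rewrite (cochain_size ch) ?size_tws //.
by rewrite (multilinear0 _ _ (mF1 _ _)) !scaler0.
Qed.

(** To the right of the mark, g lies either within the arc that K takes or beyond it. *)
Lemma insR_insM (F : seq A -> A -> seq A -> V) (K : seq A -> A -> seq A -> A) :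
  marked_multilinear F -> marked_cochain r K ->
  insR n (insM r F K) g =
  insM (r + n) F (insR n K g) + (-1) ^+ (n * r) *: insM r (insR n F g) K.
Proof.
move=> [mF1 lF mF2] [_ twK sK].
apply/funext => y; apply/funext => a; apply/funext => u; rewrite !fctE.
rewrite {1}/insR {1}/ins {1}/plug {1}/mark {1}/insM.
transitivity (split2 y (fun b c => split3 u (fun p q s => split2 p (fun d e =>
    (-1) ^+ (n * (size y).+1 + n * size p + r * size b) *:
      F (tws (r + n) b) (K (tws n c) (tw n a) (tws n d))
        (tws (r + n) e ++ tw r (g q) :: tws (r + n) s)))) +
  split2 y (fun b c => split3 u (fun p q s => split2 s (fun d e =>
    (-1) ^+ (n * (size y).+1 + n * size p + r * size b) *:
      F (tws (r + n) b) (K (tws n c) (tw n a) (tws n p ++ g q :: tws n d))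
        (tws (r + n) e))))).
  rewrite -!split32_exchange -split3D split3Z; apply: eq_split3 => p q s.
  rewrite split2_tws signZZ split2Z -split2D; apply: eq_split2 => b c.
  rewrite split2_cat !split2_tws scalerDr !split2Z; congr (_ + _);
    apply: eq_split2 => d e; rewrite signZZ size_tws ?tws_cat ?tws_cons !tws_tws //.
rewrite [LHS]addrC; congr (_ + _).
  rewrite /insM /insR /ins /plug /mark; apply: eq_split2_in => b c ->.
  transitivity (split2 u (fun x e => split3 x (fun p q d =>
    (-1) ^+ ((r + n) * size b + n * (size c).+1 + n * size p) *:
      F (tws (r + n) b) (K (tws n c) (tw n a) (tws n p ++ g q :: tws n d))
        (tws (r + n) e)))).
    rewrite split4_last split4_cat3; apply: eq_split4 => p q d e.
    by apply: signZ => //; parity.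
  apply: eq_split2 => x e; rewrite split3Z (split3_linear _ _ (lF _ _)) split3Z.
  by apply: eq_split3 => p q d; rewrite !(linearZ_of (lF _ _)) !signZZ.
rewrite split2Z; apply: eq_split2_in => b c ->.
transitivity (split2 u (fun d z => split3 z (fun e q s =>
    (-1) ^+ (n * r + (r * size b + n * (size b).+1 + n * size e)) *:
      F (tws (r + n) b) (K (tws n c) (tw n a) (tws n d))
        (tws (r + n) e ++ g (tws r q) :: tws (r + n) s)))).
  rewrite split4_head; apply: eq_split4 => d e q s; rewrite (cochain_tw cg).
  (* Passing g over the arc of K changes the number of letters in front of it by r, but only where K
     does not vanish. *)
  have [es|ns] := eqVneq (size c + size d)%N r.
    by apply: signZ => //; rewrite -es; parity.
  by rewrite sK ?size_tws // (linear0_of (lF _ _)) !scaler0.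
rewrite split2Z; apply: eq_split2 => d z.
rewrite /insR /ins /plug /mark split3_tws !split3Z; apply: eq_split3 => e q s.
rewrite !signZZ !size_tws !tws_tws twK; apply: signZ; first parity.
by rewrite (addnC n).
Qed.

End Identities.

(** * Multilinearity and cochain conditions for the insertions *)

Section Closure.
Variables (k : comNzRingType) (A : homAssocAlgebra k) (V : lmodType k).
Implicit Types (w u v y : seq A).

Lemma multilinear_tws n (F : seq A -> V) :
  multilinear F -> multilinear (fun s => F (tws n s)).
Proof. by move=> mF s1 s2 c x y; rewrite !tws_cat !tws_cons tw_linear mF. Qed.

Lemma multilinear_sizeZ (c : nat -> k) (F : seq A -> V) :
  multilinear F -> multilinear (fun s => c (size s) *: F s).
Proof.
move=> mF s1 s2 d x y; rewrite mF !size_cat /= scalerDr !scalerA.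
by rewrite (mulrC (c _)).
Qed.

Lemma multilinear_split2_param w (G : seq A -> seq A -> seq A -> V) :
  (forall u v, multilinear (fun s => G s u v)) ->
  multilinear (fun s => split2 w (G s)).
Proof.
move=> mG s1 s2 c x y; rewrite split2Z -split2D.
by apply: eq_split2 => u v; apply: mG.
Qed.

Lemma multilinear_split2 (F : seq A -> seq A -> V) :
  (forall v, multilinear (F^~ v)) -> (forall u, multilinear (F u)) ->
  multilinear (fun w => split2 w F).
Proof.
move=> mF1 mF2 s1 s2 c x y; rewrite !split2_cat scalerDr !split2Z addrACA -!split2D.
congr (_ + _); apply: eq_split2 => u v; first exact: mF2.
exact: mF1.
Qed.

Lemma multilinear_split3_param w (G : seq A -> seq A -> seq A -> seq A -> V) :
  (forall u v y, multilinear (fun s => G s u v y)) ->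
  multilinear (fun s => split3 w (G s)).
Proof.
move=> mG; apply: multilinear_split2_param => u z.
exact: multilinear_split2_param.
Qed.

Lemma multilinear_split3 (F : seq A -> seq A -> seq A -> V) :
  (forall v y, multilinear (fun s => F s v y)) ->
  (forall u y, multilinear (fun s => F u s y)) ->
  (forall u v, multilinear (F u v)) -> multilinear (fun w => split3 w F).
Proof.
move=> mF1 mF2 mF3; apply: multilinear_split2 => [z|u].
  exact: multilinear_split2_param.
exact: multilinear_split2.
Qed.

Lemma linear_split3_param (U : lmodType k) w (G : U -> seq A -> seq A -> seq A -> V) :
  (forall u v y, linear (fun x => G x u v y)) -> linear (fun x => split3 w (G x)).
Proof.
move=> lG c x y; rewrite split3Z -split3D.
by apply: eq_split3 => u v z; apply: lG.
Qed.

Lemma multilinear_plug n (F : seq A -> A -> seq A -> V) g :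
  marked_multilinear F -> multilinear g -> multilinear (plug n F g).
Proof.
move=> [mF1 lF mF2] mg; apply: multilinear_split3.
- move=> v y; apply: (multilinear_sizeZ (fun i => (-1) ^+ (n * i))).
  exact: (multilinear_tws n (mF1 _ _)).
- move=> u y s1 s2 c a b; rewrite mg lF scalerDr !scalerA.
  by rewrite (mulrC (_ ^+ _)).
- move=> u v s1 s2 c a b; rewrite (multilinear_tws n (mF2 _ _)) scalerDr !scalerA.
  by rewrite (mulrC (_ ^+ _)).
Qed.

Lemma marked_multilinear_mark (phi : seq A -> V) : multilinear phi ->
  marked_multilinear (mark phi).
Proof.
move=> mphi; split=> [a u|y u|y a]; rewrite /mark.
- by move=> s1 s2 c x y; rewrite -!catA mphi.
- by move=> c x x'; apply: mphi.
- move=> s1 s2 c x x'; have E z s : y ++ a :: s1 ++ z :: s = (y ++ a :: s1) ++ z :: s.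
    by rewrite -catA.
  by rewrite !E mphi.
Qed.

Lemma multilinear_ins n (phi : seq A -> V) g :
  multilinear phi -> multilinear g -> multilinear (ins n phi g).
Proof. by move=> mphi mg; apply: multilinear_plug => //; apply:
  marked_multilinear_mark. Qed.

Lemma marked_multilinear_insR r (F : seq A -> A -> seq A -> V) h :
  marked_multilinear F -> multilinear h -> marked_multilinear (insR r F h).
Proof.
move=> [mF1 lF mF2] mh; split=> [a u|y u|y a]; rewrite /insR.
- apply: (multilinear_sizeZ (fun i => (-1) ^+ (r * i.+1))).
  apply: multilinear_split3_param => u1 u2 u3 s1 s2 c x x'.
  rewrite /mark (multilinear_tws r (mF1 _ _)) scalerDr !scalerA.
  by rewrite (mulrC (_ ^+ _)).
- move=> c x x'; rewrite tw_linear.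
  have -> : F (tws r y) (c *: tw r x + tw r x') =
      c *: F (tws r y) (tw r x) + F (tws r y) (tw r x').
    by apply/funext => z; rewrite lF.
  have lI : linear (fun phi : seq A -> V => ins r phi h u).
    apply: linear_split3_param => u1 u2 u3 d p q.
    by rewrite /mark ?fctE scalerDr !scalerA (mulrC (_ ^+ _)).
  by rewrite lI scalerDr !scalerA (mulrC (_ ^+ _)).
- have mI := multilinear_ins r (mF2 (tws r y) (tw r a)) mh.
  by move=> s1 s2 c x x'; rewrite mI scalerDr !scalerA (mulrC (_ ^+ _)).
Qed.

End Closure.

Section CochainClosure.
Variables (k : comNzRingType) (A : homAssocAlgebra k).

Lemma marked_cochain_mark d (f : seq A -> A) :
  is_cochain d.+1%:Z f -> marked_cochain d (mark f).
Proof.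
move=> cf; split; first exact/marked_multilinear_mark/cochain_mlin/cf.
  by move=> i y a u; rewrite /mark (cochain_tw cf) tws_cat.
move=> y a u ne; apply: (cochain_size cf); rewrite size_cat /=.
by apply: contra ne => /eqP e; apply/eqP; lia.
Qed.

Lemma is_cochainP d (f : seq A -> A) : multilinear f ->
  (forall s, tw 1 (f s) = f (tws 1 s)) -> (forall s, size s != d.+1 -> f s = 0) ->
  is_cochain d.+1%:Z f.
Proof.
move=> mf af sf; split=> //.
move=> s; rewrite /has_length => ns; apply: sf; apply: contra ns => /eqP ->.
by rewrite eqxx.
Qed.

Lemma plug_cochain d n K (g : seq A -> A) :
  marked_cochain d K -> is_cochain n.+1%:Z g -> is_cochain (d + n).+1%:Z (plug n K g).
Proof.
move=> [mK aK sK] cg; have [_ lK _] := mK; apply: is_cochainP.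
- exact: multilinear_plug (cochain_mlin cg).
- move=> s; rewrite /plug (split3_linear _ _ (@tw_linear _ A 1)) split3_tws.
  apply: eq_split3 => u v y; rewrite twZ aK (cochain_tw cg) !size_tws !tws_tws.
  by rewrite (addnC 1).
- move=> s ns; rewrite -[RHS](split3_0 A s); apply: eq_split3_in => u v y es.
  have [ev|nv] := eqVneq (size v) n.+1; last first.
    by rewrite (cochain_size cg) // (linear0_of (lK _ _)) scaler0.
  rewrite sK ?scaler0 // !size_tws; apply: contra ns => /eqP e.
  by apply/eqP; rewrite es !size_cat; lia.
Qed.

Lemma ins_cochain d n (f g : seq A -> A) : is_cochain d.+1%:Z f ->
  is_cochain n.+1%:Z g -> is_cochain (d + n).+1%:Z (ins n f g).
Proof. by move=> cf cg; apply: plug_cochain => //; apply: marked_cochain_mark. Qed.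

Lemma insR_marked_cochain d r K (h : seq A -> A) :
  marked_cochain d K -> is_cochain r.+1%:Z h -> marked_cochain (d + r) (insR r K h).
Proof.
move=> [mK aK sK] ch; have [_ _ mK2] := mK; split.
- exact: marked_multilinear_insR (cochain_mlin ch).
- move=> i y a u; rewrite /insR twZ /ins /plug /mark size_tws split3_tws.
  rewrite (split3_linear _ _ (@tw_linear _ A i)); congr (_ *: _).
  apply: eq_split3 => p q s.
  rewrite twZ aK tws_cat tws_cons (cochain_tw ch) !size_tws !tws_tws !tw_tw.
  by rewrite !(addnC i).
- move=> y a u ns; rewrite /insR /ins -[RHS](scaler0 _ ((-1) ^+ (r * (size y).+1))).
  congr (_ *: _); rewrite -[RHS](split3_0 A u); apply: eq_split3_in => p q s eu.
  have [ev|nv] := eqVneq (size q) r.+1; last first.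
    by rewrite /mark (cochain_size ch) // (multilinear0 _ _ (mK2 _ _)) scaler0.
  rewrite /mark sK ?scaler0 // size_cat /= !size_tws; apply: contra ns => /eqP e.
  by apply/eqP; rewrite eu !size_cat; lia.
Qed.

End CochainClosure.

Section Linearity.
Variables (k : comNzRingType) (A : homAssocAlgebra k) (V : lmodType k).
Implicit Types (F G : seq A -> A -> seq A -> V) (g h : seq A -> A) (phi psi : seq A
  -> V).

Lemma markD phi psi : mark (phi + psi) = mark phi + mark psi.
Proof. by []. Qed.

Lemma markZ c phi : mark (c *: phi) = c *: mark phi.
Proof. by []. Qed.

Lemma evalmD n F G g : plug n (F + G) g = plug n F g + plug n G g.
Proof.
apply/funext => w; rewrite ?fctE -split3D; apply: eq_split3 => u v y.
by rewrite ?fctE scalerDr.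
Qed.

Lemma evalmZ n c F g : plug n (c *: F) g = c *: plug n F g.
Proof.
apply/funext => w; rewrite ?fctE split3Z; apply: eq_split3 => u v y.
by rewrite ?fctE !scalerA mulrC.
Qed.

Lemma evalmDr n F g h : marked_multilinear F -> plug n F (g + h) = plug n F g + plug
  n F h.
Proof.
move=> [_ lF _]; apply/funext => w; rewrite ?fctE -split3D; apply: eq_split3 => u v y.
by rewrite ?fctE -scalerDr -[g v]scale1r lF !scale1r.
Qed.

Lemma evalmZr n c F g : marked_multilinear F -> plug n F (c *: g) = c *: plug n F g.
Proof.
move=> [_ lF _]; apply/funext => w; rewrite ?fctE split3Z; apply: eq_split3 => u v y.
by rewrite ?fctE (linearZ_of (lF _ _)) !scalerA mulrC.
Qed.

Lemma insD n phi psi g : ins n (phi + psi) g = ins n phi g + ins n psi g.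
Proof. by rewrite /ins markD evalmD. Qed.

Lemma insZ n c phi g : ins n (c *: phi) g = c *: ins n phi g.
Proof. by rewrite /ins markZ evalmZ. Qed.

Lemma insDr n phi g h : multilinear phi -> ins n phi (g + h) = ins n phi g + ins n
  phi h.
Proof. by move=> mphi; apply/evalmDr/marked_multilinear_mark. Qed.

Lemma insZr n c phi g : multilinear phi -> ins n phi (c *: g) = c *: ins n phi g.
Proof. by move=> mphi; apply/evalmZr/marked_multilinear_mark. Qed.

Lemma insRD n F G g : insR n (F + G) g = insR n F g + insR n G g.
Proof.
apply/funext => y; apply/funext => a; apply/funext => u.
by rewrite ?fctE /insR -scalerDr insD.
Qed.

Lemma insRZ n c F g : insR n (c *: F) g = c *: insR n F g.
Proof.
apply/funext => y; apply/funext => a; apply/funext => u.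
by rewrite ?fctE /insR insZ !fctE !scalerA mulrC.
Qed.

Lemma insRDr n F g h : marked_multilinear F -> insR n F (g + h) = insR n F g + insR n
  F h.
Proof.
move=> [_ _ mF]; apply/funext => y; apply/funext => a; apply/funext => u.
by rewrite ?fctE /insR insDr // fctE scalerDr.
Qed.

Lemma insRZr n c F g : marked_multilinear F -> insR n F (c *: g) = c *: insR n F g.
Proof.
move=> [_ _ mF]; apply/funext => y; apply/funext => a; apply/funext => u.
by rewrite ?fctE /insR insZr // fctE !scalerA mulrC.
Qed.

End Linearity.

(** * Pre-Lie and brace identities *)

Section PreLie.
Variables (k : comNzRingType) (A : homAssocAlgebra k) (V : lmodType k).
Variables (n r : nat) (g h : seq A -> A).
Hypotheses (cg : is_cochain n.+1%:Z g) (ch : is_cochain r.+1%:Z h).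

Lemma ins_ins (phi : seq A -> V) : multilinear phi ->
  ins r (ins n phi g) h = ins (n + r) phi (ins r g h) +
  (plug r (insR n (mark phi) g) h + (-1) ^+ (n * r) *: plug n (insR r (mark phi) h) g).
Proof.
move=> mphi; rewrite -[ins n phi g]/(plug n (mark phi) g) (ins_plug cg ch); last
  exact: marked_multilinear_mark.
by rewrite (plug_insL cg ch) // scalerDr signZZ; congr (_ + (_ + _)); zsigns.
Qed.
End PreLie.

Section PreLieSym.
Variables (k : comNzRingType) (A : homAssocAlgebra k) (V : lmodType k).
Variables (n r : nat) (g h : seq A -> A).
Hypotheses (cg : is_cochain n.+1%:Z g) (ch : is_cochain r.+1%:Z h).

(** The associator of [ins] consists of the terms in which g and h are disjoint, and these are
    graded symmetric in g and h. *)
Lemma prelie (phi : seq A -> V) : multilinear phi ->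
  ins r (ins n phi g) h - ins (n + r) phi (ins r g h) =
  (-1) ^+ (n * r) *: (ins n (ins r phi h) g - ins (r + n) phi (ins n h g)).
Proof.
move=> mphi; rewrite (ins_ins cg ch) // (ins_ins ch cg) //.
zsigns.
Qed.

(** With the mark and the letters to its left held fixed, insertion to the right is insertion into
    an ordinary word, so [prelie] applies there. *)
Lemma prelie_insR (F : seq A -> A -> seq A -> V) : marked_multilinear F ->
  insR r (insR n F g) h - insR (n + r) F (ins r g h) =
  (-1) ^+ (n * r) *: (insR n (insR r F h) g - insR (r + n) F (ins n h g)).
Proof.
move=> [_ _ mF]; apply/funext => y; apply/funext => a; apply/funext => u.
rewrite !fctE.
have E d e (p q : seq A -> A) : insR e (insR d F p) q y a u =
    (-1) ^+ ((e + d) * (size y).+1) *: ins e (ins d (F (tws (d + e) y) (tw (d + e)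
      a)) p) q u.
  have E1 : insR d F p (tws e y) (tw e a) =
      (-1) ^+ (d * (size y).+1) *: ins d (F (tws (d + e) y) (tw (d + e) a)) p.
    by apply/funext => z; rewrite fctE /insR size_tws !tws_tws tw_tw.
  rewrite {1}/insR E1 insZ fctE signZZ.
  by congr (_ *: _); congr (_ ^+ _); lia.
rewrite !E /insR; have := prelie (mF (tws (n + r) y) (tw (n + r) a)).
move/(congr1 (fun f => f u)); rewrite !fctE => /eqP; rewrite subr_eq => /eqP ->.
by rewrite (addnC r n); zsigns.
Qed.
End PreLieSym.

Definition brack (k : comNzRingType) (A : homAssocAlgebra k) m n (f g : seq A -> A) :
  seq A -> A := ins n f g - (-1) ^+ (m * n) *: ins m g f.

(* The brace phi{g, h}, in which g stands to the left of h. *)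
Definition brace (k : comNzRingType) (A : homAssocAlgebra k) (V : lmodType k)
    (n r : nat) (phi : seq A -> V) (g h : seq A -> A) : seq A -> V :=
  (-1) ^+ (n * r) *: plug n (insR r (mark phi) h) g.

Section Brace.
Variables (k : comNzRingType) (A : homAssocAlgebra k) (V : lmodType k).
Variables (m n r : nat) (f g h : seq A -> A).
Hypotheses (cf : is_cochain m.+1%:Z f) (cg : is_cochain n.+1%:Z g).
Hypothesis ch : is_cochain r.+1%:Z h.

(* Expanding (phi o f){g, h} and phi{g, h} o f, the triple braces that occur are
   the same and cancel. *)
Lemma brace_brack (phi : seq A -> V) : multilinear phi ->
  ins m (brace n r phi g h) f =
  (-1) ^+ (m * r) *: brace (n + m) r phi (brack n m g f) h +
  brace n (r + m) phi g (brack r m h f) +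
  (-1) ^+ ((n + r) * m) *:
    (brace n r (ins m phi f) g h - ins (m + (n + r)) phi (brace n r f g h)).
Proof.
move=> mphi; have mmphi := marked_multilinear_mark mphi; have mh := cochain_mlin ch.
have mR i := marked_multilinear_insR i mmphi mh.
have cgf := ins_cochain cg cf; have cfg := ins_cochain cf cg.
rewrite /brace /brack insZ (ins_plug cg cf) //.
rewrite (insL_insR ch cf) //.
have := prelie_insR ch cf mmphi => /eqP; rewrite subr_eq => /eqP ->.
(* In (phi o f){g, h} the cochain f lies to the left of g, to its right or around it. Around g it
   may take h as well, which gives the subtracted phi o f{g, h}, or leave h outside, which completes
   the bracket of g with f. *)
rewrite mark_ins !insRD (insR_insM ch) //; last exact: marked_cochain_mark.
(* Minus signs are turned into scalars, so that rules for sums and multiples are enough. *)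
rewrite -!scaleN1r !(insRDr, insRZr, evalmDr, evalmZr, evalmD, evalmZ) //.
rewrite !plug_insM // insZr // /ins.
rewrite (_ : (m + r + n)%N = (m + (n + r))%N) ?(addnC r m) ?(addnC m n); last lia.
by rewrite !scaleN1r; zsigns.
Qed.
End Brace.

(** * Cyclic words *)

Section Circle.
Variables (k : comNzRingType) (A : homAssocAlgebra k) (V : lmodType k).
Implicit Types (Psi : A -> seq A -> V) (f g h : seq A -> A).
Implicit Types (G K : seq A -> A -> seq A -> A) (a : A) (w : seq A).

(* On a chain a (x) w, viewed as a cyclic word with base point a, the cochain G is
   applied to the arcs y, a, u around the base point, where w = u z y.  The
   parity of c is meant to be that of size w: moving one letter from the end of
   w to the front passes over size w letters. *)
Definition around c n Psi G a w : V :=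
  (-1) ^+ n *: split3 w (fun u z y => (-1) ^+ (c * size y) *: Psi (G y a u) (tws n z)).

Definition along m Psi f a w : V := ins m (Psi (tw m a)) f w.

(** The Lie derivative on the letters of a chain: f is inserted away from the base point or around
    it. Since f shortens the word by m letters, an operator nested inside carries [c + m] in place
    of c. *)
Definition lie_op c m Psi f : A -> seq A -> V := along m Psi f + around c m Psi (mark
  f).

Definition pointed_multilinear Psi := (forall w, linear (Psi^~ w)) /\ (forall a,
  multilinear (Psi a)).

Lemma aroundDl c n Psi1 Psi2 G :
  around c n (Psi1 + Psi2) G = around c n Psi1 G + around c n Psi2 G.
Proof.
apply/funext => a; apply/funext => w; rewrite !fctE -scalerDr -split3D.
by congr (_ *: _); apply: eq_split3 => u z y; rewrite fctE scalerDr.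
Qed.

Lemma aroundD c n Psi G K : pointed_multilinear Psi ->
  around c n Psi (G + K) = around c n Psi G + around c n Psi K.
Proof.
move=> [lP _]; apply/funext => a; apply/funext => w; rewrite !fctE -scalerDr -split3D.
congr (_ *: _); apply: eq_split3 => u z y; rewrite -scalerDr; congr (_ *: _).
by rewrite !fctE -[X in X + _]scale1r lP scale1r.
Qed.

Lemma aroundZ c n Psi d G : pointed_multilinear Psi -> around c n Psi (d *: G) = d *:
  around c n Psi G.
Proof.
move=> [lP _]; apply/funext => a; apply/funext => w; rewrite !fctE.
rewrite /around !split3Z; apply: eq_split3 => u z y; rewrite !fctE (linearZ_of (lP _)).
by rewrite !scalerA; congr (_ *: _); rewrite mulrC mulrA.
Qed.

(** Both arcs contain the base point, so the second one contains the result of the first. *)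
Lemma around_around c n r Psi G K : pointed_multilinear Psi ->
  around c n (around (c + n) r Psi K) G = around c (n + r) Psi (insM n K G).
Proof.
move=> [lP _]; apply/funext => a; apply/funext => w; rewrite /around /insM.
transitivity (split3 w (fun u z y => split3 z (fun u' z' y' =>
  (-1) ^+ (n + r + c * size y + (c + n) * size y') *:
    Psi (K (tws n y') (G y a u) (tws n u')) (tws (n + r) z')))).
  rewrite split3Z; apply: eq_split3 => u z y; rewrite split3_tws !split3Z.
  apply: eq_split3 => u' z' y'; rewrite !signZZ size_tws !tws_tws (addnC r).
  by apply: signZ => //; parity.
rewrite split3_mid.
transitivity (split3 w (fun x z t => split2 x (fun u u' => split2 t (fun y' y =>
  (-1) ^+ (n + r + c * size t + n * size y') *:
    Psi (K (tws n y') (G y a u) (tws n u')) (tws (n + r) z))))).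
  rewrite split3_sides; apply: eq_split5 => u u' z y' y.
  by apply: signZ => //; parity.
rewrite split3Z; apply: eq_split3 => x z t.
rewrite split2_exchange (split2_linear _ _ (lP _)) !split2Z; apply: eq_split2 => y' y.
rewrite (split2_linear _ _ (lP _)) !split2Z; apply: eq_split2 => u u'.
rewrite (linearZ_of (lP _)) !signZZ; apply: signZ => //; parity.
Qed.

(** After h is inserted away from the base point, the arc of G either misses its value, and the two
    insertions commute up to sign, or takes it in on one of the two sides of the base point. *)
Lemma along_around c n r Psi G h a w : odd c = odd (size w) -> pointed_multilinear
  Psi ->
  marked_cochain n G -> is_cochain r.+1%:Z h ->
  along r (around (c + r) n Psi G) h a w =
  (-1) ^+ (n * r) *: around c n (along r Psi h) G a w +
  around c (n + r) Psi (insR r G h + insL r G h) a w.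
Proof.
move=> ew [lP mP] [[mG1 lG mG2] aG sG] ch; rewrite aroundD ?fctE //.
rewrite {1}/along /ins {1}/plug /mark /around.
transitivity (split3 w (fun p q s => split3 p (fun u z y =>
    (-1) ^+ (r * size p + n + (c + r) * (size y + (size s).+1)) *:
    Psi (G (tws r y ++ h q :: tws r s) (tw r a) (tws r u)) (tws (n + r) z)))
 + split3 w (fun p q s => split2 p (fun u z => split2 s (fun z' y =>
    (-1) ^+ (r * size p + n + (c + r) * size y) *:
    Psi (G (tws r y) (tw r a) (tws r u)) (tws (n + r) z ++ h (tws n q) :: tws (n + r)
      z'))))
 + split3 w (fun p q s => split3 s (fun u z y =>
    (-1) ^+ (r * size p + n + (c + r) * size y) *:
    Psi (G (tws r y) (tw r a) (tws r p ++ h q :: tws r u)) (tws (n + r) z)))).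
  rewrite -!split3D; apply: eq_split3 => p q s.
  rewrite split3_cat !split3_tws split2_tws !scalerDr addrA !signZZ.
  congr (_ + _ + _); rewrite ?split3Z ?split2Z.
  - apply: eq_split3 => u z y; rewrite size_cat size_cons !size_tws !tws_tws.
    by rewrite signZZ.
  - apply: eq_split2 => u z; rewrite split2_tws split2Z; apply: eq_split2 => z' y.
    by rewrite signZZ size_tws tws_cat tws_cons !tws_tws (cochain_tw ch).
  - by apply: eq_split3 => u z y; rewrite signZZ size_tws !tws_tws.
rewrite [X in X + _]addrC -!addrA; congr (_ + _).
  transitivity (split3 w (fun u t y => split3 t (fun z q z' =>
    (-1) ^+ (n * r + n + c * size y + r * size z) *:
    Psi (G (tws r y) (tw r a) (tws r u)) (tws (n + r) z ++ h (tws n q) :: tws (n + r)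
      z')))).
    rewrite split3_mid split3_sides; apply: eq_split5 => u z q z' y.
    have [ey|ny] := eqVneq (size y + size u)%N n.
      by apply: signZ => //; rewrite -ey; parity.
    by rewrite sG ?size_tws // (linear0_of (lP _)) !scaler0.
  rewrite !split3Z; apply: eq_split3 => u t y.
  rewrite /along /ins /plug /mark split3_tws !split3Z; apply: eq_split3 => z q z'.
  rewrite !signZZ size_tws !tws_tws aG (addnC r n).
  by apply: signZ => //; parity.
rewrite addrC; congr (_ + _).
  transitivity (split3 w (fun x z y => split3 x (fun p q u =>
    (-1) ^+ (n + r + c * size y + r * (size y).+1 + r * size p) *:
    Psi (G (tws r y) (tw r a) (tws r p ++ h q :: tws r u)) (tws (n + r) z)))).
    rewrite split3_left split3_right; apply: eq_split5 => p q u z y.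
    by apply: signZ => //; parity.
  rewrite split3Z; apply: eq_split3 => x z y.
  rewrite /insR /ins /plug /mark (linearZ_of (lP _)) (split3_linear _ _ (lP _))
    !split3Z.
  apply: eq_split3 => p q u.
rewrite (linearZ_of (lP _)) !signZZ; apply: signZ => //; parity.
transitivity (split3 w (fun u z t => split3 t (fun y q s =>
  (-1) ^+ (n + r + c * size t + r * size y) *:
  Psi (G (tws r y ++ h q :: tws r s) (tw r a) (tws r u)) (tws (n + r) z)))).
  rewrite split3_left split3_right; apply: eq_split5_in => u z y q s ews.
  (* When h ends up to the left of the base point, it has been carried around the cyclic word. The
     sign comes out right only because c has the parity of the length of w. *)
  have [eq|nq] := eqVneq (size q) r.+1.
    apply: signZ => //; move: ew; rewrite ews.
    rewrite !(size_cat, eq, oddD, oddM, oddS) /=.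
    by oddcases.
  by rewrite (cochain_size ch) // (multilinear0 _ _ (mG1 _ _)) (linear0_of (lP _))
    !scaler0.
rewrite split3Z; apply: eq_split3 => u z t.
rewrite /insL /ins /plug /mark (split3_linear _ _ (lP _)) !split3Z.
apply: eq_split3 => y q s.
rewrite (linearZ_of (lP _)) !signZZ; apply: signZ => //; parity.
Qed.

End Circle.

Section Cartan.
Variables (k : comNzRingType) (A : homAssocAlgebra k) (V : lmodType k).
Variables (Psi : A -> seq A -> V) (c : nat) (a : A) (w : seq A).
Hypotheses (cPsi : pointed_multilinear Psi) (cw : odd c = odd (size w)).
Implicit Types (f g h : seq A -> A) (G K : seq A -> A -> seq A -> A).

Lemma pointed_multilinear_along m f : is_cochain m.+1%:Z f -> pointed_multilinear
  (along m Psi f).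
Proof.
have [lP mP] := cPsi => cf; split=> [z|x]; rewrite /along; last first.
  exact: multilinear_ins (mP _) (cochain_mlin cf).
move=> d x y; rewrite tw_linear.
have -> : Psi (d *: tw m x + tw m y) = d *: Psi (tw m x) + Psi (tw m y).
  by apply/funext => s; rewrite lP.
by rewrite insD insZ.
Qed.

(** In the graded commutator the disjoint configurations cancel. What survives is h inside the arc
    of G, on either side of the base point or at it, minus G at the base point inside h. *)
Lemma lie_op_around n r G h : marked_cochain n G -> is_cochain r.+1%:Z h ->
  lie_op c r (around (c + r) n Psi G) h a w =
  (-1) ^+ (n * r) *: around c n (lie_op (c + n) r Psi h) G a w +
  around c (n + r) Psi (insR r G h + insL r G h + insM r G (mark h)
    - (-1) ^+ (n * r) *: insM n (mark h) G) a w.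
Proof.
move=> cG ch; rewrite {1}/lie_op !appE (along_around _ cw) // around_around //.
rewrite /lie_op aroundDl appE around_around // -!scaleN1r !(aroundD, aroundZ) // !appE.
by rewrite (addnC r n) !scaleN1r; zsigns.
Qed.

(** Away from the base point this is [prelie]. At the base point the nested arcs are those of g o h
    and h o g, by [mark_ins]. *)
Lemma lie_op_brack n r g h : is_cochain n.+1%:Z g -> is_cochain r.+1%:Z h ->
  lie_op c r (lie_op (c + r) n Psi g) h a w
    - (-1) ^+ (n * r) *: lie_op c n (lie_op (c + n) r Psi h) g a w =
  lie_op c (n + r) Psi (brack n r g h) a w.
Proof.
move=> cg ch; have [lP mP] := cPsi.
have lieD m Psi1 Psi2 f : lie_op c m (Psi1 + Psi2) f = lie_op c m Psi1 f + lie_op c m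
  Psi2 f.
  rewrite /lie_op aroundDl; apply/funext => x; apply/funext => s.
  by rewrite !appE /along appE insD !appE addrACA.
rewrite [lie_op (c + r) n Psi g]/lie_op [lie_op (c + n) r Psi h]/lie_op !lieD !appE.
rewrite (lie_op_around (marked_cochain_mark cg) ch).
have lieE d m Psi' f : lie_op d m Psi' f a w =
  along m Psi' f a w + around d m Psi' (mark f) a w by [].
rewrite [lie_op c r (along _ _ _) _ _ _]lieE [lie_op c n (along _ _ _) _ _ _]lieE.
rewrite [lie_op c n (around _ _ _ _) _ _ _]lieE (along_around _ cw) //; last exact:
  marked_cochain_mark.
rewrite around_around // [lie_op (c + n) r Psi h]/lie_op aroundDl around_around //
  !appE.
have -> : along r (along n Psi g) h a w = ins r (ins n (Psi (tw (n + r) a)) g) h w.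
  by rewrite /along tw_tw.
have -> : along n (along r Psi h) g a w = ins n (ins r (Psi (tw (n + r) a)) h) g w.
  by rewrite /along tw_tw addnC.
have := prelie cg ch (mP (tw (n + r) a)) => /(congr1 (fun u => u w)).
rewrite !appE => /eqP; rewrite subr_eq => /eqP ->.
rewrite /lie_op /along !appE /brack.
rewrite -!scaleN1r !(insDr, insZr) // !(markD, markZ) !mark_ins.
rewrite !(aroundD, aroundZ) // !appE (addnC r n) !scaleN1r.
zsigns.
Qed.

(* The part of lie_derivative (g o f) in which g is applied around the base point
   and f inside g to the right of the base point. *)
Definition homotopy_op d n m (Psi' : A -> seq A -> V) g f := around d (n + m) Psi'
  (insR m (mark g) f).

(** The left side inserts h everywhere into the part of g o f with f to the right of the mark. By
    [prelie_insR], the terms with h in f become the bracket of f and h. The others are (g o h) o f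
    with f to the right of the mark, except where f lies inside h, which must be removed. *)
Lemma insR_total m n r f g h : is_cochain m.+1%:Z f -> is_cochain n.+1%:Z g ->
  is_cochain r.+1%:Z h ->
  let J := insR m (mark g) f in
  insR r J h + insL r J h + insM r J (mark h) =
  insR (m + r) (mark g) (brack m r f h) + (-1) ^+ (m * r) *:
    (insR m (mark (ins r g h)) f - insM (r + m) (mark g) (insR m (mark h) f)).
Proof.
move=> cf cg ch J; have mg := marked_multilinear_mark (cochain_mlin cg).
have := prelie_insR cf ch mg => /eqP; rewrite subr_eq => /eqP ->.
rewrite (insL_insR cf ch) // mark_ins !insRD (insR_insM cf) //; last exact:
  marked_cochain_mark.
rewrite /brack -!scaleN1r !(insRDr, insRZr) // !scaleN1r (addnC r m) -/J.
by zsigns.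
Qed.

Lemma lie_op_homotopy_op m n r f g h : is_cochain m.+1%:Z f -> is_cochain n.+1%:Z g ->
  is_cochain r.+1%:Z h ->
  (-1) ^+ (r * m) *: lie_op c r (homotopy_op (c + r) n m Psi g f) h a w
  - (-1) ^+ (r * n) *: homotopy_op c n m (lie_op (c + (n + m)) r Psi h) g f a w
  = (-1) ^+ (r * m) *: homotopy_op c n (m + r) Psi g (brack m r f h) a w
    + around c (n + m + r) Psi
      (insR m (mark (ins r g h)) f - insM (r + m) (mark g) (insR m (mark h) f)
      - (-1) ^+ (n * r) *: insM (n + m) (mark h) (insR m (mark g) f)) a w.
Proof.
move=> cf cg ch; have cJ := insR_marked_cochain (marked_cochain_mark cg) cf.
rewrite /homotopy_op (lie_op_around cJ ch) (insR_total cf cg ch).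
rewrite !addnA -!scaleN1r !(aroundD, aroundZ) // !appE !scaleN1r.
zsigns.
Qed.

(* lie_op_homotopy_op antisymmetrized in g and h: the terms insM, which are
   symmetric, disappear.  For h = mu this is the chain homotopy behind the
   formula for i_[f,g]. *)
Lemma cartan_homotopy m n r f g h : is_cochain m.+1%:Z f -> is_cochain n.+1%:Z g ->
  is_cochain r.+1%:Z h ->
  ((-1) ^+ (r * m) *: lie_op c r (homotopy_op (c + r) n m Psi g f) h a w
  - (-1) ^+ (r * n) *: homotopy_op c n m (lie_op (c + (n + m)) r Psi h) g f a w)
  - (-1) ^+ (n * r) *:
  ((-1) ^+ (n * m) *: lie_op c n (homotopy_op (c + n) r m Psi h f) g a w
  - (-1) ^+ (n * r) *: homotopy_op c r m (lie_op (c + (r + m)) n Psi g) h f a w)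
  = (-1) ^+ (r * m) *: homotopy_op c n (m + r) Psi g (brack m r f h) a w
   - (-1) ^+ (n * r + n * m) *: homotopy_op c r (m + n) Psi h (brack m n f g) a w
    + homotopy_op c (n + r) m Psi (brack n r g h) f a w.
Proof.
move=> cf cg ch; rewrite (lie_op_homotopy_op cf cg ch) (lie_op_homotopy_op cf ch cg)
  /homotopy_op.
rewrite (_ : (n + r + m = n + m + r)%N); last lia.
rewrite (_ : (r + m + n = n + m + r)%N); last lia.
have Er : (r + (m + n) = n + m + r)%N by lia.
have En : (n + (m + r) = n + m + r)%N by lia.
rewrite !En !Er (addnC n m) (addnC r m).
have -> : mark (brack n r g h) =
  mark (ins r g h) - (-1) ^+ (n * r) *: mark (ins n h g) by [].
rewrite -!scaleN1r !(insRD, insRZ) !(aroundD, aroundZ) // !appE !scaleN1r.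
zsigns.
Qed.

End Cartan.

(** * Identities up to homotopy *)

Section CochainIdentities.
Variables (k : comNzRingType) (A : homAssocAlgebra k).
Notation mu := (@mu_fun k A).

Lemma is_cochain_mu : is_cochain 1.+1%:Z mu.
Proof. exact/asboolP/mu_subproof. Qed.

Lemma is_cochainZ p c (f : seq A -> A) : is_cochain p f -> is_cochain p (c *: f).
Proof. by move=> /asboolP cf; apply/asboolP; exact: (rpredZ c (cf : f \in
  cochain_pred p)). Qed.

Lemma is_cochainD p (f g : seq A -> A) :
  is_cochain p f -> is_cochain p g -> is_cochain p (f + g).
Proof. by move=> /asboolP cf /asboolP cg; apply/asboolP; exact: (rpredD (cf : f \in
  cochain_pred p) cg). Qed.

Lemma split2_nill (T : Type) (V : lmodType k) (w : seq T) (F : seq T -> seq T -> V) :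
  (forall a u v, F (a :: u) v = 0) -> split2 w F = F [::] w.
Proof.
case: w => [//|a w] F0 /=; rewrite -[RHS]addr0; congr (_ + _).
by rewrite -[RHS](split2_0 V w); apply: eq_split2 => u v; rewrite F0.
Qed.

Lemma split2_nilr (T : Type) (V : lmodType k) (w : seq T) (F : seq T -> seq T -> V) :
  (forall u a v, F u (a :: v) = 0) -> split2 w F = F w [::].
Proof.
elim: w F => [//|a w IH] F F0 /=; rewrite F0 add0r IH // => u b v; exact: F0.
Qed.

(** On three letters the two terms are the two sides of hom-associativity, with opposite signs. *)
Lemma ins_mu_mu : ins 1 mu mu = 0.
Proof.
have cmm := ins_cochain is_cochain_mu is_cochain_mu.
apply/funext => w; have [|ne] := eqVneq (size w) 3; last exact: cochain_size ne.
case: w => [|a [|b [|c [|]]]] // _.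
rewrite /ins /plug /mark /split3 /= !(scaler0, addr0, add0r) muln0 muln1 expr0 expr1.
by rewrite scale1r scaleN1r hom_mulA subrr.
Qed.

Section Brackets.
Variables (m n r : nat) (f g h : seq A -> A).
Hypotheses (cf : is_cochain m.+1%:Z f) (cg : is_cochain n.+1%:Z g).
Hypothesis ch : is_cochain r.+1%:Z h.

Lemma brack_cochain : is_cochain (m + n).+1%:Z (brack m n f g).
Proof.
apply: is_cochainD; first exact: ins_cochain.
by rewrite -scaleN1r; do 2!apply: is_cochainZ; rewrite addnC; apply: ins_cochain.
Qed.

Lemma brace_cochain : is_cochain (m + n + r).+1%:Z (brace n r f g h).
Proof.
by apply: is_cochainZ; rewrite addnAC; apply: plug_cochain => //;
  apply: insR_marked_cochain => //; apply: marked_cochain_mark.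
Qed.

Lemma brackC : brack m n f g = - ((-1) ^+ (m * n) *: brack n m g f).
Proof. by rewrite /brack; zsigns. Qed.

Lemma ins_ins_brace (V : lmodType k) (phi : seq A -> V) : multilinear phi ->
  ins r (ins n phi g) h = ins (n + r) phi (ins r g h) +
  ((-1) ^+ (n * r) *: brace r n phi h g + brace n r phi g h).
Proof. by move=> mphi; rewrite (ins_ins cg ch) // /brace; zsigns. Qed.

End Brackets.

Section Jacobi.
Variables (m n r : nat) (f g h : seq A -> A).
Hypotheses (cf : is_cochain m.+1%:Z f) (cg : is_cochain n.+1%:Z g).
Hypothesis ch : is_cochain r.+1%:Z h.

(** Each left-nested product is a right-nested one plus two braces. Over the six orders of f, g, h
    every brace occurs twice and cancels. *)
Lemma brack_jacobi : brack m (n + r) f (brack n r g h) =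
  brack (m + n) r (brack m n f g) h +
  (-1) ^+ (m * n) *: brack n (m + r) g (brack m r f h).
Proof.
have mf := cochain_mlin cf; have mg := cochain_mlin cg; have mh := cochain_mlin ch.
rewrite /brack -!scaleN1r !(insD, insZ, insDr, insZr) //.
rewrite (ins_ins_brace cg ch) // (ins_ins_brace cf ch) // (ins_ins_brace cf cg) //.
rewrite (ins_ins_brace ch cg) // (ins_ins_brace ch cf) // (ins_ins_brace cg cf) //.
rewrite (addnC r m) (addnC r n) (addnC n m) !scaleN1r; zsigns.
Qed.

End Jacobi.

(* As in cup_product, the arguments of g come first. *)
Definition cupf m n (f g : seq A -> A) : seq A -> A :=
  fun w => split2 w (fun v v' => hom_mul A (tw m (g v)) (f (tws n v'))).

(** Since mu has two arguments, the values of g and f fill it and no letter remains outside them. In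
    the sign, n * m undoes the sign built into [brace], and m is the cost of passing f over one
    letter. *)
Lemma cupfE m n (f g : seq A -> A) :
  cupf m n f g = (-1) ^+ (n * m + m) *: brace n m mu g f.
Proof.
rewrite /brace signZZ; apply/funext => w; rewrite appE /cupf.
rewrite /plug [in RHS]/split3 [in RHS]split2_nill; last first.
  move=> a u v; rewrite -[RHS](split2_0 A v); apply: eq_split2 => x y.
  rewrite /insR /ins /plug /mark -[RHS](scaler0 _ ((-1) ^+ (n * size (a :: u)))).
  congr (_ *: _); rewrite -[RHS](scaler0 _ ((-1) ^+ (m * (size (tws n (a :: u))).+1))).
  congr (_ *: _); rewrite -[RHS](split3_0 A (tws n y)).
  apply: eq_split3 => p q s; rewrite -[RHS](scaler0 _ ((-1) ^+ (m * size p))).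
  congr (_ *: _); move: (tw m (g x)) (f q) (tws m p) (tws m s) => b c P S.
  rewrite !tws_cons; move: (tws m (tws n u)) => U.
  by case: U => [|? [|? ?]] //=; case: P => [|? ?].
rewrite split2Z; apply: eq_split2 => v v'; rewrite muln0 expr0 scale1r.
rewrite /insR /ins /plug /mark /= muln1 split3Z /split3 split2_nill; last first.
  move=> a u z; rewrite -[RHS](split2_0 A z); apply: eq_split2 => x y.
  by rewrite /= -[RHS](scaler0 _ ((-1) ^+ m)) -[X in _ = _ *: X](scaler0 _ ((-1) ^+
    (m * (size u).+1))); case: (tws m u).
rewrite split2_nilr; last by move=> x a u; rewrite /= !scaler0.
by rewrite /= muln0 expr0 scale1r signZZ; zsigns.
Qed.

(** The shift of a cup product exceeds the sum of the shifts by one. The extra twist is the alpha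
    that hom-associativity requires. *)
Lemma cupf_assoc m n r (f g h : seq A -> A) : is_cochain m.+1%:Z f ->
  is_cochain n.+1%:Z g ->
  cupf m (n + r).+1 f (cupf n r g h) = cupf (m + n).+1 r (cupf m n f g) h.
Proof.
move=> cf cg; apply/funext => w; rewrite /cupf.
transitivity (split3 w (fun v1 v2 v3 => hom_mul A (tw (m + n).+1 (h v1))
  (hom_mul A (g (tws (m + r) v2)) (f (tws (n + r) v3))))).
  rewrite -split2A; apply: eq_split2 => v v3.
  have lin : linear (fun x => hom_mul A (tw m x) (f (tws (n + r).+1 v3))).
    by move=> c x y; rewrite tw_linear linearPl.
  rewrite (split2_linear _ _ lin); apply: eq_split2 => v1 v2.
  have -> : f (tws (n + r).+1 v3) = hom_twist A (f (tws (n + r) v3)).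
    by rewrite -[hom_twist A _]/(tw 1 _) (cochain_tw cf) tws_tws.
  by rewrite tw_mul tw_tw (cochain_tw cg) tws_tws hom_mulA.
apply: eq_split2 => v1 v.
have lin : linear (hom_mul A (tw (m + n).+1 (h v1))) by move=> c x y; rewrite linearPr.
rewrite split2_tws (split2_linear _ _ lin); apply: eq_split2 => v2 v3.
by rewrite (cochain_tw cg) !tws_tws.
Qed.

Lemma cupf_cochain m n (f g : seq A -> A) : is_cochain m.+1%:Z f ->
  is_cochain n.+1%:Z g -> is_cochain (m + n).+2%:Z (cupf m n f g).
Proof.
move=> cf cg; rewrite cupfE; apply: is_cochainZ.
have := brace_cochain is_cochain_mu cg cf.
by congr is_cochain; congr Posz; lia.
Qed.

Section BraceLinear.
Variables (n r : nat) (phi g h : seq A -> A) (c : k).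
Hypotheses (mphi : multilinear phi) (mh : multilinear h).

Lemma braceZl : brace n r phi (c *: g) h = c *: brace n r phi g h.
Proof.
have mR := marked_multilinear_insR r (marked_multilinear_mark mphi) mh.
by rewrite /brace evalmZr // !scalerA mulrC.
Qed.

Lemma braceZr : brace n r phi g (c *: h) = c *: brace n r phi g h.
Proof.
have mF := marked_multilinear_mark mphi.
by rewrite /brace insRZr // evalmZ // !scalerA mulrC.
Qed.

Lemma brace0l : brace n r phi 0 h = 0.
Proof.
have mR := marked_multilinear_insR r (marked_multilinear_mark mphi) mh.
have e0 : (0 : seq A -> A) = 0 *: 0 by rewrite scale0r.
by rewrite /brace e0 evalmZr // !scale0r scaler0.
Qed.

Lemma brace0r : brace n r phi g 0 = 0.
Proof.
have mF := marked_multilinear_mark mphi.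
have e0 : (0 : seq A -> A) = 0 *: 0 by rewrite scale0r.
by rewrite /brace e0 insRZr // evalmZ // !scale0r scaler0.
Qed.

Lemma braceZ0 : brace n r (c *: phi) g h = c *: brace n r phi g h.
Proof. by rewrite /brace markZ insRZ evalmZ !scalerA mulrC. Qed.

End BraceLinear.

Lemma brace00 n r (g h : seq A -> A) : brace n r (0 : seq A -> A) g h = 0.
Proof.
have e0 : (0 : seq A -> A) = 0 *: 0 by rewrite scale0r.
by rewrite e0 braceZ0 !scale0r.
Qed.

Section Differential.
Variables (m n r : nat) (f g h : seq A -> A).
Hypotheses (cf : is_cochain m.+1%:Z f) (cg : is_cochain n.+1%:Z g).
Hypothesis ch : is_cochain r.+1%:Z h.
Let mmu := cochain_mlin is_cochain_mu.

Lemma diff_brack : brack (m + n) 1 (brack m n f g) mu =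
  brack m n.+1 f (brack n 1 g mu) + (-1) ^+ n *: brack m.+1 n (brack m 1 f mu) g.
Proof.
have := brack_jacobi cf cg is_cochain_mu; rewrite !addn1 => ->.
rewrite [brack n m.+1 g _]brackC.
have -> : (-1) ^+ (m * n) *: (- ((-1) ^+ (n * m.+1) *: brack m.+1 n (brack m 1 f mu) g))
   = - ((-1) ^+ n *: brack m.+1 n (brack m 1 f mu) g) by zsigns.
by rewrite subrK.
Qed.

(** This is [brace_brack] for a brace of mu with mu inserted; the term with mu o mu drops out. *)
Lemma diff_cup : brack (m + n).+1 1 (cupf m n f g) mu =
  cupf m n.+1 f (brack n 1 g mu) + (-1) ^+ n.+1 *: cupf m.+1 n (brack m 1 f mu) g.
Proof.
have := brace_brack is_cochain_mu cg cf mmu; rewrite ins_mu_mu brace00.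
rewrite !addn1 !add1n sub0r => e.
rewrite !cupfE {1}/brack insZ insZr // e (addnC n m); zsigns.
Qed.

Hypotheses (zf : brack m 1 f mu = 0) (zg : brack n 1 g mu = 0).

(** The braces in (mu o g) o f are the two cup products. For cocycles, f o mu and g o mu can be
    traded for mu o f and mu o g up to sign, so [prelie] turns the remaining terms into the
    differential of g o f. *)
Lemma cup_comm : cupf m n f g - (-1) ^+ (m.+1 * n.+1) *: cupf n m g f =
  brack (m + n) 1 ((-1) ^+ (n + n * m) *: ins m g f) mu.
Proof.
have mg := cochain_mlin cg.
have := ins_ins_brace cg cf mmu.
have := prelie cf is_cochain_mu mg.
move/eqP: zf; rewrite subr_eq0 => /eqP ->; rewrite insZr //.
move/eqP: zg; rewrite subr_eq0 => /eqP ->; rewrite insZ.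
rewrite addn1 add1n => /eqP; rewrite subr_eq => /eqP e1 e2.
rewrite !cupfE /brack insZ insZr // (addnC m n) e1 e2; zsigns.
Qed.

Hypothesis zh : brack r 1 h mu = 0.

(** Two instances of [brace_brack] are combined: f{h, g} with mu inserted, where the brackets of g
    and h with mu vanish, and mu{h, g} with f inserted. They share the brace of f o mu, which equals
    that of mu o f up to sign because f is a cocycle. *)
Lemma brack_cup : brack m (n + r).+1 f (cupf n r g h) =
  cupf (m + n) r (brack m n f g) h + (-1) ^+ (m * n.+1) *: cupf n (m + r) g (brack m
    r f h)
  + brack (m + (n + r)) 1 ((-1) ^+ (r * n + r.+1) *: brace r n f h g) mu.
Proof.
have mf := cochain_mlin cf; have mg := cochain_mlin cg.
have := brace_brack is_cochain_mu ch cg mf; rewrite zh zg.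
rewrite brace0l // brace0r // scaler0 !add0r.
have := brace_brack cf ch cg mmu.
rewrite [brack r m h f]brackC [brack n m g f]brackC -!scaleN1r.
have mfg := cochain_mlin (brack_cochain cf cg).
have mfh := cochain_mlin (brack_cochain cf ch).
rewrite !(braceZl, braceZr) //.
move/eqP: zf; rewrite subr_eq0 => /eqP ->; rewrite braceZ0.
rewrite !cupfE /brack !(insZ, insZr) // (addnC r m) (addnC n m) (addnC r n) !scaleN1r.
rewrite !(addnA, addn1, add1n, muln1, mul1n) => e2 e1; rewrite e1.
rewrite e2 addSn; zsigns.
Qed.

End Differential.

End CochainIdentities.

(** * Contraction and the Cartan formula on words *)

Section Contraction.
Variables (k : comNzRingType) (A : homAssocAlgebra k) (V : lmodType k).
Notation mu := (@mu_fun k A).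
Implicit Types (Psi : A -> seq A -> V) (f g : seq A -> A).

Definition contraction_op m Psi f a w : V :=
  split2 w (fun v y => Psi (hom_mul A (tw m a) (f v)) (tws m.+1 y)).

(** The two arguments of mu are used up by the base point and the value of f, so nothing can stand
    to the left of the base point. *)
Lemma homotopy_op_mu c m Psi f : pointed_multilinear Psi -> is_cochain m.+1%:Z f ->
  homotopy_op c 1 m Psi mu f = - contraction_op m Psi f.
Proof.
move=> [lP mP] cf; apply/funext => a; apply/funext => w; rewrite appE.
rewrite appE /homotopy_op /around.
have e y u : insR m (mark mu) f y a u =
    if y is [::] then (-1) ^+ m *: hom_mul A (tw m a) (f u) else 0.
  rewrite /insR /ins /plug /mark.
  case: y => [|b y].
    rewrite /= muln1; congr (_ *: _); rewrite /split3 split2_nill; last first.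
      move=> b v z; rewrite -[RHS](split2_0 A z); apply: eq_split2 => p q.
      by rewrite /= -[RHS](scaler0 _ ((-1) ^+ (m * (size v).+1))); case: (tws m v).
    rewrite split2_nilr; last by move=> b v z; rewrite /= scaler0.
    by rewrite muln0 expr0 scale1r.
  rewrite -[RHS](scaler0 _ ((-1) ^+ (m * (size (b :: y)).+1))); congr (_ *: _).
  rewrite -[RHS](split3_0 A u); apply: eq_split3 => p q s.
  rewrite -[RHS](scaler0 _ ((-1) ^+ (m * size p))); congr (_ *: _).
  rewrite tws_cons; case: (tws m y) => [|? [|? ?]] //.
  by case: (tws m p).
transitivity ((-1) ^+ (1 + m) *: split2 w (fun u z => (-1) ^+ m *:
    Psi (hom_mul A (tw m a) (f u)) (tws m.+1 z))).
  congr (_ *: _); apply: eq_split2 => u z; rewrite split2_nilr.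
    by rewrite e (linearZ_of (lP _)) muln0 expr0 scale1r add1n.
  by move=> x b y; rewrite e (linear0_of (lP _)) scaler0.
by rewrite -split2Z signZZ /contraction_op; zsigns.
Qed.

(** The contraction by g acts first and takes the letters next to the base point; this matches the
    order of arguments in the cup product. The rest is hom-associativity. *)
Lemma contraction_op_cup m n Psi f g a w : pointed_multilinear Psi -> is_cochain
  m.+1%:Z f ->
  contraction_op n (contraction_op m Psi f) g a w = contraction_op (m + n).+1 Psi
    (cupf m n f g) a w.
Proof.
move=> [lP mP] cf; rewrite /contraction_op /cupf.
transitivity (split3 w (fun v v' y => Psi
  (hom_mul A (tw (m + n).+1 a) (hom_mul A (tw m (g v)) (f (tws n v'))))
  (tws (m + n).+2 y))).
  apply: eq_split2 => v z; rewrite split2_tws; apply: eq_split2 => v' y.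
  have -> : f (tws n.+1 v') = hom_twist A (f (tws n v')).
    by rewrite -[hom_twist A _]/(tw 1 _) (cochain_tw cf) tws_tws.
  by rewrite tw_mul hom_mulA tw_tw tws_tws addSn addnS.
rewrite -split2A; apply: eq_split2 => z y.
have lin : linear (fun x => Psi (hom_mul A (tw (m + n).+1 a) x) (tws (m + n).+2 y)).
  by move=> c b d; rewrite linearPr lP.
by rewrite (split2_linear _ _ lin).
Qed.

End Contraction.

Section ChainIdentities.
Variables (k : comNzRingType) (A : homAssocAlgebra k) (V : lmodType k).
Notation mu := (@mu_fun k A).
Variables (Psi : A -> seq A -> V) (c : nat) (a : A) (w : seq A).
Hypotheses (cPsi : pointed_multilinear Psi) (cw : odd c = odd (size w)).
Implicit Types (f g : seq A -> A).

Lemma pointed_multilinear_around d n G : marked_cochain n G -> pointed_multilinear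
  (around d n Psi G).
Proof.
have [lP mP] := cPsi; move=> [[mG1 lG mG2] _ _]; split=> [s|x]; rewrite /around.
  apply: scale_linear; apply: linear_split3_param => u v y; apply: scale_linear.
  by move=> e b b'; rewrite lG lP.
have mG e F : multilinear F -> multilinear (fun s : seq A => e *: F s : V).
  by move=> mF; apply: (multilinear_sizeZ (fun=> e)).
apply: (mG); apply: multilinear_split3 => [v y|u y|u v].
- by apply: (mG) => s1 s2 e b b'; rewrite mG2 lP.
- by apply: (mG); apply: multilinear_tws.
- apply: (multilinear_sizeZ (fun i => (-1) ^+ (d * i))) => s1 s2 e b b'.
  by rewrite mG1 lP.
Qed.

Lemma pointed_multilinear_lie_op d m f : is_cochain m.+1%:Z f -> pointed_multilinear
  (lie_op d m Psi f).
Proof.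
move=> cf; have [l1 m1] := pointed_multilinear_along cPsi cf.
have [l2 m2] := pointed_multilinear_around d (marked_cochain_mark cf).
split=> [s e x y|x s1 s2 e b b']; rewrite /lie_op !appE.
  by rewrite l1 l2 scalerDr addrACA.
by rewrite m1 m2 scalerDr addrACA.
Qed.

Lemma lieopN d m Psi' f : lie_op d m (- Psi' : A -> seq A -> V) f = - lie_op d m Psi' f.
Proof.
rewrite /lie_op /along; apply/funext => x; apply/funext => s.
have aroundN : around d m (- Psi') (mark f) = - around d m Psi' (mark f).
  apply: (addrI (around d m Psi' (mark f))).
  rewrite -aroundDl !subrr; apply/funext => b; apply/funext => t.
  by rewrite /around -[RHS](scaler0 _ ((-1) ^+ m)) -[in RHS](split3_0 V t); congr (_
    *: _);
    apply: eq_split3 => u v y; apply: scaler0.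
rewrite aroundN !appE -!scaleN1r insZ appE.
by rewrite !scaleN1r opprD.
Qed.

(** Take g = h = mu in [lie_op_homotopy_op]. The term with mu o mu vanishes, and the two [insM]
    terms coincide and cancel because mu has odd shift. *)
Lemma contraction_op_diff m f : is_cochain m.+1%:Z f ->
  (-1) ^+ m *: lie_op c 1 (contraction_op m Psi f) mu a w
    + contraction_op m (lie_op (c + m.+1) 1 Psi mu) f a w =
  (-1) ^+ m *: contraction_op m.+1 Psi (brack m 1 f mu) a w.
Proof.
move=> cf; have cmu := @is_cochain_mu k A.
have cl := pointed_multilinear_lie_op (c + m.+1) cmu; have cb := brack_cochain cf cmu.
have := lie_op_homotopy_op a cPsi cw cf cmu cmu; rewrite !mul1n !addn1 !add1n
  !homotopy_op_mu //; last first.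
  by rewrite -[m.+1]addn1.
rewrite ins_mu_mu.
have -> : around c m.+2 Psi (insR m (mark (0 : seq A -> A)) f
    - insM m.+1 (mark mu) (insR m (mark mu) f)
    - (-1) ^+ 1 *: insM m.+1 (mark mu) (insR m (mark mu) f)) = 0.
  rewrite expr1 scaleN1r opprK addrNK.
  have -> : insR m (mark (0 : seq A -> A)) f = 0 *: insR m (mark mu) f.
    by rewrite -insRZ scale0r.
  by rewrite aroundZ // scale0r.
have z0 : (0 : A -> seq A -> V) a w = 0 by [].
rewrite lieopN // !appE z0 addr0 => e.
rewrite [RHS](_ : _ = - ((-1) ^+ m *: - contraction_op m.+1 Psi (brack m 1 f mu) a w)).
  by rewrite -e; zsigns.
by rewrite scalerN opprK.
Qed.

(** On the right of [cartan_homotopy] with h = mu, the cocycle conditions kill the terms containing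
    the bracket of f or g with mu. Only T(mu, [f, g]) is left, which is minus the contraction by the
    bracket. *)
Lemma contraction_op_brack m n f g : is_cochain m.+1%:Z f -> is_cochain n.+1%:Z g ->
  brack m 1 f mu = 0 -> brack n 1 g mu = 0 ->
  contraction_op (m + n) Psi (brack m n f g) a w =
  lie_op c n (contraction_op m Psi f) g a w
  - (-1) ^+ (m.+1 * n) *: contraction_op m (lie_op (c + m.+1) n Psi g) f a w
  + ((-1) ^+ (m.+1 * n + m) *: lie_op c 1 (homotopy_op (c + 1) n m Psi g f) mu a w
  - (-1) ^+ (m * n) *: homotopy_op c n m (lie_op (c + (n + m)) 1 Psi mu) g f a w).
Proof.
move=> cf cg zf zg; have cmu := @is_cochain_mu k A.
have cl := pointed_multilinear_lie_op (c + m.+1) cg; have cb := brack_cochain cf cg.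
have := cartan_homotopy a cPsi cw cf cg cmu; rewrite zf zg !mul1n !muln1 !add1n.
have -> : homotopy_op c n (m + 1) Psi g 0 = 0.
  have e0 : (0 : seq A -> A) = 0 *: 0 by rewrite scale0r.
  have mg := marked_multilinear_mark (cochain_mlin cg).
  by rewrite /homotopy_op e0 insRZr // aroundZ // scale0r.
have -> : homotopy_op c (n + 1) m Psi 0 f = 0.
  have e0 : (0 : seq A -> A) = 0 *: 0 by rewrite scale0r.
  by rewrite /homotopy_op e0 markZ insRZ aroundZ // scale0r.
rewrite !homotopy_op_mu // lieopN // !appE !scaler0 addr0 add0r => /eqP.
rewrite subr_eq => /eqP e; rewrite mulSn exprD -scalerA (mulnC m n).
have -> : lie_op c 1 (homotopy_op (c + 1) n m Psi g f) mu a w = (-1) ^+ m *: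
   ((-1) ^+ m *: lie_op c 1 (homotopy_op (c + 1) n m Psi g f) mu a w
     - (-1) ^+ n *: homotopy_op c n m (lie_op (c + (n + m)) 1 Psi mu) g f a w) +
   (-1) ^+ (m + n) *: homotopy_op c n m (lie_op (c + (n + m)) 1 Psi mu) g f a w by
     zsigns.
rewrite e; zsigns.
Qed.

End ChainIdentities.

(** * Cochains and chains *)

Section SplitSums.
Variables (k : comNzRingType) (T : Type) (V : lmodType k).
Implicit Types (w u v : seq T).

Lemma split2_sum w (F : seq T -> seq T -> V) :
  split2 w F = \sum_(i < (size w).+1) F (take i w) (drop i w).
Proof.
elim: w F => [|a w IH] F /=; first by rewrite big_ord1.
by rewrite big_ord_recl /= ?take0 ?drop0 (IH (fun u v => F (a :: u) v)).
Qed.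

Lemma split2_at i w (F : seq T -> seq T -> V) :
  (forall u v, w = u ++ v -> size u != i -> F u v = 0) -> (i <= size w)%N ->
  split2 w F = F (take i w) (drop i w).
Proof.
move=> F0 le_iw; rewrite split2_sum (bigD1 (Ordinal (le_iw : (i < (size w).+1)%N))) //=.
rewrite big1 ?addr0 // => j ne_ji; apply: F0; first by rewrite cat_take_drop.
by rewrite size_takel // -ltnS.
Qed.

Lemma split2_none w (F : seq T -> seq T -> V) :
  (forall u v, w = u ++ v -> F u v = 0) -> split2 w F = 0.
Proof. by move=> F0; rewrite -[RHS](split2_0 V w); apply: eq_split2_in. Qed.

Lemma sum_trunc (G : nat -> V) n N :
  (forall j, (n <= j)%N -> G j = 0) -> (n <= N)%N ->
  \sum_(j < N) G j = \sum_(j < n) G j.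
Proof.
move=> G0 le_nN; rewrite -!(big_mkord xpredT) (big_cat_nat (leq0n n) le_nN) //=.
by rewrite [X in _ + X]big_nat_cond [X in _ + X]big1 ?addr0 // => j /andP[/andP[/G0]].
Qed.

End SplitSums.

Section CochainLinks.
Variables (k : comNzRingType) (A : homAssocAlgebra k).
Notation mu := (@mu_fun k A).

Lemma spliceE m (f : seq A -> A) i s : splice m.+1%:Z f i s =
  tws m (take i s) ++ f (take m.+1 (drop i s)) :: tws m (drop (i + m.+1) s).
Proof. by rewrite /splice (_ : absz (m.+1%:Z - 1) = m) //; lia. Qed.

(** From position size w - m on, f finds too few letters and the terms vanish. Any N beyond this
    gives the same sum, so the lemma fits the different ranges in the definitions. *)
Lemma insE (V : lmodType k) m N (psi : seq A -> V) (f : seq A -> A) w :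
  is_cochain m.+1%:Z f -> multilinear psi -> (size w <= N + m)%N ->
  ins m psi f w = \sum_(j < N) (-1) ^+ (m * j) *: psi (splice m.+1%:Z f j w).
Proof.
move=> cf mpsi le_wN.
pose G j := (-1) ^+ (m * j) *: psi (splice m.+1%:Z f j w).
have G0 j : (size w - m <= j)%N -> G j = 0.
  move=> le_j; rewrite /G spliceE (cochain_size cf) ?multilinear0 ?scaler0 //.
  by rewrite size_take_min size_drop; apply/eqP; lia.
transitivity (\sum_(j < (size w).+1) G j); last first.
  by rewrite !(sum_trunc G0) //; lia.
rewrite /ins /plug /mark /split3 split2_sum; apply: eq_bigr => -[j /= lt_j] _.
have [le_m|gt_m] := leqP m.+1 (size (drop j w)).
  rewrite (split2_at _ le_m) /G; last first.
    by move=> u v _ nu; rewrite (cochain_size cf) // multilinear0 ?scaler0.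
  by rewrite spliceE drop_drop addnC size_takel.
rewrite G0 ?split2_none //; last by move: gt_m; rewrite size_drop; lia.
move=> u v e; rewrite (cochain_size cf) ?multilinear0 ?scaler0 //.
by move: gt_m; rewrite e size_cat => gt; apply/eqP; lia.
Qed.

Lemma gcast_cochain p q (e : p = q) (f : cochain A p) :
  gcast e f = f :> (seq A -> A).
Proof. by case: _ / e. Qed.

Lemma cochain_sumE p (I : Type) (r : seq I) (F : I -> cochain A p) s :
  (\sum_(i <- r) F i : cochain A p) s = \sum_(i <- r) F i s.
Proof. exact: (big_morph (fun f : cochain A p => f s)). Qed.

Lemma sgnM_nat (i j : nat) : sgn (i%:Z * j%:Z) = (-1) ^+ (i * j) :> k.
Proof. by rewrite /sgn abszM. Qed.

Lemma sum_circE m n (f : cochain A m.+1%:Z) (g : cochain A n.+1%:Z) s :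
  \sum_(1 <= i < m.+2) sgn ((n.+1%:Z - 1) * (i%:Z - 1)) *: circ f i g s = ins n f g s.
Proof.
have cf := cochainP f; have cg := cochainP g.
have cfg := ins_cochain cf cg.
have [es|ns] := eqVneq (size s) (m + n).+1; last first.
  rewrite (cochain_size cfg) // big1 // => i _.
  have [sc _ _] := cochainP (circ f i g); rewrite sc ?scaler0 //.
  by apply: contra ns => /andP[_ /eqP e]; apply/eqP; lia.
rewrite (insE (N := m.+1) cg (cochain_mlin cf)); last lia.
rewrite big_add1 big_mkord; apply: eq_bigr => -[j /= _] _.
have -> : n.+1%:Z - 1 = n%:Z by lia.
have -> : j.+1%:Z - 1 = j%:Z by lia.
by rewrite sgnM_nat.
Qed.

Lemma bracketE m n (f : cochain A m.+1%:Z) (g : cochain A n.+1%:Z) :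
  bracket f g = brack m n f g :> (seq A -> A).
Proof.
apply/funext => s; rewrite /bracket /brack.
have E p (x y : cochain A p) : (x - y) s = x s - y s by [].
have Z p c (x : cochain A p) : (c *: x) s = c *: x s by [].
rewrite E Z !cochain_sumE !appE; congr (_ - _).
  by rewrite -sum_circE; apply: eq_bigr.
have -> : n.+1%:Z - 1 = n%:Z by lia.
have em : m.+1%:Z - 1 = m%:Z by lia.
rewrite em sgnM_nat; congr (_ *: _).
rewrite -sum_circE em; apply: eq_bigr => i _.
by rewrite Z gcast_cochain.
Qed.

Lemma cup_productE m n (f : cochain A m.+1%:Z) (g : cochain A n.+1%:Z) :
  cup_product f g = cupf m n f g :> (seq A -> A).
Proof.
have cf := cochainP f; have cg := cochainP g.
apply/funext => s; have [es|ns] := eqVneq (size s) (m + n).+2; last first.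
  rewrite (cochain_size (cupf_cochain cf cg)) //.
  have [sc _ _] := cochainP (cup_product f g); rewrite sc //.
  by apply: contra ns => /andP[_ /eqP e]; apply/eqP; lia.
have -> : cup_product f g s = mu (splice m.+1%:Z f 1 (splice n.+1%:Z g 0 s)).
  by rewrite /cup_product gcast_cochain.
rewrite !spliceE take0 drop0 add0n add1n [tws n [::]]/= cat0s.
rewrite [take 1 _]/= [drop 1 _]/= [drop _ _]/= take0 drop0.
have sz : size (tws n (drop n.+1 s)) = m.+1 by rewrite size_tws size_drop es; lia.
have -> : drop m.+2 (g (take n.+1 s) :: tws n (drop n.+1 s)) = [::].
  by rewrite drop_oversize //= sz.
have -> : take m.+1 (tws n (drop n.+1 s)) = tws n (drop n.+1 s).
  by rewrite take_oversize // sz.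
rewrite /= /cupf (@split2_at _ _ _ n.+1) //; last lia.
move=> u v _ nu; rewrite (cochain_size cg) //.
by rewrite (linear0_of (@tw_linear _ A m)) linear0l.
Qed.

(** The identities above have mu as second entry of the bracket, [delta] has it as first. *)
Lemma deltaE m p q (e : p + 1 = q) (f : cochain A p) : p = m.+1%:Z ->
  delta e f = - ((-1) ^+ m *: brack m 1 f mu) :> (seq A -> A).
Proof.
move=> ep; subst p; rewrite /delta gcast_cochain.
by rewrite (@bracketE 1) (brackC 1) mul1n.
Qed.

Lemma cochain_nonpos p (f : cochain A p) : p <= 0 -> f = 0.
Proof.
move=> p0; apply: val_inj; apply/funext => s /=; have [sf _ _] := cochainP f.
by rewrite sf // negb_and; case: s => [//|a s] /=; apply/eqP; lia.
Qed.

End CochainLinks.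

Section ChainLinks.
Variables (k : comNzRingType) (A : homAssocAlgebra k).
Notation mu := (@mu_fun k A).

Lemma chain_ind n (P : chain A n -> Prop) :
  P 0 -> (forall c s x, P x -> P (c *: tensor n s + x)) -> forall x, P x.
Proof.
move=> P0 PD; elim/qclass_ind; elim/freeg_ind_dom0; first by rewrite linear0.
move=> c s D _ _ PDD; have -> : << c *g s >> = c *: generator s.
  by apply/eqP/freeg_eqP => y; rewrite coeffZ !coeffU mul1r.
by rewrite linearP; apply: PD.
Qed.

Lemma chain_ext n (V : lmodType k) (F G : chain A n -> V) : linear F -> linear G ->
  (forall a w, size w = n :> int -> F (tensor n (a :: w)) = G (tensor n (a :: w))) ->
  forall x, F x = G x.
Proof.
move=> lF lG e.
have z0 (H : chain A n -> V) : linear H -> H 0 = 0.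
  by move=> lH; have := lH (-1) 0 0; rewrite scaler0 addr0 scaleN1r addNr.
elim/chain_ind => [|c s x ex]; first by rewrite !z0.
rewrite lF lG ex; congr (_ *: _ + _).
have [ls|nls] := boolP (has_length (n + 1) s); last first.
  by rewrite tensor_supported // !z0.
case: s ls => [//|a w] /andP[_ /eqP /= sw]; apply: e; lia.
Qed.

Lemma gcast_tensor n m (e : n = m) s : gcast e (tensor n s) = tensor m s :> chain A m.
Proof. by case: _ / e. Qed.

(** The function [Psi] for which the operators on words become those on chains. *)
Definition pointed_tensor n (a : A) (w : seq A) : chain A n := tensor n (a :: w).

Lemma pointed_multilinear_pointed_tensor n : pointed_multilinear (@pointed_tensor n).
Proof.
split=> [w c x y|a s1 s2 c x y]; first exact: (@tensor_multilinear k A n [::]).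
by rewrite /pointed_tensor -!cat_cons tensor_multilinear.
Qed.

Lemma pointed_tensor_supported n a w : size w != n :> int -> pointed_tensor n a w = 0.
Proof.
move=> nw; apply: tensor_supported; rewrite /has_length /=.
by apply: contra nw => /eqP e; apply/eqP; lia.
Qed.

Section Vanishing.
Variables (V : lmodType k) (Psi : A -> seq A -> V) (m : nat) (w : seq A).
Hypotheses (cPsi : pointed_multilinear Psi).

(** Every surviving term has lost exactly m letters, so it is enough that Psi vanishes in that
    length. This settles tensors of the wrong length and the degrees in which an operator on chains
    is zero by definition. *)
Lemma around_vanish c G a : marked_cochain m G ->
  (forall b v, (size v + m = size w)%N -> Psi b v = 0) -> around c m Psi G a w = 0.
Proof.
have [lP _] := cPsi; move=> [_ _ sG] P0; rewrite /around -[RHS](scaler0 _ ((-1) ^+ m)).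
congr (_ *: _); rewrite -[RHS](split3_0 V w); apply: eq_split3_in => u z y ew.
have [e|ne] := eqVneq (size y + size u)%N m; last first.
  by rewrite sG // (linear0_of (lP _)) scaler0.
by rewrite P0 ?scaler0 // ew !size_cat size_tws; lia.
Qed.

Lemma lie_op_vanish c f a : is_cochain m.+1%:Z f ->
  (forall b v, (size v + m = size w)%N -> Psi b v = 0) -> lie_op c m Psi f a w = 0.
Proof.
have [_ mP] := cPsi; move=> cf P0; rewrite /lie_op !appE around_vanish ?addr0 //;
  last first.
  exact: marked_cochain_mark.
rewrite /along /ins /plug /mark -[RHS](split3_0 V w); apply: eq_split3_in => u v y ew.
have [e|ne] := eqVneq (size v) m.+1; last first.
  by rewrite (cochain_size cf) // multilinear0 ?scaler0.
by rewrite P0 ?scaler0 // ew !size_cat /= !size_tws; lia.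
Qed.

Lemma contraction_op_vanish f a : is_cochain m.+1%:Z f ->
  (forall b v, (size v + m.+1 = size w)%N -> Psi b v = 0) -> contraction_op m Psi f a
    w = 0.
Proof.
have [lP _] := cPsi; move=> cf P0; rewrite /contraction_op; apply: split2_none => v y
  ew.
have [e|ne] := eqVneq (size v) m.+1; last first.
  by rewrite (cochain_size cf) // linear0r (linear0_of (lP _)).
by rewrite P0 // ew size_cat size_tws; lia.
Qed.

End Vanishing.

Lemma iter_rotr (a : A) w j : (j <= size w)%N ->
  iter j (rotr 1) (a :: w) = drop (size w - j) w ++ a :: take (size w - j) w.
Proof.
elim: j => [|j IH] le_j /=; first by rewrite subn0 drop_size take_size.
rewrite IH ?(ltnW le_j) //; have [i ei] : exists i, (size w - j = i.+1)%N.
  by exists (size w - j).-1; lia.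
have -> : (size w - j.+1 = i)%N by lia.
rewrite ei (take_nth a) -?rcons_cons -?rcons_cat ?rotr1_rcons; last lia.
have -> : drop i w = nth a w i :: drop i.+1 w by rewrite -drop_nth //; lia.
by [].
Qed.

Lemma iter_rotate n j s : iter j (@rotate k A n) (tensor n s) = tensor n (iter j
  (rotr 1) s).
Proof. by elim: j => [//|j IH] /=; rewrite IH rotateE. Qed.

Lemma split2_sumr (V : lmodType k) (w : seq A) (F : seq A -> seq A -> V) :
  split2 w F = \sum_(j < (size w).+1) F (take (size w - j) w) (drop (size w - j) w).
Proof.
rewrite split2_sum (reindex_inj rev_ord_inj); apply: eq_bigr => j _ /=.
by rewrite subSS.
Qed.

(** The last j letters of w form the part of the arc to the left of the base point; j rotations
    bring them to the front. *)
Lemma around_sum (V : lmodType k) (Psi : A -> seq A -> V) c m f a w :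
  pointed_multilinear Psi -> is_cochain m.+1%:Z f -> (m <= size w)%N ->
  around c m Psi (mark f) a w = \sum_(j < m.+1) (-1) ^+ (c * j + m) *:
    Psi (f (take m.+1 (iter j (rotr 1) (a :: w))))
        (tws m (drop m.+1 (iter j (rotr 1) (a :: w)))).
Proof.
move=> [lP mP] cf le_m; rewrite /around -split2A split2_sumr scaler_sumr.
pose G j := (-1) ^+ m *: split2 (take (size w - j) w) (fun u v =>
   (-1) ^+ (c * size (drop (size w - j) w)) *:
      Psi (mark f (drop (size w - j) w) a u) (tws m v)).
(* An arc with more than m letters to the left of the base point is too long for f. *)
have G0 j : (m.+1 <= j)%N -> (j < (size w).+1)%N -> G j = 0.
  move=> le_j lt_j; rewrite /G split2_none ?scaler0 // => u v _.
  rewrite (marked_cochain_size (marked_cochain_mark cf)) ?(linear0_of (lP _))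
    ?scaler0 //.
  by rewrite size_drop; apply/eqP; lia.
rewrite -(big_mkord xpredT G) (big_cat_nat (leq0n m.+1)) //=.
rewrite [X in _ + X]big_nat_cond [X in _ + X]big1 ?addr0; last first.
  by move=> j /andP[/andP[le_j lt_j] _]; apply: G0.
rewrite big_mkord; apply: eq_bigr => -[j /= lt_j] _.
rewrite iter_rotr; last lia.
have sd : size (drop (size w - j) w) = j by rewrite size_drop; lia.
rewrite /G sd (@split2_at _ _ _ (m - j)%N); last first.
- by rewrite size_takel; lia.
- move=> u v _ nu; rewrite (marked_cochain_size (marked_cochain_mark cf))
  ?(linear0_of (lP _)) ?scaler0 //.
  by rewrite sd; apply: contra nu => /eqP e; apply/eqP; lia.
rewrite signZZ take_cat drop_cat sd ltnNge (ltnW lt_j) /=.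
have -> : (m.+1 - j = (m - j).+1)%N by lia.
by apply: signZ => //; rewrite addnC.
Qed.

Lemma lieE m n (f : cochain A m.+1%:Z) a w :
  lie_derivative f (tensor n (a :: w)) =
  lie_op `|n|%N m (@pointed_tensor (n - m.+1%:Z + 1)) f a w.
Proof.
have cf := cochainP f; have cT := pointed_multilinear_pointed_tensor (n - m.+1%:Z + 1).
rewrite /lie_derivative.
case: ifP => le_pn; last first.
  rewrite lie_op_vanish // => b v _; apply: pointed_tensor_supported; apply/eqP; lia.
have [en|nn] := eqVneq ((size w)%:Z) n; last first.
  rewrite lie_op_vanish //; last first.
    by move=> b v e; apply: pointed_tensor_supported; apply/eqP; move: nn => /eqP; lia.
  rewrite [tensor _ _](pointed_tensor_supported a nn) !big1 ?addr0 // => i _.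
    by rewrite [iter _ _ _](_ : _ = 0) ?linear0 ?scaler0 //; elim: i.-1 => //= j ->;
      rewrite linear0.
  by rewrite linear0 scaler0.
have le_m : (m <= size w)%N by lia.
rewrite /lie_op !appE; congr (_ + _).
  rewrite /along (insE (N := absz (n - m.+1%:Z + 1)) cf); [|by case: cT|lia].
  rewrite big_add1 big_mkord; apply: eq_bigr => -[j /= _] _.
  have -> : m.+1%:Z - 1 = m%:Z by lia.
  have -> : j.+1%:Z - 1 = j%:Z by lia.
  rewrite sgnM_nat bulletE !spliceE; congr (_ *: _).
rewrite (around_sum _ _ cT cf le_m) big_add1 big_mkord; apply: eq_bigr => -[j /=
  lt_j] _.
rewrite iter_rotate bulletE spliceE take0 drop0 add0n; congr (_ *: _).
rewrite /sgn -en; congr (_ ^+ _).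
have -> : (size w)%:Z * (j.+1%:Z - 1) + m.+1%:Z - 1 = (size w * j + m)%N%:Z by lia.
by [].
Qed.

Lemma chain_neg n (x : chain A n) : n < 0 -> x = 0.
Proof.
move=> n0; elim/chain_ind: x => [//|c s x ->].
rewrite tensor_supported ?scaler0 ?addr0 // negb_and; case: s => [//|a s] /=.
by apply/eqP; lia.
Qed.

Lemma contractionE m n (f : cochain A m.+1%:Z) a w :
  contraction f (tensor n (a :: w)) = contraction_op m (@pointed_tensor (n -
    m.+1%:Z)) f a w.
Proof.
have cf := cochainP f; have cT := pointed_multilinear_pointed_tensor (n - m.+1%:Z).
rewrite /contraction; case: ifP => le_pn; last first.
  rewrite contraction_op_vanish // => b v _; apply: pointed_tensor_supported;
    apply/eqP; lia.
have [en|nn] := eqVneq ((size w)%:Z) n; last first.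
  rewrite contraction_op_vanish //; last first.
    by move=> b v e; apply: pointed_tensor_supported; apply/eqP; move: nn => /eqP; lia.
  by rewrite [tensor _ _](pointed_tensor_supported a nn) !linear0.
have le_m : (m.+1 <= size w)%N by lia.
rewrite bulletE gcast_tensor /contraction_op (@split2_at _ _ _ m.+1) //; last first.
  by move=> u v _ nu; rewrite (cochain_size cf) // linear0r (linear0_of (cT.1 _)).
rewrite /splice (_ : absz (2%:Z + m.+1%:Z - 1)%R = m.+2); last lia.
rewrite (_ : absz (2%:Z + m.+1%:Z - 1 - 1)%R = m.+1); last lia.
rewrite take0 drop0 add0n /pointed_tensor; congr (tensor _ (_ :: _)).
rewrite -[LHS]/(mu (splice m.+1%:Z f 1 (a :: take m.+1 w))) spliceE.
rewrite [take 1 _]/= [drop 1 _]/= take0 drop0.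
by rewrite drop_oversize /= ?size_takel // take_oversize // size_takel.
Qed.

Lemma dalpha_lie n M (e : M + 1 = n) (x : chain A n) :
  dalpha e x = - gcast (deg_d e) (lie_derivative (@Defs.mu k A) x).
Proof.
(* For n <= 0 the target degree is negative and both sides are zero. Otherwise the bounds given by
   absolute values are the true ones. *)
have [n0|n0] := leP n 0.
  by rewrite [LHS]chain_neg ?[RHS]chain_neg //; lia.
rewrite /dalpha /lie_derivative -linearN; congr (gcast _ _).
have -> : 2%:Z <= n + 1 by lia.
have -> : (absz (n - 2%:Z + 1)%R).+1 = `|n|%N by lia.
have -> : \sum_(1 <= i < `|2%:Z|.+1) sgn (n * (i%:Z - 1) + 2%:Z - 1) *:
     bullet (@Defs.mu k A) 0 (iter i.-1 (@rotate k A n) x) =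
   - bullet (@Defs.mu k A) 0 x - sgn n *: bullet (@Defs.mu k A) 0 (rotate x).
  rewrite big_nat_recr //= big_nat1 /= !subrr mulr0 add0r.
  have -> : sgn (2%:Z - 1) = -1 :> k by rewrite /sgn expr1.
  rewrite scaleN1r -scaleNr; congr (_ + _ *: _).
  rewrite /sgn -signr_odd -[in RHS]signr_odd.
  have -> : odd (absz (n * (2%:Z - 1) + 2%:Z - 1)%R) = ~~ odd (absz n) by lia.
  by case: odd; rewrite /= ?expr1 ?expr0 ?opprK.
suff -> : \sum_(1 <= i < `|n|%N) sgn i *: bullet (@Defs.mu k A) i x =
    - \sum_(1 <= i < `|n|%N) sgn ((2%:Z - 1) * (i%:Z - 1)) *: bullet (@Defs.mu k A) i x.
  by zmodule.
rewrite -sumrN; apply: eq_big_nat => i /andP[i0 _].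
rewrite -scaleNr; congr (_ *: _); rewrite /sgn -signr_odd -[in RHS]signr_odd.
have -> : odd (absz ((2%:Z - 1) * (i%:Z - 1))%R) = ~~ odd (absz i%:Z) by lia.
by case: odd; rewrite /= ?expr1 ?expr0 ?opprK.
Qed.

Lemma lie_derivative_linear m n (f : cochain A m) : linear (@lie_derivative k A m n f).
Proof.
rewrite /lie_derivative; case: (m <= n + 1); last by move=> c x y; rewrite scaler0
  addr0.
apply: add_linear; apply: sum_linear => i; apply: scale_linear; first exact:
  bullet_is_linear.
move=> c x y; have -> : iter i.-1 (@rotate k A n) (c *: x + y) =
    c *: iter i.-1 (@rotate k A n) x + iter i.-1 (@rotate k A n) y.
  by elim: i.-1 => //= j ->; rewrite linearP.
by rewrite linearP.
Qed.

Lemma contraction_linear m n (f : cochain A m) : linear (@contraction k A m n f).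
Proof.
rewrite /contraction => c x y; case: (m <= n); last by rewrite scaler0 addr0.
by rewrite !linearP.
Qed.

HB.instance Definition _ m n (f : cochain A m) :=
  GRing.isLinear.Build k (chain A n) (chain A (n - m + 1)) _
    (@lie_derivative k A m n f) (@lie_derivative_linear m n f).

HB.instance Definition _ m n (f : cochain A m) :=
  GRing.isLinear.Build k (chain A n) (chain A (n - m)) _
    (@contraction k A m n f) (@contraction_linear m n f).

End ChainLinks.

(** * The identities for operators on chains *)

Section Naturality.
Variables (k : comNzRingType) (A : homAssocAlgebra k) (V W : lmodType k).
Variables (Phi : V -> W) (Psi : A -> seq A -> V).
Hypothesis lPhi : linear Phi.

Lemma around_natural c n G a w :
  Phi (around c n Psi G a w) = around c n (fun b v => Phi (Psi b v)) G a w.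
Proof.
rewrite /around (linearZ_of lPhi) (split3_linear _ _ lPhi); congr (_ *: _).
by apply: eq_split3 => u z y; rewrite (linearZ_of lPhi).
Qed.

(** With Phi itself an operator on chains, a composite of two such operators becomes one operator on
    words nested in another. *)
Lemma lie_op_natural c m f a w :
  Phi (lie_op c m Psi f a w) = lie_op c m (fun b v => Phi (Psi b v)) f a w.
Proof.
rewrite /lie_op !appE -around_natural -[X in Phi (X + _)]scale1r lPhi scale1r.
congr (_ + _); rewrite /along /ins /plug (split3_linear _ _ lPhi).
by apply: eq_split3 => u z y; rewrite (linearZ_of lPhi).
Qed.

Lemma contraction_op_natural m f a w :
  Phi (contraction_op m Psi f a w) = contraction_op m (fun b v => Phi (Psi b v)) f a w.
Proof. exact: split2_linear. Qed.

End Naturality.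

Section Parity.
Variables (k : comNzRingType) (A : homAssocAlgebra k) (V : lmodType k).
Variables (Psi : A -> seq A -> V) (c d : nat).
Hypothesis cd : odd c = odd d.

(** Needed to pass from the absolute value of an intermediate degree to the sums [c + n] of the word
    calculus, which agree with it only modulo 2. *)
Lemma around_odd n G : around c n Psi G = around d n Psi G.
Proof.
apply/funext => a; apply/funext => w; congr (_ *: _); apply: eq_split3 => u z y.
by apply: signZ => //; rewrite !oddM cd.
Qed.

Lemma lie_op_odd m f : lie_op c m Psi f = lie_op d m Psi f.
Proof. by rewrite /lie_op around_odd. Qed.

Lemma homotopy_op_odd n m g f : homotopy_op c n m Psi g f = homotopy_op d n m Psi g f.
Proof. exact: around_odd. Qed.

End Parity.

Section TypedIdentities.
Variables (k : comNzRingType) (A : homAssocAlgebra k).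
Notation mu := (@mu_fun k A).
Notation mu2 := (@Defs.mu k A).

(** The target degree is free and its equation a parameter, so that composites can be stated without
    further transports. *)
Definition castlie (p n M : int) (e : n - p + 1 = M) (f : cochain A p) (x : chain A
  n) : chain A M :=
  gcast e (lie_derivative f x).

Definition castio (p n M : int) (e : n - p = M) (f : cochain A p) (x : chain A n) :
  chain A M :=
  gcast e (contraction f x).

Lemma castlie_linear p n M (e : n - p + 1 = M) f : linear (castlie e f).
Proof. by move=> c x y; rewrite /castlie !linearP. Qed.

Lemma castio_linear p n M (e : n - p = M) f : linear (castio e f).
Proof. by move=> c x y; rewrite /castio !linearP. Qed.

HB.instance Definition _ p n M (e : n - p + 1 = M) f :=
  GRing.isLinear.Build k (chain A n) (chain A M) _ (castlie e f) (castlie_linear e f).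

HB.instance Definition _ p n M (e : n - p = M) f :=
  GRing.isLinear.Build k (chain A n) (chain A M) _ (castio e f) (castio_linear e f).

Section Evaluation.
Variables (p : int) (m : nat) (def_p : p = m.+1%:Z) (f : cochain A p).
Variables (n M : int).

Lemma castlieE (e : n - p + 1 = M) a w :
  castlie e f (tensor n (a :: w)) = lie_op `|n|%N m (@pointed_tensor k A M) f a w.
Proof. by subst p; rewrite /castlie; case: _ / e; apply: lieE. Qed.

Lemma castioE (e : n - p = M) a w :
  castio e f (tensor n (a :: w)) = contraction_op m (@pointed_tensor k A M) f a w.
Proof. by subst p; rewrite /castio; case: _ / e; apply: contractionE. Qed.

Lemma castlie_pointed_tensor (e : n - p + 1 = M) :
  (fun b v => castlie e f (@pointed_tensor k A n b v)) = lie_op `|n|%N m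
    (@pointed_tensor k A M) f.
Proof. by apply/funext => b; apply/funext => v; apply: castlieE. Qed.

Lemma castio_pointed_tensor (e : n - p = M) :
  (fun b v => castio e f (@pointed_tensor k A n b v)) = contraction_op m
    (@pointed_tensor k A M) f.
Proof. by apply/funext => b; apply/funext => v; apply: castioE. Qed.

End Evaluation.

Lemma muP : 2%:Z = 1.+1%:Z. Proof. by []. Qed.

Lemma cochain_shift p m (f : cochain A p) : p = m.+1%:Z -> is_cochain m.+1%:Z f.
Proof. by move=> <-; apply: cochainP. Qed.

Section HopChain.
Variables (m n : nat) (f g : seq A -> A) (N M : int).
Hypotheses (cf : is_cochain m.+1%:Z f) (cg : is_cochain n.+1%:Z g).
Hypothesis eNM : M + (m + n)%N%:Z = N.

Definition homotopy_fun (s : seq A) : chain A M :=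
  if s is a :: w then homotopy_op `|N|%N n m (@pointed_tensor k A M) g f a w else 0.

Lemma homotopy_fun_multilinear : multilinear homotopy_fun.
Proof.
have cJ := insR_marked_cochain (marked_cochain_mark cg) cf.
have [lP mP] := pointed_multilinear_around (pointed_multilinear_pointed_tensor A M)
  `|N|%N cJ.
by case=> [|a s1] s2 c x y /=; [apply: lP|apply: mP].
Qed.

Lemma homotopy_fun_supported : supported (N + 1) homotopy_fun.
Proof.
have cJ := insR_marked_cochain (marked_cochain_mark cg) cf.
case=> [//|a w] /= nw; apply: (around_vanish (pointed_multilinear_pointed_tensor A M)
  _ _ cJ) => b v e.
apply: pointed_tensor_supported; apply: contra nw => /eqP ev.
by rewrite /has_length /=; apply/eqP; lia.
Qed.

(** The operator T(g, f) as a map of chains. *)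
Definition homotopy_chain : chain A N -> chain A M := tensor_lift homotopy_fun.

Lemma homotopy_chain_linear : linear homotopy_chain.
Proof. exact: tensor_lift_linear homotopy_fun_multilinear homotopy_fun_supported. Qed.

Lemma homotopy_chainE a w :
  homotopy_chain (tensor N (a :: w)) = homotopy_op `|N|%N n m (@pointed_tensor k A M)
    g f a w.
Proof. exact: (tensor_liftE homotopy_fun_multilinear homotopy_fun_supported). Qed.

End HopChain.

Section Identities.
Variables (p q r : int) (m n : nat).
Hypotheses (def_p : p = m.+1%:Z) (def_q : q = n.+1%:Z).
Variables (f : cochain A p) (g : cochain A q) (h : cochain A r).
Variable N : int.

Lemma castlie_brack (M M1 M2 : int) (e : N - r + 1 = M)
    (e1 : N - q + 1 = M1) (e2 : M1 - p + 1 = M)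
    (e3 : N - p + 1 = M2) (e4 : M2 - q + 1 = M) (x : chain A N) :
  h = brack m n f g :> (seq A -> A) -> r = (m + n).+1%:Z ->
  castlie e h x = castlie e2 f (castlie e1 g x)
    - (-1) ^+ (m * n) *: castlie e4 g (castlie e3 f x).
Proof.
move=> eh def_r; have cf := cochain_shift f def_p; have cg := cochain_shift g def_q.
move: x; apply: chain_ext => [||a w sw]; first exact: castlie_linear.
  apply: sub_linear; [|apply: scale_linear].
    exact: comp_linear (castlie_linear e2 f) (castlie_linear e1 g).
  exact: comp_linear (castlie_linear e4 g) (castlie_linear e3 f).
rewrite (castlieE def_r) (castlieE def_q) (castlieE def_p) eh.
rewrite (lie_op_natural _ (castlie_linear e2 f)) (lie_op_natural _ (castlie_linear e4
  g)).
rewrite (castlie_pointed_tensor def_p) (castlie_pointed_tensor def_q).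
have cw : odd `|N|%N = odd (size w) by lia.
rewrite -(lie_op_brack a (pointed_multilinear_pointed_tensor A M) cw cf cg).
rewrite (@lie_op_odd _ _ _ _ (absz M1) (`|N| + n)%N); last lia.
by rewrite (@lie_op_odd _ _ _ _ (absz M2) (`|N| + m)%N); last lia.
Qed.

Lemma castio_cup (M M1 : int) (e : N - r = M) (e1 : N - q = M1) (e2 : M1 - p = M) (x
  : chain A N) :
  h = cupf m n f g :> (seq A -> A) -> r = (m + n).+2%:Z ->
  castio e h x = castio e2 f (castio e1 g x).
Proof.
move=> eh def_r; have cf := cochain_shift f def_p; have cg := cochain_shift g def_q.
move: x; apply: chain_ext => [||a w sw]; first exact: castio_linear.
  exact: comp_linear (castio_linear e2 f) (castio_linear e1 g).
rewrite (castioE def_r) (castioE def_q) eh (contraction_op_natural _ (castio_linear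
  e2 f)).
by rewrite (castio_pointed_tensor def_p) -(contraction_op_cup _ _ _ _
  (pointed_multilinear_pointed_tensor A M)).
Qed.

Lemma castio_diff (M M1 M2 : int) (e : N - r = M)
    (e1 : N - 2%:Z + 1 = M1) (e2 : M1 - p = M)
    (e3 : N - p = M2) (e4 : M2 - 2%:Z + 1 = M) (x : chain A N) :
  h = brack m 1 f mu :> (seq A -> A) -> r = m.+2%:Z ->
  (-1) ^+ m *: castio e2 f (castlie e1 mu2 x) + castlie e4 mu2 (castio e3 f x) =
  (-1) ^+ m *: castio e h x.
Proof.
clear g def_q; move=> eh def_r; have cf := cochain_shift f def_p.
move: x; apply: chain_ext => [||a w sw].
- apply: add_linear; first apply: scale_linear.
    exact: comp_linear (castio_linear e2 f) (castlie_linear e1 mu2).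
  exact: comp_linear (castlie_linear e4 mu2) (castio_linear e3 f).
- exact/scale_linear/castio_linear.
rewrite (castlieE muP) (castioE def_p) (castioE def_r) eh.
rewrite (lie_op_natural _ (castio_linear e2 f)) (contraction_op_natural _
  (castlie_linear e4 mu2)).
rewrite (castio_pointed_tensor def_p) (castlie_pointed_tensor muP).
have cw : odd `|N|%N = odd (size w) by lia.
rewrite -(contraction_op_diff a (pointed_multilinear_pointed_tensor A M) cw cf).
by rewrite (@lie_op_odd _ _ _ _ (absz M2) (`|N| + m.+1)%N); last lia.
Qed.

Lemma castio_brack (M M1 M2 M3 M4 : int) (e : N - r = M)
    (e1 : N - q + 1 = M1) (e2 : M1 - p = M)
    (e3 : N - p = M2) (e4 : M2 - q + 1 = M)
    (e5 : N - 2%:Z + 1 = M3) (e6 : M + (m + n)%N%:Z = M3)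
    (e7 : M4 + (m + n)%N%:Z = N) (e8 : M4 - 2%:Z + 1 = M) (x : chain A N) :
  brack m 1 f mu = 0 -> brack n 1 g mu = 0 ->
  h = brack m n f g :> (seq A -> A) -> r = (m + n).+1%:Z ->
  castio e h x = castio e2 f (castlie e1 g x)
    - (-1) ^+ (m.+1 * n) *: castlie e4 g (castio e3 f x)
    + ((-1) ^+ (m.+1 * n + m) *: homotopy_chain m n f g M (castlie e5 mu2 x)
       - (-1) ^+ (m * n) *: castlie e8 mu2 (homotopy_chain m n f g M4 x)).
Proof.
move=> zf zg eh def_r; have cf := cochain_shift f def_p; have cg := cochain_shift g
  def_q.
have l1 := homotopy_chain_linear cf cg e6; have l2 := homotopy_chain_linear cf cg e7.
move: x; apply: chain_ext => [||a w sw]; first exact: castio_linear.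
  apply: add_linear; apply: sub_linear; try apply: scale_linear.
  - exact: comp_linear (castio_linear e2 f) (castlie_linear e1 g).
  - exact: comp_linear (castlie_linear e4 g) (castio_linear e3 f).
  - exact: comp_linear l1 (castlie_linear e5 mu2).
  - exact: comp_linear (castlie_linear e8 mu2) l2.
rewrite (castioE def_r) (castlieE def_q) (castioE def_p) (castlieE muP)
  (homotopy_chainE cf cg e7) eh.
rewrite (lie_op_natural _ (castio_linear e2 f)) (contraction_op_natural _
  (castlie_linear e4 g)).
rewrite (lie_op_natural _ l1) (around_natural _ (castlie_linear e8 mu2)).
rewrite (castio_pointed_tensor def_p) (castlie_pointed_tensor def_q)
  (castlie_pointed_tensor muP).
have -> : (fun b v => homotopy_chain m n f g M (@pointed_tensor k A M3 b v)) =
    homotopy_op `|M3|%N n m (@pointed_tensor k A M) g f.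
  by apply/funext => b; apply/funext => v; apply: homotopy_chainE.
have cw : odd `|N|%N = odd (size w) by lia.
rewrite (contraction_op_brack a (pointed_multilinear_pointed_tensor A M) cw cf cg zf
  zg).
rewrite (@lie_op_odd _ _ _ _ (absz M2) (`|N| + m.+1)%N); last lia.
rewrite (@homotopy_op_odd _ _ _ _ (absz M3) (`|N| + 1)%N); last lia.
by rewrite (@lie_op_odd _ _ _ _ (absz M4) (`|N| + (n + m))%N); last lia.
Qed.

End Identities.
End TypedIdentities.

(** * Operations on homology *)

Section Representatives.
Variables (k : comNzRingType) (U V W : lmodType k).
Variables (d1 : {linear U -> V}) (d2 : {linear V -> W}).
Implicit Types (h : homology d1 d2) (x y : V).

Lemma represents_cycle h x : represents h x -> d2 x = 0.
Proof. by case=> [[z zP] /= <- _]; apply/eqP. Qed.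

Lemma represents_ex h : exists x, represents h x.
Proof. by elim/qclass_ind: h => z; exists z; exists z. Qed.

Lemma represents_eq h h' x y : represents h x -> represents h' y ->
  (exists z, x - y = d1 z) -> h = h'.
Proof.
case=> z <- -> [z' <- ->] [t e]; apply/qclassP/asboolP.
by exists t; rewrite -e.
Qed.

Lemma represents_uniq h h' x : represents h x -> represents h' x -> h = h'.
Proof.
by move=> hx h'x; apply: represents_eq hx h'x _; exists 0; rewrite linear0 subrr.
Qed.

Lemma represents_boundary h x y : represents h x -> represents h y ->
  exists z, x - y = d1 z.
Proof.
case=> z <- -> [z' <- /qclassP/asboolP[t e]].
by exists t; rewrite -e.
Qed.

Lemma represents_move h x y : represents h y -> d2 x = 0 ->
  (exists z, x - y = d1 z) -> represents h x.
Proof.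
move=> [z <- ->] x0 [t e]; have kx : x \in ker_pred d2 by apply/eqP.
exists (Cycle kx) => //; apply/esym/qclassP/asboolP; exists t.
by rewrite -e.
Qed.

Lemma representsZD c h h' x y : represents h x -> represents h' y ->
  represents (c *: h + h') (c *: x + y).
Proof.
case=> z <- -> [z' <- ->]; exists (c *: z + z') => //.
by rewrite linearP.
Qed.

Lemma represents0 : represents (0 : homology d1 d2) 0.
Proof. by exists 0 => //; rewrite linear0. Qed.

Lemma representsZ c h x : represents h x -> represents (c *: h) (c *: x).
Proof.
by move=> hx; have := representsZD c hx represents0; rewrite !addr0.
Qed.

Lemma representsD h h' x y : represents h x -> represents h' y ->
  represents (h + h') (x + y).
Proof. by move=> hx hy; have := representsZD 1 hx hy; rewrite !scale1r. Qed.

Lemma representsN h x : represents h x -> represents (- h) (- x).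
Proof. by move=> hx; have := representsZ (-1) hx; rewrite !scaleN1r. Qed.

(** Elements that are not cycles get the default class 0. *)
Definition hclass x : homology d1 d2 := qclass _ (insubd (0 : Defs.cycle d2) x).

Lemma hclassP x : d2 x = 0 -> represents (hclass x) x.
Proof.
move=> x0; exists (insubd 0 x) => //.
by have := @insubdK _ _ (Defs.cycle d2) 0 x; apply; apply/eqP.
Qed.

End Representatives.

Section Induced.
Variables (k : comNzRingType) (U1 V1 W1 U2 V2 W2 U3 V3 W3 : lmodType k).
Variables (d1 : {linear U1 -> V1}) (e1 : {linear V1 -> W1}).
Variables (d2 : {linear U2 -> V2}) (e2 : {linear V2 -> W2}).
Variables (d3 : {linear U3 -> V3}) (e3 : {linear V3 -> W3}).
Variable op : V1 -> V2 -> V3.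

Definition induced (u : homology d1 e1) (v : homology d2 e2) : homology d3 e3 :=
  hclass d3 e3 (op (repr u) (repr v)).

Definition descends : Prop :=
  [/\ forall x y, e1 x = 0 -> e2 y = 0 -> e3 (op x y) = 0,
      forall x y, e2 y = 0 -> exists z, op (d1 x) y = d3 z &
      forall x y, e1 x = 0 -> exists z, op x (d2 y) = d3 z].

Hypotheses (bop : bilinear_op op) (dop : descends).

Lemma induced_represents u v x y :
  represents u x -> represents v y -> represents (induced u v) (op x y).
Proof.
have [opl opr] := bop; have [op0 opd1 opd2] := dop => ux vy.
have ru : represents u (repr u).
  by exists (repr u) => //; rewrite -[LHS]reprK.
have rv : represents v (repr v).
  by exists (repr v) => //; rewrite -[LHS]reprK.
have c x' y' (ux' : represents u x') (vy' : represents v y') : e3 (op x' y') = 0.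
  by apply: op0; [apply: represents_cycle ux'|apply: represents_cycle vy'].
apply: (represents_move (hclassP d3 (c _ _ ru rv)) (c _ _ ux vy)).
have [s es] := represents_boundary ux ru; have [t et] := represents_boundary vy rv.
have [s' es'] := opd1 s y (represents_cycle vy).
have [t' et'] := opd2 _ t (represents_cycle ru).
(* The representatives are changed one at a time: first the left one with y fixed, then the right
   one with the chosen representative of u fixed. *)
exists (s' + t'); rewrite linearD -es' -et' -es -et.
have subl a b z : op (a - b) z = op a z - op b z.
  by rewrite addrC -scaleN1r opl scaleN1r addrC.
have subr a b z : op z (a - b) = op z a - op z b.
  by rewrite addrC -scaleN1r opr scaleN1r addrC.
by rewrite subl subr addrA subrK.
Qed.

Lemma induced_bilinear : bilinear_op induced.
Proof.
have [opl opr] := bop; split=> [v c x y|u c x y];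
  have [a xa] := represents_ex x; have [b yb] := represents_ex y.
  have [z vz] := represents_ex v.
  apply: (represents_uniq (induced_represents (representsZD c xa yb) vz)).
  rewrite opl; apply: representsZD; exact: induced_represents.
have [z uz] := represents_ex u.
apply: (represents_uniq (induced_represents uz (representsZD c xa yb))).
rewrite opr; apply: representsZD; exact: induced_represents.
Qed.

End Induced.

Lemma int_nonpos_or_shift (p : int) : p <= 0 \/ exists m, p = m.+1%:Z.
Proof.
have [p0|p0] := leP p 0; [by left|right].
by exists (absz p).-1; lia.
Qed.

(** * Compatibility of the operations with the differentials *)

Section CochainOps.
Variables (k : comNzRingType) (A : homAssocAlgebra k).
Notation mu := (@mu_fun k A).
Notation mu2 := (@Defs.mu k A).

#[local] Hint Resolve is_cochain_mu : core.

Lemma cochain_inj p (f g : cochain A p) : f = g :> (seq A -> A) -> f = g.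
Proof. by move=> e; apply: val_inj. Qed.

Lemma cochain_add p (f g : cochain A p) : f + g = (f : seq A -> A) + g :> (seq A -> A).
Proof. by []. Qed.
Lemma cochain_opp p (f : cochain A p) : - f = - (f : seq A -> A) :> (seq A -> A).
Proof. by []. Qed.
Lemma cochain_scale p c (f : cochain A p) : c *: f = c *: (f : seq A -> A) :> (seq A
  -> A).
Proof. by []. Qed.
Lemma cochain_zero p : (0 : cochain A p) = 0 :> (seq A -> A).
Proof. by []. Qed.

Definition mk_cochain p h (ch : @is_cochain k A p h) : cochain A p :=
  Cochain (introT (asboolP _) ch : h \in cochain_pred p).

Lemma bracket_fun p q m n (f : cochain A p) (g : cochain A q) :
  p = m.+1%:Z -> q = n.+1%:Z -> bracket f g = brack m n f g :> (seq A -> A).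
Proof. by move=> def_p def_q; subst p q; apply: bracketE. Qed.

Lemma cup_fun p q m n (f : cochain A p) (g : cochain A q) :
  p = m.+1%:Z -> q = n.+1%:Z -> cup_product f g = cupf m n f g :> (seq A -> A).
Proof. by move=> def_p def_q; subst p q; apply: cup_productE. Qed.

Lemma bracket_bilinear p q : bilinear_op (@bracket k A p q).
Proof.
split=> [g|f]; last exact: bracket_linearr.
apply: sub_linear; [|apply: scale_linear]; apply: sum_linear => i;
  apply: scale_linear; first exact: circ_linearl.
by move=> c x y; rewrite circ_linearr linearP.
Qed.

Lemma cup_bilinear_op p q : bilinear_op (@cup_product k A p q).
Proof.
split=> [g c x y|f c x y]; rewrite /cup_product.
  by rewrite circ_linearr circ_linearl linearP.
by rewrite circ_linearr linearP.
Qed.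

Lemma bullet_linearl p n i (x : chain A n) :
  linear (fun f : cochain A p => bullet f i x).
Proof.
move=> c f g; move: x; apply: chain_ext => [||a w _]; first exact: bullet_is_linear.
  by apply: add_linear; [apply: scale_linear|]; apply: bullet_is_linear.
by rewrite !bulletE /splice; apply: tensor_multilinear.
Qed.

Lemma contraction_bilinear p n : bilinear_op (@contraction k A p n).
Proof.
split=> [x c f g|f]; last exact: contraction_linear.
rewrite /contraction; case: (p <= n); last by rewrite scaler0 addr0.
by rewrite circ_linearr bullet_linearl linearP.
Qed.

Lemma lie_bilinear_op p n : bilinear_op (@lie_derivative k A p n).
Proof.
split=> [x c f g|f]; last exact: lie_derivative_linear.
rewrite /lie_derivative; case: (p <= n + 1); last by rewrite scaler0 addr0.
rewrite scalerDr !scaler_sumr addrACA -!big_split /=.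
by congr (_ + _); apply: eq_bigr => i _; rewrite bullet_linearl scalerDr !scalerA
  (mulrC c).
Qed.

Lemma op0l (U V W : lmodType k) (op : U -> V -> W) v : bilinear_op op -> op 0 v = 0.
Proof. by case=> l _; apply: (linear0_of (l v)). Qed.

Lemma op0r (U V W : lmodType k) (op : U -> V -> W) u : bilinear_op op -> op u 0 = 0.
Proof. by case=> _ l; apply: (linear0_of (l u)). Qed.

Lemma opZl (U V W : lmodType k) (op : U -> V -> W) c u v :
  bilinear_op op -> op (c *: u) v = c *: op u v.
Proof. by case=> l _; apply: (linearZ_of (l v)). Qed.

Lemma opNl (U V W : lmodType k) (op : U -> V -> W) u v :
  bilinear_op op -> op (- u) v = - op u v.
Proof. by move=> bop; rewrite -scaleN1r opZl // scaleN1r. Qed.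

Lemma brack0l m n (g : seq A -> A) : is_cochain n.+1%:Z g -> brack m n 0 g = 0.
Proof.
move=> cg; have mg := cochain_mlin cg; rewrite /brack.
have e0 : (0 : seq A -> A) = 0 *: 0 by rewrite scale0r.
by rewrite e0 insZ insZr // !scale0r scaler0 subrr.
Qed.

Lemma brack0r m n (f : seq A -> A) : is_cochain m.+1%:Z f -> brack m n f 0 = 0.
Proof. by move=> cf; rewrite brackC brack0l // scaler0 oppr0. Qed.

Lemma brackZl m n c (f g : seq A -> A) : is_cochain n.+1%:Z g ->
  brack m n (c *: f) g = c *: brack m n f g.
Proof.
move=> cg; have mg := cochain_mlin cg; rewrite /brack insZ insZr // scalerBr.
by rewrite !scalerA mulrC.
Qed.

Lemma brackZr m n c (f g : seq A -> A) : is_cochain m.+1%:Z f ->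
  brack m n f (c *: g) = c *: brack m n f g.
Proof.
move=> cf; rewrite brackC brackZl // [in RHS]brackC scalerN; congr (- _).
by rewrite !scalerA mulrC.
Qed.

Lemma cupf0l m n (g : seq A -> A) : cupf m n 0 g = 0.
Proof. by apply/funext => w; apply: split2_none => u v _; rewrite linear0r. Qed.

Lemma cupf0r m n (f : seq A -> A) : cupf m n f 0 = 0.
Proof.
apply/funext => w; apply: split2_none => u v _.
by rewrite (linear0_of (@tw_linear _ A m)) linear0l.
Qed.

Lemma cupfZl m n c (f g : seq A -> A) : cupf m n (c *: f) g = c *: cupf m n f g.
Proof.
by apply/funext => w; rewrite appE /cupf split2Z; apply: eq_split2 => u v; rewrite
  linearZr.
Qed.

Lemma cupfZr m n c (f g : seq A -> A) : cupf m n f (c *: g) = c *: cupf m n f g.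
Proof.
apply/funext => w; rewrite appE /cupf split2Z; apply: eq_split2 => u v.
by rewrite appE twZ linearZl.
Qed.

Lemma delta_cycle p m q (e : p + 1 = q) (f : cochain A p) : p = m.+1%:Z ->
  (delta e f = 0) <-> (brack m 1 f mu = 0).
Proof.
move=> def_p; split=> [f0|f0].
  have := congr1 (@cochain_fun k A q) f0; rewrite (deltaE e f def_p) cochain_zero => e0.
  rewrite -[LHS](signrZK m) -[X in _ *: X]opprK e0 oppr0 scaler0 //.
by apply: cochain_inj; rewrite (deltaE e f def_p) f0 scaler0 oppr0.
Qed.

(** The sign between [delta] and the bracket with mu on the right is absorbed into the primitive. *)
Lemma delta_boundary p d h (x : cochain A p) : p = d.+2%:Z ->
  is_cochain d.+1%:Z h -> x = brack d 1 h mu :> (seq A -> A) ->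
  exists y, x = delta (subrK 1 p) y.
Proof.
move=> def_p ch ex; have ed : p - 1 = d.+1%:Z by lia.
have ch' : is_cochain (p - 1) (- ((-1) ^+ d *: h)).
  by rewrite ed -scaleN1r; do 2!apply: is_cochainZ.
exists (mk_cochain ch'); apply: cochain_inj; rewrite (deltaE _ _ ed) ex /=.
rewrite -!scaleN1r !brackZl //; rewrite !scaleN1r; zsigns.
Qed.

Lemma delta_form p m (x : cochain A (p - 1)) : p - 1 = m.+1%:Z ->
  delta (subrK 1 p) x = (- (-1) ^+ m) *: brack m 1 x mu :> (seq A -> A).
Proof. by move=> def_p; rewrite (deltaE _ _ def_p) scaleNr. Qed.

Lemma bracket_descends p q : descends
  (delta (subrK 1 p)) (@delta k A p _ (erefl (p + 1)))
  (delta (subrK 1 q)) (@delta k A q _ (erefl (q + 1)))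
  (delta (subrK 1 (p + q - 1))) (@delta k A (p + q - 1) _ (erefl (p + q - 1 + 1)))
  (@bracket k A p q).
Proof.
have bop := bracket_bilinear p q.
have [p0|[m def_p]] := int_nonpos_or_shift p.
  split=> [x y _ _|x y _|x y _].
  - by rewrite (cochain_nonpos x p0) (op0l _ bop) linear0.
  - by exists 0; rewrite /= [delta _ x](cochain_nonpos _ p0) (op0l _ bop) linear0.
  - by exists 0; rewrite (cochain_nonpos x p0) (op0l _ bop) linear0.
have [q0|[n def_q]] := int_nonpos_or_shift q.
  split=> [x y _ _|x y _|x y _].
  - by rewrite (cochain_nonpos y q0) (op0r _ bop) linear0.
  - by exists 0; rewrite (cochain_nonpos y q0) (op0r _ bop) linear0.
  - by exists 0; rewrite /= [delta _ y](cochain_nonpos _ q0) (op0r _ bop) linear0.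
have def_r : p + q - 1 = (m + n).+1%:Z by lia.
split=> [x y zx zy|x y zy|x y zx].
- have cx := cochain_shift x def_p; have cy := cochain_shift y def_q.
  move/(delta_cycle _ _ def_p) in zx; move/(delta_cycle _ _ def_q) in zy.
  apply/(delta_cycle _ _ def_r); rewrite (bracket_fun _ _ def_p def_q) diff_brack //
    zx zy.
  by rewrite brack0r // brack0l // scaler0 addr0.
- have cy := cochain_shift y def_q; move/(delta_cycle _ _ def_q) in zy.
  (* There are no nonzero cochains in degree p - 1 <= 0, so zero is the only coboundary in this
     case. *)
  have [p1|[m' def_p']] := int_nonpos_or_shift (p - 1).
    by exists 0; rewrite (cochain_nonpos x p1) !linear0 (op0l _ bop).
  have cx := cochain_shift x def_p'; have em : m = m'.+1 by lia.
  subst m; have cxy := brack_cochain cx cy.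
  (* The first sign is that of [delta]; the second undoes the sign in [diff_brack]. *)
  apply: (@delta_boundary _ (m' + n) (((- (-1) ^+ m') * (-1) ^+ n) *: brack m' n x y)).
  + lia.
  + exact: is_cochainZ.
  rewrite (bracket_fun _ _ def_p def_q) (delta_form _ def_p') !brackZl //.
  by rewrite diff_brack // zy brack0r // add0r scalerA -mulrA -expr2 sqrr_sign mulr1.
- have cx := cochain_shift x def_p; move/(delta_cycle _ _ def_p) in zx.
  have [q1|[n' def_q']] := int_nonpos_or_shift (q - 1).
    by exists 0; rewrite (cochain_nonpos y q1) !linear0 (op0r _ bop).
  have cy := cochain_shift y def_q'; have em : n = n'.+1 by lia.
  subst n; have cxy := brack_cochain cx cy.
  apply: (@delta_boundary _ (m + n') ((- (-1) ^+ n') *: brack m n' x y)).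
  + lia.
  + exact: is_cochainZ.
  rewrite (bracket_fun _ _ def_p def_q) (delta_form _ def_q') brackZr // brackZl //.
  by rewrite diff_brack // zx brack0l // scaler0 addr0.
Qed.

Lemma cup_descends p q : descends
  (delta (subrK 1 p)) (@delta k A p _ (erefl (p + 1)))
  (delta (subrK 1 q)) (@delta k A q _ (erefl (q + 1)))
  (delta (subrK 1 (p + q))) (@delta k A (p + q) _ (erefl (p + q + 1)))
  (@cup_product k A p q).
Proof.
have bop := cup_bilinear_op p q.
have [p0|[m def_p]] := int_nonpos_or_shift p.
  split=> [x y _ _|x y _|x y _].
  - by rewrite (cochain_nonpos x p0) (op0l _ bop) linear0.
  - by exists 0; rewrite /= [delta _ x](cochain_nonpos _ p0) (op0l _ bop) linear0.
  - by exists 0; rewrite (cochain_nonpos x p0) (op0l _ bop) linear0.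
have [q0|[n def_q]] := int_nonpos_or_shift q.
  split=> [x y _ _|x y _|x y _].
  - by rewrite (cochain_nonpos y q0) (op0r _ bop) linear0.
  - by exists 0; rewrite (cochain_nonpos y q0) (op0r _ bop) linear0.
  - by exists 0; rewrite /= [delta _ y](cochain_nonpos _ q0) (op0r _ bop) linear0.
have def_r : p + q = (m + n).+2%:Z by lia.
split=> [x y zx zy|x y zy|x y zx].
- have cx := cochain_shift x def_p; have cy := cochain_shift y def_q.
  move/(delta_cycle _ _ def_p) in zx; move/(delta_cycle _ _ def_q) in zy.
  apply/(delta_cycle _ _ def_r); rewrite (cup_fun _ _ def_p def_q) diff_cup // zx zy.
  by rewrite cupf0r cupf0l scaler0 addr0.
- have cy := cochain_shift y def_q; move/(delta_cycle _ _ def_q) in zy.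
  have [p1|[m' def_p']] := int_nonpos_or_shift (p - 1).
    by exists 0; rewrite (cochain_nonpos x p1) !linear0 (op0l _ bop).
  have cx := cochain_shift x def_p'; have em : m = m'.+1 by lia.
  subst m; have cxy := cupf_cochain cx cy.
  apply: (@delta_boundary _ (m' + n).+1 (((- (-1) ^+ m') * (-1) ^+ n.+1) *: cupf m' n
    x y)).
  + lia.
  + exact: is_cochainZ.
  rewrite (cup_fun _ _ def_p def_q) (delta_form _ def_p') !(brackZl, cupfZl) //.
  by rewrite diff_cup // zy cupf0r add0r scalerA -mulrA -expr2 sqrr_sign mulr1.
- have cx := cochain_shift x def_p; move/(delta_cycle _ _ def_p) in zx.
  have [q1|[n' def_q']] := int_nonpos_or_shift (q - 1).
    by exists 0; rewrite (cochain_nonpos y q1) !linear0 (op0r _ bop).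
  have cy := cochain_shift y def_q'; have em : n = n'.+1 by lia.
  subst n; have cxy := cupf_cochain cx cy.
  apply: (@delta_boundary _ (m + n').+1 ((- (-1) ^+ n') *: cupf m n' x y)).
  + lia.
  + exact: is_cochainZ.
  rewrite (cup_fun _ _ def_p def_q) (delta_form _ def_q') cupfZr // brackZl //.
  by rewrite diff_cup // zx cupf0l scaler0 addr0.
Qed.

End CochainOps.

Section ChainOps.
Variables (k : comNzRingType) (A : homAssocAlgebra k).
Notation mu := (@mu_fun k A).
Notation mu2 := (@Defs.mu k A).
#[local] Hint Resolve is_cochain_mu : core.

Lemma dalphaN (n M : int) (e : M + 1 = n) (e' : n - 2%:Z + 1 = M) (x : chain A n) :
  castlie e' mu2 x = - dalpha e x.
Proof. by rewrite dalpha_lie opprK /castlie (eq_irrelevance e' (deg_d e)). Qed.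

Section ChainMap.
Variables (p : int) (m : nat) (f : cochain A p) (def_p : p = m.+1%:Z).
Variables (n : int) (x : chain A n).

Lemma diff_exists : exists2 h : cochain A (p + 1), h = brack m 1 f mu :> (seq A -> A) &
  delta (erefl (p + 1)) f = - ((-1) ^+ m *: h).
Proof.
have cf := cochain_shift f def_p.
have ch : is_cochain (p + 1) (brack m 1 f mu).
  have -> : p + 1 = (m + 1).+1%:Z by lia.
  exact: brack_cochain.
exists (mk_cochain ch) => //; apply: cochain_inj.
by rewrite (deltaE _ _ def_p).
Qed.

(** All three conditions of [descends] for the contraction follow from this formula, by dropping the
    terms that vanish on cycles. *)
Lemma contraction_dalpha (M M1 : int) (e1 : M1 + 1 = n) (e2 : M1 - p = M) (e3 : M + 1
  = n - p)
    (e4 : n - (p + 1) = M) :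
  dalpha e3 (contraction f x) =
  gcast e4 (contraction (delta (erefl (p + 1)) f) x)
  - (-1) ^+ m *: gcast e2 (contraction f (dalpha e1 x)).
Proof.
have [h eh ->] := diff_exists; have def_r : p + 1 = m.+2%:Z by lia.
have := castio_diff def_p e4 (deg_d e1) e2 (erefl (n - p)) (deg_d e3) x eh def_r.
rewrite (dalphaN e1) (dalphaN e3) (linearN (castio e2 f)) => e.
rewrite -[LHS]opprK.
have -> : - dalpha e3 (contraction f x) =
  (-1) ^+ m *: castio e4 h x - (-1) ^+ m *: - castio e2 f (dalpha e1 x).
  by rewrite -e addrAC subrr add0r.
have bop := contraction_bilinear A (p + 1) n.
have -> : contraction (- ((-1) ^+ m *: h)) x = - ((-1) ^+ m *: contraction h x).
  by rewrite (opNl _ _ bop) (opZl _ _ _ bop).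
rewrite (linearN (gcast e4)) (linearZ_LR (gcast e4)) /castio /=.
by rewrite scalerN opprK opprD.
Qed.

(** This is [castlie_brack] with mu as second cochain, since d is minus the Lie derivative along
    mu. *)
Lemma lie_dalpha (M M1 : int) (e1 : M1 + 1 = n) (e2 : M1 - p + 1 = M) (e3 : M + 1 = n
  - p + 1)
    (e4 : n - (p + 1) + 1 = M) :
  dalpha e3 (lie_derivative f x) =
  (-1) ^+ m *: gcast e2 (lie_derivative f (dalpha e1 x))
  - gcast e4 (lie_derivative (delta (erefl (p + 1)) f) x).
Proof.
have [h eh ->] := diff_exists; have def_r : p + 1 = (m + 1).+1%:Z by lia.
have := castlie_brack (g := mu2) def_p (erefl : 2%:Z = 1.+1%:Z) e4 (deg_d e1) e2
  (erefl (n - p + 1))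
  (deg_d e3) x eh def_r.
rewrite (dalphaN e1) (dalphaN e3) (linearN (castlie e2 f)) muln1 => e.
have bop := lie_bilinear_op A (p + 1) n.
have -> : lie_derivative (- ((-1) ^+ m *: h)) x = - ((-1) ^+ m *: lie_derivative h x).
  by rewrite (opNl _ _ bop) (opZl _ _ _ bop).
rewrite (linearN (gcast e4)) (linearZ_LR (gcast e4)) /= -[gcast e4 _]/(castlie e4 h
  x) e /castlie /=.
by rewrite opprK scalerDr !scalerN opprK scalerA -expr2 sqrr_sign scale1r addNKr.
Qed.

End ChainMap.

Lemma dalpha_gcast (a b c : int) (u : b = a) (v : c + 1 = a) (w : c + 1 = b)
  (y : chain A b) : dalpha v (gcast u y) = dalpha w y.
Proof. by case: _ / u v => v; rewrite (eq_irrelevance v w). Qed.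

Lemma contraction_delta p q n (u : p + 1 = q) (e : n - (p + 1) = n - q)
    (f : cochain A p) (x : chain A n) :
  contraction (delta u f) x = gcast e (contraction (delta (erefl (p + 1)) f) x).
Proof. by case: _ / u e => e; rewrite (eq_irrelevance e erefl). Qed.

Lemma lie_delta p q n (u : p + 1 = q) (e : n - (p + 1) + 1 = n - q + 1)
    (f : cochain A p) (x : chain A n) :
  lie_derivative (delta u f) x = gcast e (lie_derivative (delta (erefl (p + 1)) f) x).
Proof. by case: _ / u e => e; rewrite (eq_irrelevance e erefl). Qed.

Lemma contraction_descends p n : descends
  (delta (subrK 1 p)) (@delta k A p _ (erefl (p + 1)))
  (@dalpha k A _ n (erefl (n + 1))) (@dalpha k A n _ (subrK 1 n))
  (@dalpha k A _ (n - p) (erefl (n - p + 1))) (@dalpha k A (n - p) _ (subrK 1 (n - p)))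
  (@contraction k A p n).
Proof.
have bop := contraction_bilinear A p n.
have [p0|[m def_p]] := int_nonpos_or_shift p.
  split=> [f x _ _|f x _|f x _].
  - by rewrite (cochain_nonpos f p0) (op0l _ bop) linear0.
  - by exists 0; rewrite /= [delta _ f](cochain_nonpos _ p0) (op0l _ bop) linear0.
  - by exists 0; rewrite (cochain_nonpos f p0) (op0l _ bop) linear0.
split=> [f x /= zf zx|f x /= zx|f x /= zf].
- have e2 : n - 1 - p = n - p - 1 by lia.
  have e4 : n - (p + 1) = n - p - 1 by lia.
  rewrite (contraction_dalpha f def_p x (subrK 1 n) e2 _ e4) zf zx.
  rewrite (op0l _ (contraction_bilinear A (p + 1) n)).
  by rewrite (op0r _ (contraction_bilinear A p (n - 1))) !linear0 addr0.
- have [p1|[m' def_p']] := int_nonpos_or_shift (p - 1).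
    by exists 0; rewrite (cochain_nonpos f p1) !linear0 (op0l _ bop).
  have e2 : n - 1 - (p - 1) = n - p by lia.
  have e3 : n - p + 1 = n - (p - 1) by lia.
  have e4 : n - (p - 1 + 1) = n - p by lia.
  (* Since x is a cycle, the boundary of its contraction by f is its contraction by the coboundary
     of f. *)
  exists (gcast (esym e3) (contraction f x)).
  rewrite /= (dalpha_gcast _ _ e3) (contraction_dalpha f def_p' x (subrK 1 n) e2 e3 e4).
  rewrite zx (op0r _ (contraction_bilinear A (p - 1) (n - 1))) linear0 scaler0 subr0.
  exact: contraction_delta.
- have e3 : n - p + 1 = n + 1 - p by lia.
  have e4 : n + 1 - (p + 1) = n - p by lia.
  (* Since f is a cocycle, contraction by f commutes with the differential up to this sign. *)
  exists (- ((-1) ^+ m *: gcast (esym e3) (contraction f x))).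
  rewrite (linearN (dalpha _)) (linearZ_LR (dalpha _)) /= (dalpha_gcast _ _ e3).
  rewrite (contraction_dalpha f def_p x (erefl (n + 1)) (erefl (n - p)) e3 e4) zf.
  rewrite (op0l _ (contraction_bilinear A (p + 1) (n + 1))) linear0 sub0r.
  by rewrite scalerN opprK scalerA -expr2 sqrr_sign scale1r.
Qed.

Lemma lie_descends p n : descends
  (delta (subrK 1 p)) (@delta k A p _ (erefl (p + 1)))
  (@dalpha k A _ n (erefl (n + 1))) (@dalpha k A n _ (subrK 1 n))
  (@dalpha k A _ (n - p + 1) (erefl (n - p + 1 + 1)))
  (@dalpha k A (n - p + 1) _ (subrK 1 (n - p + 1)))
  (@lie_derivative k A p n).
Proof.
have bop := lie_bilinear_op A p n.
have [p0|[m def_p]] := int_nonpos_or_shift p.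
  split=> [f x _ _|f x _|f x _].
  - by rewrite (cochain_nonpos f p0) (op0l _ bop) linear0.
  - by exists 0; rewrite /= [delta _ f](cochain_nonpos _ p0) (op0l _ bop) linear0.
  - by exists 0; rewrite (cochain_nonpos f p0) (op0l _ bop) linear0.
split=> [f x /= zf zx|f x /= zx|f x /= zf].
- have e2 : n - 1 - p + 1 = n - p + 1 - 1 by lia.
  have e4 : n - (p + 1) + 1 = n - p + 1 - 1 by lia.
  rewrite (lie_dalpha f def_p x (subrK 1 n) e2 _ e4) zf zx.
  rewrite (op0l _ (lie_bilinear_op A (p + 1) n)).
  by rewrite (op0r _ (lie_bilinear_op A p (n - 1))) !linear0 addr0.
- have [p1|[m' def_p']] := int_nonpos_or_shift (p - 1).
    by exists 0; rewrite (cochain_nonpos f p1) !linear0 (op0l _ bop).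
  have e2 : n - 1 - (p - 1) + 1 = n - p + 1 by lia.
  have e3 : n - p + 1 + 1 = n - (p - 1) + 1 by lia.
  have e4 : n - (p - 1 + 1) + 1 = n - p + 1 by lia.
  exists (- gcast (esym e3) (lie_derivative f x)).
  rewrite (linearN (dalpha _)) /= (dalpha_gcast _ _ e3).
  rewrite (lie_dalpha f def_p' x (subrK 1 n) e2 e3 e4).
  rewrite zx (op0r _ (lie_bilinear_op A (p - 1) (n - 1))) linear0 scaler0 sub0r opprK.
  exact: lie_delta.
- have e3 : n - p + 1 + 1 = n + 1 - p + 1 by lia.
  have e4 : n + 1 - (p + 1) + 1 = n - p + 1 by lia.
  exists ((-1) ^+ m *: gcast (esym e3) (lie_derivative f x)).
  rewrite (linearZ_LR (dalpha _)) /= (dalpha_gcast _ _ e3).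
  rewrite (lie_dalpha f def_p x (erefl (n + 1)) (erefl (n - p + 1)) e3 e4) zf.
  rewrite (op0l _ (lie_bilinear_op A (p + 1) (n + 1))) linear0 subr0.
  by rewrite scalerA -expr2 sqrr_sign scale1r.
Qed.

End ChainOps.

(** * The precalculus on cohomology and homology *)

Section HomologyOps.
Variables (k : comNzRingType) (A : homAssocAlgebra k).
Notation mu := (@mu_fun k A).
Notation mu2 := (@Defs.mu k A).
Notation H := (cohomology A).
Notation HH := (hochschild_homology A).

Definition cupH p q (u : H p) (v : H q) : H (p + q) :=
  induced _ _ (@cup_product k A p q) u v.
Definition brH p q (u : H p) (v : H q) : H (p + q - 1) :=
  induced _ _ (@bracket k A p q) u v.
Definition ioH p n (u : H p) (w : HH n) : HH (n - p) :=
  induced _ _ (@contraction k A p n) u w.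
Definition lieH p n (u : H p) (w : HH n) : HH (n - p + 1) :=
  induced _ _ (@lie_derivative k A p n) u w.

Lemma cupHP p q (u : H p) (v : H q) (f : cochain A p) (g : cochain A q) :
  represents u f -> represents v g -> represents (cupH u v) (cup_product f g).
Proof.
exact: (induced_represents (cup_bilinear_op A p q) (cup_descends A p q)).
Qed.

Lemma brHP p q (u : H p) (v : H q) (f : cochain A p) (g : cochain A q) :
  represents u f -> represents v g -> represents (brH u v) (bracket f g).
Proof.
exact: (induced_represents (bracket_bilinear A p q) (bracket_descends A p q)).
Qed.

Lemma ioHP p n (u : H p) (w : HH n) (f : cochain A p) (x : chain A n) :
  represents u f -> represents w x -> represents (ioH u w) (contraction f x).
Proof.
exact: (induced_represents (contraction_bilinear A p n) (contraction_descends A p n)).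
Qed.

Lemma lieHP p n (u : H p) (w : HH n) (f : cochain A p) (x : chain A n) :
  represents u f -> represents w x -> represents (lieH u w) (lie_derivative f x).
Proof.
exact: (induced_represents (lie_bilinear_op A p n) (lie_descends A p n)).
Qed.

Lemma cupH_bilinear p q : bilinear_op (@cupH p q).
Proof. exact: (induced_bilinear (cup_bilinear_op A p q) (cup_descends A p q)). Qed.
Lemma brH_bilinear p q : bilinear_op (@brH p q).
Proof. exact: (induced_bilinear (bracket_bilinear A p q) (bracket_descends A p q)). Qed.
Lemma ioH_bilinear p n : bilinear_op (@ioH p n).
Proof.
exact: (induced_bilinear (contraction_bilinear A p n) (contraction_descends A p n)).
Qed.
Lemma lieH_bilinear p n : bilinear_op (@lieH p n).
Proof. exact: (induced_bilinear (lie_bilinear_op A p n) (lie_descends A p n)). Qed.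

Lemma represents_gcast p q (e : p = q) (u : H p) (f : cochain A p) :
  represents u f -> represents (gcast e u) (gcast e f).
Proof. by case: _ / e. Qed.

Lemma represents_gcastH p q (e : p = q) (u : HH p) (f : chain A p) :
  represents u f -> represents (gcast e u) (gcast e f).
Proof. by case: _ / e. Qed.

Lemma cohomology_nonpos p (u : H p) : p <= 0 -> u = 0.
Proof.
move=> p0; have [f uf] := represents_ex u.
by apply: (represents_uniq uf); rewrite (cochain_nonpos f p0); apply: represents0.
Qed.

Lemma represents_same (U V W : lmodType k) (d1 : {linear U -> V}) (d2 : {linear V -> W})
    (h h' : homology d1 d2) x y :
  represents h x -> represents h' y -> x = y -> h = h'.
Proof. by move=> hx h'y e; rewrite e in hx; apply: represents_uniq hx h'y. Qed.

Lemma gcast0 (X : int -> lmodType k) p q (e : p = q) : gcast e (0 : X p) = 0.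
Proof. exact: linear0. Qed.

Let cup0l p q (v : H q) : cupH (0 : H p) v = 0.
Proof. exact: op0l (cupH_bilinear p q). Qed.
Let cup0r p q (u : H p) : cupH u (0 : H q) = 0.
Proof. exact: op0r (cupH_bilinear p q). Qed.
Let br0l p q (v : H q) : brH (0 : H p) v = 0.
Proof. exact: op0l (brH_bilinear p q). Qed.
Let br0r p q (u : H p) : brH u (0 : H q) = 0.
Proof. exact: op0r (brH_bilinear p q). Qed.
Let io0l p n (w : HH n) : ioH (0 : H p) w = 0.
Proof. exact: op0l (ioH_bilinear p n). Qed.
Let io0r p n (u : H p) : ioH u (0 : HH n) = 0.
Proof. exact: op0r (ioH_bilinear p n). Qed.
Let lie0l p n (w : HH n) : lieH (0 : H p) w = 0.
Proof. exact: op0l (lieH_bilinear p n). Qed.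
Let lie0r p n (u : H p) : lieH u (0 : HH n) = 0.
Proof. exact: op0r (lieH_bilinear p n). Qed.

Let op0 := (cup0l, cup0r, br0l, br0r, io0l, io0r, lie0l, lie0r, gcast0, scaler0,
  addr0, oppr0).

Section Signs.
Variables (p q : int) (m n : nat) (def_p : p = m.+1%:Z) (def_q : q = n.+1%:Z).

Lemma sgn_pq : sgn (p * q) = (-1) ^+ (m.+1 * n.+1) :> k.
Proof. by rewrite def_p def_q sgnM_nat. Qed.

Lemma sgn_shifts : sgn ((p - 1) * (q - 1)) = (-1) ^+ (m * n) :> k.
Proof.
have -> : p - 1 = m%:Z by lia.
have -> : q - 1 = n%:Z by lia.
exact: sgnM_nat.
Qed.

Lemma sgn_shiftl : sgn ((p - 1) * q) = (-1) ^+ (m * n.+1) :> k.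
Proof. by rewrite def_q (_ : p - 1 = m%:Z) ?sgnM_nat //; lia. Qed.

Lemma sgn_mixed : sgn (p * (q + 1)) = (-1) ^+ (m.+1 * n) :> k.
Proof.
have -> : q + 1 = n.+2%:Z by lia.
by rewrite def_p sgnM_nat !mulnS !exprD mulrA -expr2 sqrr_sign mul1r.
Qed.

End Signs.

Lemma cocycle p m (u : H p) (f : cochain A p) : p = m.+1%:Z -> represents u f ->
  brack m 1 f mu = 0.
Proof. by move=> def_p /represents_cycle /(delta_cycle _ _ def_p). Qed.

(** Associativity, antisymmetry and the Jacobi identity hold for cochains and need only
    [represents_same]. Commutativity and the Leibniz rule hold up to a coboundary. In nonpositive
    degrees every term is zero. *)
Lemma cohomology_gerstenhaber : gerstenhaber cupH brH.
Proof.
split; [exact: cupH_bilinear|exact: brH_bilinear| | | | |].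
- move=> p q r u v w.
  have [p0|[m def_p]] := int_nonpos_or_shift p; first by rewrite (cohomology_nonpos u
    p0) !op0.
  have [q0|[n def_q]] := int_nonpos_or_shift q; first by rewrite (cohomology_nonpos v
    q0) !op0.
  have [r0|[l def_r]] := int_nonpos_or_shift r; first by rewrite (cohomology_nonpos w
    r0) !op0.
  have [f uf] := represents_ex u; have [g vg] := represents_ex v.
  have [h wh] := represents_ex w.
  apply: (represents_same (cupHP uf (cupHP vg wh))
    (represents_gcast (deg_cupA p q r) (cupHP (cupHP uf vg) wh))).
  have epq : p + q = (m + n).+1.+1%:Z by lia.
  have eqr : q + r = (n + l).+1.+1%:Z by lia.
  apply: cochain_inj; rewrite (gcast_cochain (deg_cupA p q r)) (cup_fun _ _ def_p
    eqr) (cup_fun _ _ def_q def_r).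
  rewrite (cup_fun _ _ epq def_r) (cup_fun _ _ def_p def_q).
  exact: cupf_assoc (cochain_shift f def_p) (cochain_shift g def_q).
- move=> p q u v.
  have [p0|[m def_p]] := int_nonpos_or_shift p; first by rewrite (cohomology_nonpos u
    p0) !op0.
  have [q0|[n def_q]] := int_nonpos_or_shift q; first by rewrite (cohomology_nonpos v
    q0) !op0.
  have [f uf] := represents_ex u; have [g vg] := represents_ex v.
  have cf := cochain_shift f def_p; have cg := cochain_shift g def_q.
  apply: (represents_eq (cupHP uf vg)
    (representsZ (sgn (p * q)) (represents_gcast (addrC q p) (cupHP vg uf)))).
  apply: (@delta_boundary _ _ _ (m + n)
     ((-1) ^+ (n + n * m) *: ins m g f)); first lia.
    by apply: is_cochainZ; rewrite addnC; apply: ins_cochain.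
  rewrite cochain_add cochain_opp cochain_scale (gcast_cochain (addrC q p)).
  rewrite (cup_fun _ _ def_p def_q) (cup_fun _ _ def_q def_p) (sgn_pq def_p def_q).
  exact: cup_comm cf cg (cocycle def_p uf) (cocycle def_q vg).
- move=> p q u v.
  have [p0|[m def_p]] := int_nonpos_or_shift p; first by rewrite (cohomology_nonpos u
    p0) !op0.
  have [q0|[n def_q]] := int_nonpos_or_shift q; first by rewrite (cohomology_nonpos v
    q0) !op0.
  have [f uf] := represents_ex u; have [g vg] := represents_ex v.
  apply: (represents_same (brHP uf vg) (representsN
    (representsZ (sgn ((p - 1) * (q - 1))) (represents_gcast (deg_brC p q) (brHP vg
      uf))))).
  apply: cochain_inj; rewrite cochain_opp cochain_scale (gcast_cochain (deg_brC p q)).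
  rewrite (bracket_fun _ _ def_p def_q) (bracket_fun _ _ def_q def_p).
  by rewrite (sgn_shifts def_p def_q); apply: brackC.
- move=> p q r u v w.
  have [p0|[m def_p]] := int_nonpos_or_shift p; first by rewrite (cohomology_nonpos u
    p0) !op0.
  have [q0|[n def_q]] := int_nonpos_or_shift q; first by rewrite (cohomology_nonpos v
    q0) !op0.
  have [r0|[l def_r]] := int_nonpos_or_shift r; first by rewrite (cohomology_nonpos w
    r0) !op0.
  have [f uf] := represents_ex u; have [g vg] := represents_ex v.
  have [h wh] := represents_ex w.
  apply: (represents_same (brHP uf (brHP vg wh)) (representsD
    (represents_gcast (deg_jacobi1 p q r) (brHP (brHP uf vg) wh))
    (representsZ (sgn ((p - 1) * (q - 1)))
      (represents_gcast (deg_jacobi2 p q r) (brHP vg (brHP uf wh)))))).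
  have epq : p + q - 1 = (m + n).+1%:Z by lia.
  have eqr : q + r - 1 = (n + l).+1%:Z by lia.
  have epr : p + r - 1 = (m + l).+1%:Z by lia.
  apply: cochain_inj; rewrite (cochain_add (gcast _ _) (_ *: _)) (cochain_scale _
    (gcast _ _)).
  rewrite (gcast_cochain (deg_jacobi1 p q r)) (gcast_cochain (deg_jacobi2 p q r)).
  rewrite (bracket_fun _ _ def_p eqr) (bracket_fun _ _ def_q def_r).
  rewrite (bracket_fun _ _ epq def_r) (bracket_fun _ _ def_p def_q) (bracket_fun _ _
    def_q epr).
  rewrite (bracket_fun _ _ def_p def_r) (sgn_shifts def_p def_q).
  exact: brack_jacobi (cochain_shift f def_p) (cochain_shift g def_q) (cochain_shift
    h def_r).
- move=> p q r u v w.
  have [p0|[m def_p]] := int_nonpos_or_shift p; first by rewrite (cohomology_nonpos u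
    p0) !op0.
  have [q0|[n def_q]] := int_nonpos_or_shift q; first by rewrite (cohomology_nonpos v
    q0) !op0.
  have [r0|[l def_r]] := int_nonpos_or_shift r; first by rewrite (cohomology_nonpos w
    r0) !op0.
  have [f uf] := represents_ex u; have [g vg] := represents_ex v.
  have [h wh] := represents_ex w.
  have cf := cochain_shift f def_p; have cg := cochain_shift g def_q.
  have ch := cochain_shift h def_r.
  apply: (represents_eq (brHP uf (cupHP vg wh)) (representsD
    (represents_gcast (deg_leibniz1 p q r) (cupHP (brHP uf vg) wh))
    (representsZ (sgn ((p - 1) * q))
      (represents_gcast (deg_leibniz2 p q r) (cupHP vg (brHP uf wh)))))).
  have epq : p + q - 1 = (m + n).+1%:Z by lia.
  have eqr : q + r = (n + l).+2%:Z by lia.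
  have epr : p + r - 1 = (m + l).+1%:Z by lia.
  apply: (@delta_boundary _ _ _ (m + (n + l))
    ((-1) ^+ (l * n + l.+1) *: brace l n f h g)); first lia.
    apply: is_cochainZ; have := brace_cochain cf ch cg.
    by congr is_cochain; congr Posz; lia.
  rewrite (cochain_add (bracket _ _) (- _)) (cochain_opp (_ + _)).
  rewrite (cochain_add (gcast _ _) (_ *: _)) (cochain_scale _ (gcast _ _)).
  rewrite (gcast_cochain (deg_leibniz1 p q r)) (gcast_cochain (deg_leibniz2 p q r)).
  rewrite (bracket_fun _ _ def_p eqr) (cup_fun _ _ def_q def_r).
  rewrite (cup_fun _ _ epq def_r) (bracket_fun _ _ def_p def_q) (cup_fun _ _ def_q epr).
  rewrite (bracket_fun _ _ def_p def_r) (sgn_shiftl def_p def_q).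
  rewrite (brack_cup cf cg ch (cocycle def_p uf) (cocycle def_q vg) (cocycle def_r wh)).
  by rewrite addrAC subrr add0r.
Qed.

Lemma hochschild_precalculus : precalculus cupH brH ioH lieH.
Proof.
split; [exact: cohomology_gerstenhaber|exact: ioH_bilinear|exact: lieH_bilinear| | |].
- move=> p q n u v w.
  have [p0|[m def_p]] := int_nonpos_or_shift p; first by rewrite (cohomology_nonpos u
    p0) !op0.
  have [q0|[l def_q]] := int_nonpos_or_shift q; first by rewrite (cohomology_nonpos v
    q0) !op0.
  have [f uf] := represents_ex u; have [g vg] := represents_ex v.
  have [x wx] := represents_ex w.
  apply: (represents_same (ioHP (cupHP uf vg) wx)
    (represents_gcastH (deg_iD p q n) (ioHP uf (ioHP vg wx)))).
  have def_r : p + q = (m + l).+2%:Z by lia.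
  exact: (castio_cup def_p def_q (erefl _) (erefl _) (deg_iD p q n) x (cup_fun f g
    def_p def_q) def_r).
- move=> p q n u v w.
  have [p0|[m def_p]] := int_nonpos_or_shift p; first by rewrite (cohomology_nonpos u
    p0) !op0.
  have [q0|[l def_q]] := int_nonpos_or_shift q; first by rewrite (cohomology_nonpos v
    q0) !op0.
  have [f uf] := represents_ex u; have [g vg] := represents_ex v.
  have [x wx] := represents_ex w.
  apply: (represents_same (lieHP (brHP uf vg) wx) (representsD
    (represents_gcastH (deg_lie1 p q n) (lieHP uf (lieHP vg wx)))
    (representsN (representsZ (sgn ((p - 1) * (q - 1)))
    (represents_gcastH (deg_lie2 p q n) (lieHP vg (lieHP uf wx))))))).
  have def_r : p + q - 1 = (m + l).+1%:Z by lia.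
  rewrite (sgn_shifts def_p def_q).
  exact: (castlie_brack def_p def_q (erefl _) (erefl _) (deg_lie1 p q n) (erefl _)
    (deg_lie2 p q n) x (bracket_fun f g def_p def_q) def_r).
- move=> p q n u v w.
  have [p0|[m def_p]] := int_nonpos_or_shift p; first by rewrite (cohomology_nonpos u
    p0) !op0.
  have [q0|[l def_q]] := int_nonpos_or_shift q; first by rewrite (cohomology_nonpos v
    q0) !op0.
  have [f uf] := represents_ex u; have [g vg] := represents_ex v.
  have [x wx] := represents_ex w.
  apply: (represents_eq (ioHP (brHP uf vg) wx) (representsD
    (represents_gcastH (deg_mix1 p q n) (ioHP uf (lieHP vg wx)))
    (representsN (representsZ (sgn (p * (q + 1)))
    (represents_gcastH (deg_mix2 p q n) (lieHP vg (ioHP uf wx))))))).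
  have def_r : p + q - 1 = (m + l).+1%:Z by lia.
  set M := n - (p + q - 1).
  have e5 : n - 2%:Z + 1 = n - 1 by lia.
  have e6 : M + (m + l)%N%:Z = n - 1 by rewrite /M; lia.
  have e7 : M + 1 + (m + l)%N%:Z = n by rewrite /M; lia.
  have e8 : M + 1 - 2%:Z + 1 = M by rewrite /M; lia.
  have cf := cochain_shift f def_p; have cg := cochain_shift g def_q.
  have x0 := represents_cycle wx.
  (* As x is a cycle, only the term of [castio_brack] with mu applied after the homotopy remains.
     Its minus sign cancels against d being minus the Lie derivative along mu. *)
  exists ((-1) ^+ (m * l) *: homotopy_chain m l f g (M + 1) x).
  have := castio_brack def_p def_q (erefl M) (erefl _) (deg_mix1 p q n) (erefl _)
    (deg_mix2 p q n) e5 e6 e7 e8 x (cocycle def_p uf) (cocycle def_q vg)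
    (bracket_fun f g def_p def_q) def_r.
  rewrite (dalphaN (subrK 1 n)) (dalphaN (erefl (M + 1))) x0 oppr0.
  rewrite (linear0_of (homotopy_chain_linear cf cg e6)) scaler0 sub0r scalerN opprK.
  rewrite (sgn_mixed def_p def_q) (linearZ_LR (dalpha _)) => e.
  by rewrite -[contraction (bracket f g) x]/(castio (erefl M) (bracket f g) x) e
    [X in X - _]addrC addrK.
Qed.

End HomologyOps.

Theorem theorem3p5 (k : comNzRingType)
  (char0 : forall n : nat, n%:R = 0 :> k -> n = 0%N)
  (A : homAssocAlgebra k) :
  exists (cup : forall p q : int,
            cohomology A p -> cohomology A q -> cohomology A (p + q))
         (br : forall p q : int,
            cohomology A p -> cohomology A q -> cohomology A (p + q - 1))
         (io : forall p n : int,
            cohomology A p -> hochschild_homology A n ->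
            hochschild_homology A (n - p))
         (lie : forall p n : int,
            cohomology A p -> hochschild_homology A n ->
            hochschild_homology A (n - p + 1)),
  [/\ forall (p q : int) (u : cohomology A p) (v : cohomology A q)
        (f : cochain A p) (g : cochain A q),
        represents u f -> represents v g ->
        represents (cup p q u v) (cup_product f g),
      forall (p q : int) (u : cohomology A p) (v : cohomology A q)
        (f : cochain A p) (g : cochain A q),
        represents u f -> represents v g ->
        represents (br p q u v) (bracket f g),
      forall (p n : int) (u : cohomology A p) (w : hochschild_homology A n)
        (f : cochain A p) (x : chain A n),
        represents u f -> represents w x ->
        represents (io p n u w) (contraction f x),
      forall (p n : int) (u : cohomology A p) (w : hochschild_homology A n)
        (f : cochain A p) (x : chain A n),
        represents u f -> represents w x ->
        represents (lie p n u w) (lie_derivative f x) &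
      precalculus cup br io lie].
Proof.
exists (@cupH k A), (@brH k A), (@ioH k A), (@lieH k A); split.
- exact: cupHP.
- exact: brHP.
- exact: ioHP.
- exact: lieHP.
- exact: hochschild_precalculus.
Qed.
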